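(* Let $K\ge2$, $\alpha\in(0,\infty)^K$, and let $H:\mathbb{R}^K\to\mathbb{R}$ satisfy (A1)–(A4) below at $\theta^*\in\Delta_{K-1}$. Let $Z=\{i:\theta^*_i=0\}$, $m=|Z|$, assume $m\le K-2$, and let $\lambda_k$ ($k\in Z$) be the KKT multipliers. Let $\widehat H(\theta)=H(\theta^* )-\mathrm{KL}(\theta^*|\theta)$ and, for $\theta\sim\mathrm{Dir}_\alpha$, let $\rho_n$ be the correlation between $e^{nH(\theta)}$ and $e^{n\widehat H(\theta)}$. Then as $n\to\infty$, $$\rho_n^2\to\rho^2:=\frac{|\det Q|^{1/2}|\det R|^{1/2}}{\left|\det\!\left(\frac{Q+R}{2}\right)\right|}\prod_{k\in Z}\left(\frac{4\lambda_k}{(\lambda_k+1)^2}\right)^{\alpha_k},$$ where $Q=U^\top\nabla^2H(\theta^* )U$ and $R=-U^\top D U$.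
   Context: $\Delta_{K-1}=\{\theta\in\mathbb{R}^K:\theta_i\ge0,\sum_i\theta_i=1\}$; $\mathrm{Dir}_\alpha$ is the Dirichlet distribution with density $\frac{1}{B(\alpha)}\prod_i\theta_i^{\alpha_i-1}$. $\mathrm{KL}(\theta^*|\theta)=\sum_k\theta^*_k\log(\theta^*_k/\theta_k)$ with $0\log0=0$, $0\log\infty=0$ (and $e^{-\infty}=0$). $D$ is the $K\times K$ diagonal matrix with $D_{ii}=1/\theta^*_i$ if $\theta^*_i>0$ and $D_{ii}=0$ if $\theta^*_i=0$ (the Hessian of $\theta\mapsto\mathrm{KL}(\theta^*|\theta)$ at $\theta=\theta^*$). Writing $\{i:\theta^*_i>0\}=\{j_1<\dots<j_{K-m}\}$, $U\in\mathbb{R}^{K\times(K-1-m)}$ has columns $e_{j_r}-e_{j_{K-m}}$, $r=1,\dots,K-1-m$. Conditions: (A1) $H$ attains its maximum over $\Delta_{K-1}$ only at $\theta^*$. (A2) $H$ is continuous on $\Delta_{K-1}$ and $C^2$ on an open neighborhood of $\theta^*$. There are unique KKT multipliers $\lambda_i\ge0$ ($i\in Z$), $\mu\in\mathbb{R}$ with $\nabla H(\theta^* )=-\sum_{i\in Z}\lambda_ie_i+\mu\mathbf{1}_K$. (A3) $\lambda_i>0$ for $i\in Z$. (A4) $d^\top\nabla^2H(\theta^* )d<0$ for all nonzero $d$ with $\mathbf{1}_K^\top d=0$, $d_i=0$ ($i\in Z$). *)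

(* Defs.v *)
From HB Require Import structures.
From mathcomp Require Import all_boot all_order all_algebra.
From mathcomp Require Import all_classical all_reals all_analysis.
Set Implicit Arguments.
Unset Strict Implicit.
Unset Printing Implicit Defensive.
Import Order.TTheory GRing.Theory Num.Theory.
Import numFieldNormedType.Exports.
Local Open Scope classical_set_scope.
Local Open Scope ring_scope.

Definition simplex (R : realType) (K : nat) : set 'rV[R]_K :=
  [set t | (forall i, 0 <= t ord0 i) /\ \sum_(i < K) t ord0 i = 1].
Arguments simplex : clear implicits.

Definition zset (R : realType) (K : nat) (ts : 'rV[R]_K) : {set 'I_K} :=
  [set i | ts ord0 i == 0].

Definition pderiv (R : realType) (K : nat) (f : 'rV[R]_K -> R) (i : 'I_K)
  (x : 'rV[R]_K) : R := 'D_(delta_mx 0 i) f x.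

Definition hessian (R : realType) (K : nat) (f : 'rV[R]_K -> R) (x : 'rV[R]_K)
  : 'M[R]_K := \matrix_(i < K, j < K) pderiv (pderiv f i) j x.

(* Iterated Lebesgue integral over R^n of a (nonnegative) extended-real
   function of the coordinates x_0, ..., x_{n-1}:
   int dx_0 int dx_1 ... int dx_{n-1} f(x). *)
Fixpoint iter_lebesgue (R : realType) (n : nat) (f : (nat -> R) -> \bar R)
  : \bar R :=
  match n with
  | 0 => f (fun _ => 0)
  | n'.+1 => (\int[@lebesgue_measure R]_x
               iter_lebesgue n' (fun v => f (fun i => if i is i'.+1 then v i' else x)))%E
  end.

Definition simplex_point (R : realType) (K : nat) (v : nat -> R) : 'rV[R]_K :=
  \row_(i < K) (if (i.+1 < K)%N then v i else 1 - \sum_(j < K.-1) v j).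

Definition dir_weight (R : realType) (K : nat) (alpha t : 'rV[R]_K) : R :=
  \prod_(i < K) (t ord0 i `^ (alpha ord0 i - 1)).

(* int_{Delta} g(theta) prod_i theta_i^(alpha_i-1) d theta, with respect to
   Lebesgue measure on the first K-1 coordinates (the standard
   parametrization of the Dirichlet density). *)
Definition dir_integral (R : realType) (K : nat) (alpha : 'rV[R]_K)
  (g : 'rV[R]_K -> R) : \bar R :=
  iter_lebesgue K.-1 (fun v =>
    if `[< simplex R K (simplex_point K v) >]
    then (g (simplex_point K v) * dir_weight alpha (simplex_point K v))%:E
    else 0%E).

Definition dir_expect (R : realType) (K : nat) (alpha : 'rV[R]_K)
  (g : 'rV[R]_K -> R) : R :=
  fine (dir_integral alpha g) / fine (dir_integral alpha (fun _ => 1)).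

Definition dir_cov (R : realType) (K : nat) (alpha : 'rV[R]_K)
  (X Y : 'rV[R]_K -> R) : R :=
  dir_expect alpha (fun t => X t * Y t)
  - dir_expect alpha X * dir_expect alpha Y.

Definition dir_corr (R : realType) (K : nat) (alpha : 'rV[R]_K)
  (X Y : 'rV[R]_K -> R) : R :=
  dir_cov alpha X Y
  / (Num.sqrt (dir_cov alpha X X) * Num.sqrt (dir_cov alpha Y Y)).

(* KL(thetastar | theta) with 0 log 0 = 0, 0 log oo = 0, and
   thetastar_k log(thetastar_k / 0) = +oo for thetastar_k > 0 (theta in the simplex). *)
Definition KL (R : realType) (K : nat) (ts t : 'rV[R]_K) : \bar R :=
  (\sum_(k < K | (0 < ts ord0 k)%R)
     (if (0 < t ord0 k)%R then (ts ord0 k * ln (ts ord0 k / t ord0 k))%:E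
      else +oo))%E.

Definition expE (R : realType) (x : \bar R) : R :=
  match x with
  | EFin r => expR r
  | _ => 0
  end.

Definition Hhat (R : realType) (K : nat) (H : 'rV[R]_K -> R) (ts : 'rV[R]_K)
  (t : 'rV[R]_K) : \bar R :=
  ((H ts)%:E - KL ts t)%E.

Definition supp_seq (R : realType) (K : nat) (ts : 'rV[R]_K) : seq 'I_K :=
  [seq i <- enum 'I_K | 0 < ts ord0 i].

Definition Umat (R : realType) (K : nat) (ts : 'rV[R]_K)
  : 'M[R]_(K, K.-1 - #|zset ts|) :=
  \matrix_(i < K, r < K.-1 - #|zset ts|)
    ((i == nth i (supp_seq ts) r)%:R
     - (i == nth i (supp_seq ts) (size (supp_seq ts)).-1)%:R).

Definition Dmat (R : realType) (K : nat) (ts : 'rV[R]_K) : 'M[R]_K :=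
  \matrix_(i < K, j < K)
    (if i == j then (if 0 < ts ord0 i then (ts ord0 i)^-1 else 0) else 0).

(* Main.v *)
Require Import Defs.
From HB Require Import structures.
From mathcomp Require Import all_boot all_order all_algebra.
From mathcomp Require Import all_classical all_reals all_analysis.
From mathcomp Require Import measurable_realfun.
From mathcomp Require Import ring lra.
Import Order.TTheory GRing.Theory Num.Theory.
Import numFieldNormedType.Exports.
Local Open Scope classical_set_scope.
Local Open Scope ring_scope.
Set Implicit Arguments.
Unset Strict Implicit.
Unset Printing Implicit Defensive.

(* Laplace's method.  At its maximum ts both exp(H) and exp(- KL(ts | .)) decrease
   linearly in the coordinates vanishing at ts (at rates lambda_k and 1) and
   quadratically along the face of ts.  Rescaling these coordinates by 1/n and
   1/sqrt n, the integrals of E^n, for E one of the three pairwise products of the two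
   functions, converge by dominated convergence, up to the common factor
   n^s (max E)^-n, to a product of Gamma integrals and of a Gaussian integral on the
   face; rates and Hessians add up under products.  The product of the two
   expectations carries one more factor n^-s, so it does not contribute to the limit
   of the covariances, and rho_n^2 tends to the corresponding ratio of determinants
   and of powers of 2 lambda_k, lambda_k + 1 and 2. *)

(** * Iterated Lebesgue integrals *)

(** The weight may be singular where a coordinate vanishes, so the dominating functions must carry
    Gamma kernels and even the finiteness of the total mass needs an argument. The chart omits a
    coordinate at which ts is positive: it stays positive near ts, and the coordinates vanishing at
    ts become genuine half-line variables. The integrals being iterated, changes of variables and
    the Gaussian determinant are obtained one coordinate at a time. Only the rates and the Hessians
    distinguish the limits of the three products: the values of the weight at ts, the Gamma values
    and the powers of pi occur squared in the numerator and once in each factor of the denominator.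
    Both functions have the same maximum exp(H(ts)), so the exponential normalisations cancel as
    well. *)

Definition vcons (R : realType) (x : R) (v : nat -> R) : nat -> R :=
  fun i => if i is i'.+1 then v i' else x.

(* Borel measurability of a function of a sequence, tested on measurable families of
   sequences since nat -> R carries no canonical sigma-algebra. *)
Definition bfun (R : realType) (f : (nat -> R) -> \bar R) : Prop :=
  forall d (T : measurableType d) (u : T -> nat -> R),
    (forall i, measurable_fun [set: T] (fun t => u t i)) ->
    measurable_fun [set: T] (fun t => f (u t)).

Lemma iter_lebesgueS (R : realType) (n : nat) (f : (nat -> R) -> \bar R) :
  iter_lebesgue n.+1 f
  = (\int[@lebesgue_measure R]_x iter_lebesgue n (fun v => f (vcons x v)))%E.
Proof. by []. Qed.

Lemma iter_lebesgue_ge0 (R : realType) (n : nat) (f : (nat -> R) -> \bar R) :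
  (forall v, 0 <= f v)%E -> (0 <= iter_lebesgue n f)%E.
Proof.
elim: n f => [|n IH] f f0 //=.
by apply: integral_ge0 => x _; apply: IH => v.
Qed.

(** Measurability in a parameter is what survives the induction on n: the outermost variable joins
    the parameter, and Tonelli integrates it out. *)
Lemma measurable_iter_lebesgue (R : realType) (n : nat) d (T : measurableType d)
    (F : T -> (nat -> R) -> \bar R) :
  (forall d' (T' : measurableType d') (a : T' -> T) (u : T' -> nat -> R),
     measurable_fun [set: T'] a ->
     (forall i, measurable_fun [set: T'] (fun t => u t i)) ->
     measurable_fun [set: T'] (fun t => F (a t) (u t))) ->
  (forall t v, 0 <= F t v)%E ->
  measurable_fun [set: T] (fun t => iter_lebesgue n (F t)).
Proof.
elim: n d T F => [|n IH] d T F mF F0.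
  by apply: (mF _ T id (fun _ _ => 0)).
pose G (z : T * measurableTypeR R) := iter_lebesgue n (fun v => F z.1 (vcons z.2 v)).
have mG : measurable_fun [set: T * measurableTypeR R] G.
  apply: (IH _ _ (fun z v => F z.1 (vcons z.2 v))) => // d' T' a u ma mu.
  apply: (mF _ T' (fst \o a) (fun t => vcons (a t).2 (u t))).
    exact: measurableT_comp.
  case=> [|i]; last exact: mu.
  exact: (measurableT_comp measurable_snd ma).
have := @measurable_fun_fubini_tonelli_F _ _ _ _ R (@lebesgue_measure R) G mG.
by apply => z; apply: iter_lebesgue_ge0.
Qed.

Lemma bfun_vcons (R : realType) (f : (nat -> R) -> \bar R) (x : R) :
  bfun f -> bfun (fun v => f (vcons x v)).
Proof.
by move=> bf d T u mu; apply: (bf _ _ (fun t => vcons x (u t))) => -[|i] //=.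
Qed.

Lemma measurable_iter_vcons (R : realType) (n : nat) (f : (nat -> R) -> \bar R) :
  bfun f -> (forall v, 0 <= f v)%E ->
  measurable_fun [set: measurableTypeR R]
    (fun x => iter_lebesgue n (fun v => f (vcons x v))).
Proof.
move=> bf f0; apply: (@measurable_iter_lebesgue R n _ (measurableTypeR R)
  (fun x v => f (vcons x v))) => // d' T' a u ma mu.
by apply: (bf _ _ (fun t => vcons (a t) (u t))) => -[|i] //=.
Qed.

Lemma le_iter_lebesgue (R : realType) (n : nat) (f g : (nat -> R) -> \bar R) :
  bfun f -> bfun g -> (forall v, 0 <= f v)%E -> (forall v, f v <= g v)%E ->
  (iter_lebesgue n f <= iter_lebesgue n g)%E.
Proof.
elim: n f g => [|n IH] f g bf bg f0 fg; first exact: fg.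
rewrite !iter_lebesgueS.
apply: ge0_le_integral => //.
- by move=> x _; apply: iter_lebesgue_ge0.
- exact: measurable_iter_vcons.
- apply: measurable_iter_vcons => // v; exact: le_trans (fg v).
- by move=> x _; apply: IH => //; exact: bfun_vcons.
Qed.

Lemma iter_lebesgueD (R : realType) (n : nat) (f g : (nat -> R) -> \bar R) :
  bfun f -> bfun g -> (forall v, 0 <= f v)%E -> (forall v, 0 <= g v)%E ->
  iter_lebesgue n (fun v => f v + g v)%E
  = (iter_lebesgue n f + iter_lebesgue n g)%E.
Proof.
elim: n f g => [|n IH] f g bf bg f0 g0 //; rewrite !iter_lebesgueS.
rewrite -ge0_integralD//.
- apply: eq_integral => x _.
  rewrite -(IH (fun v => f (vcons x v)) (fun v => g (vcons x v)))//; exact: bfun_vcons.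
- by move=> x _; apply: iter_lebesgue_ge0.
- exact: measurable_iter_vcons.
- by move=> x _; apply: iter_lebesgue_ge0.
- exact: measurable_iter_vcons.
Qed.

Lemma iter_lebesgueZ (R : realType) (n : nat) (k : R) (f : (nat -> R) -> \bar R) :
  0 <= k -> bfun f -> (forall v, 0 <= f v)%E ->
  iter_lebesgue n (fun v => k%:E * f v)%E = (k%:E * iter_lebesgue n f)%E.
Proof.
move=> k0; elim: n f => [|n IH] f bf f0 //; rewrite !iter_lebesgueS.
rewrite -ge0_integralZl_EFin//.
- apply: eq_integral => x _.
  by rewrite -(IH (fun v => f (vcons x v)))//; exact: bfun_vcons.
- by move=> x _; apply: iter_lebesgue_ge0.
- exact: measurable_iter_vcons.
Qed.

Lemma eq_iter_lebesgue (R : realType) (n : nat) (f g : (nat -> R) -> \bar R) :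
  f =1 g -> iter_lebesgue n f = iter_lebesgue n g.
Proof. by move=> /funext ->. Qed.

Lemma bfun_EFin (R : realType) (f : (nat -> R) -> R) :
  (forall d (T : measurableType d) (u : T -> nat -> R),
    (forall i, measurable_fun [set: T] (fun t => u t i)) ->
    measurable_fun [set: T] (fun t => f (u t))) ->
  bfun (fun v => (f v)%:E).
Proof. by move=> mf d T u mu; apply/measurable_EFinP; exact: mf. Qed.

(** The constant C is carried along because the factor in the outer variable is a constant for the
    inner integrals. *)
Lemma iter_lebesgue_prod (R : realType) (n : nat) (C : R) (g : nat -> R -> R) :
  0 <= C -> (forall i x, 0 <= g i x) ->
  (forall i, measurable_fun [set: R] (g i)) ->
  iter_lebesgue n (fun v => (C * \prod_(i < n) g i (v i))%:E)
  = (C%:E * \prod_(i < n) \int[@lebesgue_measure R]_x (g i x)%:E)%E.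
Proof.
move=> C0; elim: n C C0 g => [|n IH] C C0 g g0 mg.
  by rewrite /= !big_ord0 mule1 mulr1.
rewrite iter_lebesgueS big_ord_recl muleA.
under eq_integral => x _.
  under eq_iter_lebesgue => v do rewrite big_ord_recl mulrA /=.
  rewrite (IH (C * g 0%N x) _ (fun i => g i.+1))//; last exact: mulr_ge0.
  rewrite /= EFinM -muleA muleCA muleC.
  over.
rewrite ge0_integralZl//.
- by rewrite muleAC.
- by apply/measurable_EFinP; exact: mg.
- by move=> x _; rewrite lee_fin.
- rewrite mule_ge0 ?lee_fin//; apply: prode_ge0 => i _.
  by apply: integral_ge0 => x _; rewrite lee_fin.
Qed.

(** Lebesgue measure and r times its image under x -> a + r x agree on half-open intervals, hence
    everywhere. *)
Lemma integral_affine (R : realType) (a r : R) (f : R -> \bar R) :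
  0 < r -> measurable_fun [set: R] f -> (forall x, 0 <= f x)%E ->
  (r%:E * \int[@lebesgue_measure R]_x f (a + r * x)%R)%E
  = (\int[@lebesgue_measure R]_x f x)%E.
Proof.
move=> r0 mf f0.
pose phi : measurableTypeR R -> measurableTypeR R := fun x => a + r * x.
have mphi : measurable_fun [set: measurableTypeR R] phi.
  by apply: measurable_funD => //; apply: measurable_funM.
pose p := NngNum (ltW r0).
pose m1f : {measure set (measurableTypeR R) -> \bar R} :=
  mscale p (pushforward (@lebesgue_measure R) phi).
pose m1 := m1f mphi.
have E : forall A, measurable A -> @lebesgue_measure R A = m1 A.
  apply: lebesgue_measure_unique => _ [[s t] _ <-] /=.
  rewrite /= /mscale /= /pushforward.
  have -> : phi @^-1` `]s, t]%classic = `](s - a) / r, (t - a) / r]%classic.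
    apply/seteqP; split => x; rewrite /= !in_itv /= /phi;
      rewrite ltr_pdivrMr// ler_pdivlMr// (mulrC x) ltrBlDl lerBrDl //.
  rewrite !lebesgue_measure_itv /= !lte_fin ltr_pM2r ?invr_gt0// ltrD2r.
  case: ifP => _; last by rewrite mule0.
  by rewrite -!EFinD -EFinM; congr EFin; field; rewrite gt_eqF.
rewrite [RHS](@eq_measure_integral _ _ _ _ m1); last by move=> A mA _; exact: E.
rewrite ge0_integral_mscale//; congr (_ * _)%E.
by rewrite ge0_integral_pushforward//.
Qed.

Lemma integral_reflect (R : realType) (c : R) (f : R -> \bar R) :
  measurable_fun [set: R] f -> (forall x, 0 <= f x)%E ->
  (\int[@lebesgue_measure R]_x f (c - x)%R)%E
  = (\int[@lebesgue_measure R]_x f x)%E.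
Proof.
move=> mf f0.
have mN : measurable_fun [set: measurableTypeR R]
  (-%R : _ -> measurableTypeR R) by exact: oppr_measurable.
rewrite -(integral_affine c ltr01 mf f0) mul1e.
under [RHS]eq_integral do rewrite mul1r.
have mg : measurable_fun [set: measurableTypeR R] (fun x => f (c + x)%R).
  by apply: (measurableT_comp mf); exact: measurable_funD.
transitivity (\int[pushforward (@lebesgue_measure R) (-%R : _ -> measurableTypeR R)]_x f (c + x)%R)%E.
  by rewrite ge0_integral_pushforward.
by apply: eq_measure_integral => A mA _; exact: lebesgue_measureN.
Qed.

(** The shift must vanish from index n on, since integration over no variable evaluates f at the
    zero sequence. *)
Lemma iter_lebesgue_affine (R : realType) (n : nat) (a r : nat -> R)
    (f : (nat -> R) -> \bar R) :
  (forall i, 0 < r i) -> (forall i, (n <= i)%N -> a i = 0) ->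
  bfun f -> (forall v, 0 <= f v)%E ->
  ((\prod_(i < n) r i)%:E * iter_lebesgue n (fun v => f (fun i => a i + r i * v i)%R))%E
  = iter_lebesgue n f.
Proof.
elim: n a r f => [|n IH] a r f r0 a0 bf f0.
  rewrite big_ord0 mul1e /=; congr f; apply/funext => i.
  by rewrite a0// mulr0 addr0.
rewrite big_ord_recl mulrC EFinM -muleA !iter_lebesgueS.
pose h x := iter_lebesgue n (fun v => f (vcons x v)).
have h0 x : (0 <= h x)%E by exact: iter_lebesgue_ge0.
have mh : measurable_fun [set: R] h by exact: measurable_iter_vcons.
rewrite -[RHS](@integral_affine _ (a 0%N) (r 0%N) h)//.
rewrite muleCA; congr (_ * _)%E.
rewrite -ge0_integralZl_EFin//.
- apply: eq_integral => x _.
  have bfx := bfun_vcons (a 0%N + r 0%N * x) bf.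
  have a0' i : (n <= i)%N -> a i.+1 = 0 by move=> ni; rewrite a0.
  rewrite /h -(IH (fun i => a i.+1) (fun i => r i.+1) _ _ a0' bfx)//.
  congr (_ * _)%E; apply: eq_iter_lebesgue => v; congr f.
  by apply/funext => -[|i].
- by move=> x _; exact: iter_lebesgue_ge0.
- pose g (v : nat -> R) := f (fun i => a i + r i * v i).
  apply: (@measurable_iter_vcons _ _ g) => [|v]; last exact: f0.
  move=> d T u mu; rewrite /g.
  apply: (bf _ _ (fun t i => a i + r i * u t i)) => i.
  by apply: measurable_funD => //; apply: measurable_funM.
- by apply: prodr_ge0 => i _; exact: ltW.
Qed.

(** A dominating function in product form is preserved by the induction: integrating the inner
    variables out leaves C g_0(x) times a finite constant, which is again integrable. *)
Lemma iter_lebesgue_dct (R : realType) (n : nat)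
    (F : nat -> (nat -> R) -> \bar R) (F0 : (nat -> R) -> \bar R)
    (g : nat -> R -> R) (C : R) :
  0 <= C -> (forall i x, 0 <= g i x) ->
  (forall i, measurable_fun [set: R] (g i)) ->
  (forall i, \int[@lebesgue_measure R]_x (g i x)%:E < +oo)%E ->
  (forall k, bfun (F k)) -> (forall k v, 0 <= F k v)%E ->
  (forall k v, F k v <= (C * \prod_(i < n) g i (v i))%:E)%E ->
  (forall v, F k v @[k --> \oo] --> F0 v) ->
  iter_lebesgue n (F k) @[k --> \oo] --> iter_lebesgue n F0.
Proof.
elim: n F F0 g C => [|n IH] F F0 g C C0 g0 mg gfin bF F0' Fg cF.
  exact: cF.
rewrite iter_lebesgueS; under eq_fun do rewrite iter_lebesgueS.
pose P := (\prod_(i < n) \int[@lebesgue_measure R]_x (g i.+1 x)%:E)%E.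
have P0 : (0 <= P)%E.
  by apply: prode_ge0 => i _; apply: integral_ge0 => x _; rewrite lee_fin.
have Pfin : P \is a fin_num.
  apply: prode_fin_num => i _; rewrite ge0_fin_numE//.
  by apply: integral_ge0 => x _; rewrite lee_fin.
pose G x := ((C * g 0%N x)%:E * P)%E.
have Fle k x v : (F k (vcons x v) <= (C * g 0%N x * \prod_(i < n) g i.+1 (v i))%:E)%E.
  by have := Fg k (vcons x v); rewrite big_ord_recl /= mulrA.
have bprod D x : bfun (fun v : nat -> R => (D * g 0%N x * \prod_(i < n) g i.+1 (v i))%:E).
  apply: bfun_EFin => d T u mu; apply: measurable_funM => //.
  by apply: measurable_prod => i _; exact: measurableT_comp.
have FG k x : (iter_lebesgue n (fun v => F k (vcons x v)) <= G x)%E.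
  rewrite /G /P -(@iter_lebesgue_prod _ _ _ (fun i => g i.+1))//; last exact: mulr_ge0.
  by apply: le_iter_lebesgue => //; exact: bfun_vcons.
apply: (@dominated_cvg _ _ _ (@lebesgue_measure R) setT measurableT
  (fun k x => iter_lebesgue n (fun v => F k (vcons x v))) _ G) => //.
- by move=> k; exact: measurable_iter_vcons.
- move=> x _; apply: (IH (fun k v => F k (vcons x v)) _ (fun i => g i.+1) (C * g 0%N x)) => //.
    exact: mulr_ge0.
  by move=> k; exact: bfun_vcons.
- by move=> x _; rewrite /G fin_numM.
- apply/integrableP; split.
    apply: emeasurable_funM => //; apply/measurable_EFinP.
    by apply: measurable_funM => //; exact: mg.
  under eq_integral => x _.
    rewrite gee0_abs; last by rewrite /G mule_ge0// lee_fin mulr_ge0.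
    rewrite /G EFinM -muleA (muleC _ P) muleA.
    over.
  rewrite ge0_integralZl//.
  + by rewrite lte_mul_pinfty// ?mule_ge0 ?lee_fin// fin_numM.
  + by apply/measurable_EFinP; exact: mg.
  + by move=> x _; rewrite lee_fin.
  + by rewrite mule_ge0// lee_fin.
- by move=> k x _; rewrite gee0_abs//; exact: iter_lebesgue_ge0.
Qed.

Definition vins (R : realType) (j : nat) (x : R) (v : nat -> R) : nat -> R :=
  fun i => if (i < j)%N then v i else if i == j then x else v i.-1.

(** Tonelli: for j = 0 the outer variable is exchanged with the others one at a time; a larger j
    leaves the outermost variable untouched and recurses. *)
Lemma iter_lebesgue_vins (R : realType) (n j : nat) (f : (nat -> R) -> \bar R) :
  (j <= n)%N -> bfun f -> (forall v, 0 <= f v)%E ->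
  iter_lebesgue n.+1 f
  = iter_lebesgue n (fun v => \int[@lebesgue_measure R]_x f (vins j x v))%E.
Proof.
elim: j n f => [|j IHj] n f jn bf f0.
  have -> : (fun v => \int[@lebesgue_measure R]_x f (vins 0 x v))%E
    = (fun v => \int[@lebesgue_measure R]_x f (vcons x v))%E.
    apply/funext => v; apply: eq_integral => x _; congr f.
    by apply/funext => -[|i].
  elim: n f {jn} bf f0 => [|n IH] f bf f0 //.
  pose h (x y : measurableTypeR R) := iter_lebesgue n (fun w => f (vcons x (vcons y w))).
  have mh : measurable_fun [set: measurableTypeR R * measurableTypeR R]
      (fun z => h z.1 z.2).
    apply: (@measurable_iter_lebesgue R n _ _ (fun z w => f (vcons z.1 (vcons z.2 w)))) => //.
    move=> d' T' a u ma mu.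
    apply: (bf _ _ (fun t => vcons (a t).1 (vcons (a t).2 (u t)))) => -[|[|i]] //=.
      exact: (measurableT_comp measurable_fst ma).
    exact: (measurableT_comp measurable_snd ma).
  transitivity (\int[@lebesgue_measure R]_x \int[@lebesgue_measure R]_y h x y)%E.
    by [].
  rewrite (fubini_tonelli (fun z => h z.1 z.2))//=; last first.
    by move=> z; exact: iter_lebesgue_ge0.
  apply: eq_integral => y _.
  pose g (u : nat -> R) := f (vcons (u 0%N) (vcons y (fun i => u i.+1))).
  apply: (IH g) => [|v]; last exact: f0.
  move=> d T u mu; rewrite /g.
  by apply: (bf _ _ (fun t => vcons (u t 0%N) (vcons y (fun i => u t i.+1)))) => -[|[|i]] //=.
case: n jn => [//|n] jn.
rewrite iter_lebesgueS [RHS]iter_lebesgueS; apply: eq_integral => y _.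
rewrite (IHj n)//; last exact: bfun_vcons.
apply: eq_iter_lebesgue => v; apply: eq_integral => x _; congr f.
apply/funext => -[|i] //=; rewrite /vins /= ltnS eqSS.
by case: (ltngtP i j) => // ij; case: i ij.
Qed.

(** * Charts of the simplex *)

Definition rvfun (R : realType) K (F : 'rV[R]_K -> \bar R) : Prop :=
  forall d (T : measurableType d) (f : T -> 'rV[R]_K),
    (forall i, measurable_fun [set: T] (fun t => f t ord0 i)) ->
    measurable_fun [set: T] (fun t => F (f t)).

(** The j-th coordinate is recovered from the sum. Varying j provides a chart whose omitted
    coordinate stays away from 0, be it a large coordinate or one in the support of ts. *)
Definition chart (R : realType) N (j : 'I_N.+1) (v : nat -> R) : 'rV[R]_N.+1 :=
  \row_i (if unlift j i is Some k then v k else 1 - \sum_(k < N) v k).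

Lemma chart_lift (R : realType) N (j : 'I_N.+1) (v : nat -> R) (k : 'I_N) :
  chart j v ord0 (lift j k) = v k.
Proof. by rewrite mxE liftK. Qed.

Lemma chart_id (R : realType) N (j : 'I_N.+1) (v : nat -> R) :
  chart j v ord0 j = 1 - \sum_(k < N) v k.
Proof. by rewrite mxE unlift_none. Qed.

Lemma sum_chart (R : realType) N (j : 'I_N.+1) (v : nat -> R) :
  \sum_i chart j v ord0 i = 1.
Proof.
rewrite (bigD1_ord j)//= chart_id; under eq_bigr do rewrite chart_lift.
by rewrite subrK.
Qed.

Lemma bfun_chart (R : realType) N (j : 'I_N.+1) (F : 'rV[R]_N.+1 -> \bar R) :
  rvfun F -> bfun (fun v => F (chart j v)).
Proof.
move=> mF d T u mu; apply: mF => i; under eq_fun do rewrite mxE.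
case: (unlift j i) => [k|]; first exact: mu.
apply: measurable_funB => //; apply: measurable_sum => k; exact: mu.
Qed.

Lemma simplex_pointE (R : realType) (N : nat) :
  @simplex_point R N.+1 = @chart R N ord_max.
Proof.
apply/funext => v; apply/rowP => i; rewrite !mxE /= ltnS.
case: unliftP => [k ->|->]; last by rewrite ltnn.
by rewrite lift_max ltn_ord.
Qed.

Lemma vins_bump (R : realType) (j k : nat) (x : R) (v : nat -> R) :
  vins j x v (bump j k) = v k.
Proof.
rewrite /vins /bump; case: (leqP j k) => jk /=; last by rewrite add0n jk.
by rewrite add1n ltnNge (leq_trans jk (leqnSn k)) /= gtn_eqF.
Qed.

Lemma sum_vins (R : realType) (n : nat) (j : 'I_n.+1) (x : R) (v : nat -> R) :
  \sum_(k < n.+1) vins j x v k = x + \sum_(k < n) v k.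
Proof.
rewrite (bigD1_ord j)//=; congr (_ + _); first by rewrite /vins ltnn eqxx.
by apply: eq_bigr => k _; exact: vins_bump.
Qed.

(* The other coordinates being fixed, exchanging the omitted coordinate with the j-th
   one is a reflection of the line. *)
Lemma iter_lebesgue_chart (R : realType) N (j : 'I_N.+1)
    (F : 'rV[R]_N.+1 -> \bar R) :
  rvfun F -> (forall t, 0 <= F t)%E ->
  iter_lebesgue N (fun v => F (simplex_point N.+1 v))
  = iter_lebesgue N (fun v => F (chart j v)).
Proof.
move=> mF F0; rewrite simplex_pointE.
have [->//|jmax] := eqVneq j ord_max.
have jN : (j < N)%N.
  by rewrite ltn_neqAle -ltnS ltn_ord andbT; apply: contra jmax => /eqP jN; apply/eqP/val_inj.
case: N j F mF F0 jmax jN => // n j F mF F0 jmax jN.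
rewrite (@iter_lebesgue_vins _ n j)//; last exact: bfun_chart.
rewrite (@iter_lebesgue_vins _ n n)//; last exact: bfun_chart.
apply: eq_iter_lebesgue => v.
have mj : measurable_fun [set: R] (fun x => F (chart ord_max (vins j x v))).
  apply: (@bfun_chart _ _ ord_max F mF _ (measurableTypeR R) (fun x => vins j x v)) => i.
  by rewrite /vins; case: (i < j)%N => //; case: (i == j).
rewrite -(integral_reflect (1 - \sum_(k < n) v k) mj)//.
have jn : (j <= n)%N by [].
have E y : \sum_(k < n.+1) vins j y v k = y + \sum_(k < n) v k.
  exact: (sum_vins (Ordinal jN)).
have E' y : \sum_(k < n.+1) vins n y v k = y + \sum_(k < n) v k.
  exact: (sum_vins ord_max).
apply: eq_integral => x _; congr F; apply/rowP => i; rewrite !mxE E E'.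
case: (unliftP j i) => [k ->|->]; last first.
  case: unliftP => [k ek|e]; last by rewrite -e eqxx in jmax.
  have -> : k = j :> nat by rewrite -(lift_max k) -ek.
  by rewrite /vins ltnn eqxx; ring.
have kn : (k <= n)%N by rewrite -ltnS.
case: unliftP => [k' ek|ek].
  have bk : bump j k = k' by rewrite -(lift_max k') -ek.
  rewrite -bk vins_bump.
  have k'n : (k < n)%N.
    rewrite ltn_neqAle kn andbT; apply/eqP => kn'; move: (ltn_ord k').
    by rewrite -bk kn' /bump jn add1n ltnn.
  by rewrite /vins k'n.
have : bump j k = n.+1 by have := congr1 val ek.
rewrite /bump => bk; have -> : k = n :> nat.
  by case: (j <= k)%N bk => [|kk]; [case|move: kn; rewrite -[k : nat]add0n kk ltnn].
by rewrite /vins ltnn eqxx; ring.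
Qed.

(** * Quadratic forms and Gaussian integrals *)

Definition qf (R : realType) (n : nat) (M : 'M[R]_n) (x : 'rV[R]_n) : R :=
  (x *m M *m x^T) ord0 ord0.

Definition posdef (R : realType) (n : nat) (M : 'M[R]_n) : Prop :=
  forall x, x != 0 -> 0 < qf M x.

Lemma qf0 (R : realType) (n : nat) (M : 'M[R]_n) : qf M 0 = 0.
Proof. by rewrite /qf mul0mx mul0mx mxE. Qed.

Lemma qfE (R : realType) (n : nat) (M : 'M[R]_n) (x : 'rV[R]_n) :
  qf M x = \sum_i \sum_j x ord0 i * M i j * x ord0 j.
Proof.
rewrite /qf mxE exchange_big /=; apply: eq_bigr => j _.
by rewrite !mxE mulr_suml; apply: eq_bigr => i _.
Qed.

Definition schur (R : realType) (n : nat) (M : 'M[R]_(1 + n)) : R :=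
  (ulsubmx M - ursubmx M *m invmx (drsubmx M) *m (ursubmx M)^T) ord0 ord0.

(** Translating v by x times this vector removes the cross terms of the form. *)
Definition schur_shift (R : realType) (n : nat) (M : 'M[R]_(1 + n)) : 'rV[R]_n :=
  ursubmx M *m invmx (drsubmx M).

Lemma sym_drsubmx (R : realType) (n : nat) (M : 'M[R]_(1 + n)) :
  M^T = M -> (drsubmx M)^T = drsubmx M.
Proof. by move=> sM; rewrite trmx_drsub sM. Qed.

Lemma sym_dlsubmx (R : realType) (n : nat) (M : 'M[R]_(1 + n)) :
  M^T = M -> dlsubmx M = (ursubmx M)^T.
Proof. by move=> sM; rewrite trmx_ursub sM. Qed.

Lemma qf_schur (R : realType) (n : nat) (M : 'M[R]_(1 + n)) (x : R) (v : 'rV[R]_n) :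
  M^T = M -> drsubmx M \in unitmx ->
  qf M (row_mx x%:M v)
  = x ^+ 2 * schur M + qf (drsubmx M) (v + x *: schur_shift M).
Proof.
move=> sM uM; rewrite /qf /schur.
set a := ulsubmx M; set c := ursubmx M; set M' := drsubmx M.
set w := schur_shift M.
have wM : w *m M' = c by rewrite /w /schur_shift mulmxKV.
have sM' : M'^T = M' by exact: sym_drsubmx.
have Mw : M' *m w^T = c^T by rewrite -[in RHS]wM [in RHS]trmx_mul sM'.
rewrite -{1}[M]submxK -/a -/c -/M' (sym_dlsubmx sM) -/c.
rewrite mul_row_block tr_row_mx mul_row_col tr_scalar_mx.
rewrite [(v + x *: w)^T]linearD /= [(x *: w)^T]linearZ /=.
rewrite !mul_scalar_mx !mulmxDl !mulmxDr -!scalemxAl -!scalemxAr -?scalemxAl wM.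
rewrite -[v *m M' *m w^T]mulmxA Mw !mul_mx_scalar.
rewrite -[ursubmx M *m invmx (drsubmx M)]/w.
have -> : c *m w^T = w *m c^T by rewrite -Mw mulmxA wM.
move: (v *m c^T) (c *m v^T) (v *m M' *m v^T) (w *m c^T) => A B C D.
by rewrite !mxE; ring.
Qed.

(** Right multiplication by the unipotent matrix [L] clears the lower left block. *)
Lemma det_schur (R : realType) (n : nat) (M : 'M[R]_(1 + n)) :
  M^T = M -> drsubmx M \in unitmx -> \det M = schur M * \det (drsubmx M).
Proof.
move=> sM uM.
pose L : 'M[R]_(1 + n) := block_mx 1%:M 0 (- (invmx (drsubmx M) *m (ursubmx M)^T)) 1%:M.
have dL : \det L = 1 by rewrite det_lblock !det1 mulr1.
have -> : \det M = \det (M *m L) by rewrite det_mulmx dL mulr1.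
rewrite -{1}[M]submxK (sym_dlsubmx sM) mulmx_block.
rewrite !mulmx1 !mulmx0 !add0r !mulmxN mulKVmx// subrr det_ublock det_mx11.
by rewrite mulmxA.
Qed.

Lemma posdef_drsubmx (R : realType) (n : nat) (M : 'M[R]_(1 + n)) :
  posdef M -> posdef (drsubmx M).
Proof.
move=> pM v v0; have := pM (row_mx 0 v).
rewrite /qf -{1}[M]submxK mul_row_block tr_row_mx mul_row_col.
rewrite !mul0mx !add0r trmx0 mulmx0 add0r; apply.
by apply: contra v0 => /eqP; rewrite -row_mx0 => /eq_row_mx[_ ->].
Qed.

Lemma schur_gt0 (R : realType) (n : nat) (M : 'M[R]_(1 + n)) :
  M^T = M -> posdef M -> drsubmx M \in unitmx -> 0 < schur M.
Proof.
move=> sM pM uM; have := pM (row_mx 1%:M (- schur_shift M)).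
rewrite qf_schur// scale1r addNr qf0 addr0 expr1n mul1r; apply.
apply/eqP; rewrite -row_mx0 => /eq_row_mx[/matrixP /(_ ord0 ord0)].
by rewrite !mxE /= => /eqP; rewrite oner_eq0.
Qed.

Lemma posdef_det_gt0 (R : realType) (n : nat) (M : 'M[R]_n) :
  M^T = M -> posdef M -> 0 < \det M.
Proof.
elim: n M => [|n IH] M sM pM; first by rewrite det_mx00.
have d' : 0 < \det (@drsubmx _ 1 n 1 n M).
  by apply: IH; [exact: sym_drsubmx|exact: posdef_drsubmx].
have u' : @drsubmx _ 1 n 1 n M \in unitmx by rewrite unitmxE unitfE gt_eqF.
by rewrite (@det_schur _ n)// mulr_gt0// schur_gt0.
Qed.

(** Cauchy-Schwarz for the form of M: x_i is the M-product of x with y = e_i M^-1, so x_i^2 is at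
    most qf M y times qf M x. Summing over i bounds the Euclidean norm. *)
Lemma posdef_coercive (R : realType) (n : nat) (M : 'M[R]_n) :
  M^T = M -> posdef M ->
  exists2 c : R, 0 < c & forall x : 'rV[R]_n, c * \sum_i x ord0 i ^+ 2 <= qf M x.
Proof.
move=> sM pM; have uM : M \in unitmx.
  by rewrite unitmxE unitfE gt_eqF// posdef_det_gt0.
have H i : {k : R | 0 < k & forall x : 'rV[R]_n, x ord0 i ^+ 2 <= k * qf M x}.
  pose y : 'rV[R]_n := delta_mx 0 i *m invmx M.
  have yM : y *m M = delta_mx 0 i by rewrite /y mulmxKV.
  have y0 : y != 0.
    apply/eqP => y0; move: yM; rewrite y0 mul0mx => /rowP /(_ i) /eqP.
    by rewrite !mxE !eqxx /= eq_sym oner_eq0.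
  exists (qf M y); first exact: pM.
  move=> x; have q0 := pM y y0.
  have yx : (y *m M *m x^T) ord0 ord0 = x ord0 i.
    by rewrite yM -rowE !mxE.
  have xy : (x *m M *m y^T) ord0 ord0 = x ord0 i.
    have e : (y *m M *m x^T)^T = x *m M *m y^T by rewrite !trmx_mul trmxK sM mulmxA.
    by rewrite -yx -e mxE.
  (* This t minimises the form at x - t y; its nonnegativity there is the Cauchy-Schwarz
     inequality. *)
  pose t := x ord0 i / qf M y.
  have : 0 <= qf M (x - t *: y).
    have [->|z0] := eqVneq (x - t *: y) 0; first by rewrite qf0.
    exact/ltW/pM.
  have -> : qf M (x - t *: y) = qf M x - 2 * t * x ord0 i + t ^+ 2 * qf M y.
    rewrite /qf [(x - t *: y)^T]linearB /= [(t *: y)^T]linearZ /= !mulmxBl !mulmxBr.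
    rewrite -!scalemxAl -!scalemxAr -?scalemxAl.
    move: xy yx; move: (x *m M *m x^T) (x *m M *m y^T) (y *m M *m x^T) (y *m M *m y^T).
    move=> A B C D HB HC; rewrite !mxE HB HC; ring.
  rewrite /t => h.
  have {h} : 0 <= qf M x - x ord0 i ^+ 2 / qf M y.
    apply: le_trans h _; rewrite le_eqVlt; apply/orP; left; apply/eqP.
    by field; rewrite gt_eqF.
  by rewrite subr_ge0 ler_pdivrMr// mulrC.
pose k i := s2val (H i).
have k0 i : 0 < k i := s2valP (H i).
have kP i (x : 'rV[R]_n) : x ord0 i ^+ 2 <= k i * qf M x := s2valP' (H i) x.
(* The summand 1 keeps s positive when n = 0. *)
pose s := 1 + \sum_i k i.
have s0 : 0 < s by rewrite ltr_pwDl// sumr_ge0// => i _; exact: ltW.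
have q0 (x : 'rV[R]_n) : 0 <= qf M x.
  by have [->|z0] := eqVneq x 0; [rewrite qf0|exact/ltW/pM].
exists s^-1 => [|x]; first by rewrite invr_gt0.
rewrite mulrC ler_pdivrMr// /s mulrDr mulr1 mulrC mulr_suml.
by rewrite (le_trans (ler_sum _ (fun i _ => kP i x)))// lerDr.
Qed.

Definition rvec (R : realType) (n : nat) (v : nat -> R) : 'rV[R]_n := \row_i v i.

Lemma rvec_vcons (R : realType) (n : nat) (x : R) (v : nat -> R) :
  rvec n.+1 (vcons x v) = row_mx x%:M (rvec n v) :> 'rV[R]_(1 + n).
Proof.
apply/rowP => i; case: (split_ordP i) => k ->.
  by rewrite row_mxEl !mxE !ord1 eqxx mulr1n.
by rewrite row_mxEr !mxE.
Qed.

Lemma measurable_qf d (T : measurableType d) (R : realType) (n : nat) (M : 'M[R]_n)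
    (f : T -> 'rV[R]_n) :
  (forall i, measurable_fun [set: T] (fun t => f t ord0 i)) ->
  measurable_fun [set: T] (fun t => qf M (f t)).
Proof.
move=> mf; under eq_fun do rewrite qfE.
apply: measurable_sum => i; apply: measurable_sum => j.
by apply: measurable_funM => //; apply: measurable_funM.
Qed.

Lemma integral_gauss_scale (R : realType) (s : R) : 0 < s ->
  (\int[@lebesgue_measure R]_x (expR (- (2^-1 * (s * x ^+ 2))))%:E
   = (Num.sqrt s)^-1%:E * \int[@lebesgue_measure R]_x (expR (- (2^-1 * x ^+ 2)))%:E)%E.
Proof.
move=> s0; have q0 : 0 < Num.sqrt s by rewrite sqrtr_gt0.
rewrite -(@integral_affine _ 0 (Num.sqrt s) (fun x => (expR (- (2^-1 * x ^+ 2)))%:E))//.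
- rewrite muleA -EFinM mulVf ?gt_eqF// mul1e; apply: eq_integral => x _.
  by rewrite add0r exprMn sqr_sqrtr// ltW.
- apply/measurable_EFinP; apply: measurableT_comp => //; apply: measurableT_comp => //.
  by apply: measurable_funM => //; exact: measurable_funX.
Qed.

(* Completing the square in the outermost variable leaves its Schur complement. *)
Lemma iter_lebesgue_gauss (R : realType) (n : nat) (M : 'M[R]_n) (Z : pred nat)
    (h : nat -> R -> R) :
  M^T = M -> posdef M ->
  (forall i j : 'I_n, Z i -> M i j = (i == j)%:R) ->
  (forall i, ~~ Z i -> h i = cst 1) ->
  (forall i x, 0 <= h i x) -> (forall i, measurable_fun [set: R] (h i)) ->
  iter_lebesgue n
    (fun v => (expR (- (2^-1 * qf M (rvec n v))) * \prod_(i < n) h i (v i))%:E)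
  = ((Num.sqrt (\det M))^-1%:E *
     \prod_(i < n) \int[@lebesgue_measure R]_x (expR (- (2^-1 * x ^+ 2)) * h i x)%:E)%E.
Proof.
elim: n M Z h => [|n IH] M Z h sM pM ZM hZ h0 mh.
  rewrite /= !big_ord0 mulr1 det_mx00 sqrtr1 invr1 mule1.
  by rewrite (_ : rvec 0 _ = 0) ?qf0 ?mulr0 ?oppr0 ?expR0//; apply/rowP => -[].
pose M' := @drsubmx _ 1 n 1 n M.
have sM' : M'^T = M' by exact: sym_drsubmx.
have pM' : posdef M' by exact: posdef_drsubmx.
have d'0 : 0 < \det M' by exact: posdef_det_gt0.
have uM' : M' \in unitmx by rewrite unitmxE unitfE gt_eqF.
have s0 : 0 < schur (M : 'M[R]_(1 + n)) by exact: schur_gt0.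
pose s := schur (M : 'M[R]_(1 + n)); pose w := schur_shift (M : 'M[R]_(1 + n)).
have M'E i j : M' i j = M (lift ord0 i) (lift ord0 j).
  by rewrite /M' !mxE; congr (M _ _); apply/val_inj.
have cE i : @ursubmx _ 1 n 1 n M ord0 i = M ord0 (lift ord0 i).
  by rewrite !mxE; congr (M _ _); apply/val_inj.
have wM' : w *m M' = @ursubmx _ 1 n 1 n M by rewrite /w /schur_shift mulmxKV.
have Msym i j : M i j = M j i by rewrite -{1}sM mxE.
(* A row of [M] indexed by [Z] is a row of the identity, so the shift vanishes there and leaves the
   argument of [h i] unchanged; off [Z] the factor [h i] is constant. *)
have w0 (i : 'I_n) : Z i.+1 -> w ord0 i = 0.
  move=> Zi; have := cE i; rewrite -wM' mxE (bigD1 i)//= big1 => [|k ki].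
    rewrite M'E ZM// eqxx mulr1 addr0 => ->.
    by rewrite Msym ZM.
  by rewrite M'E Msym ZM// eq_sym (inj_eq (@lift_inj _ _)) (negbTE ki) mulr0.
rewrite big_ord_recl iter_lebesgueS.
pose P := (\prod_(i < n) \int[@lebesgue_measure R]_x (expR (- (2^-1 * x ^+ 2)) * h i.+1 x)%:E)%E.
have P0 : (0 <= P)%E.
  apply: prode_ge0 => i _; apply: integral_ge0 => x _.
  by rewrite lee_fin mulr_ge0// expR_ge0.
pose f (v : nat -> R) :=
  (expR (- (2^-1 * qf M' (rvec n v))) * \prod_(i < n) h i.+1 (v i))%:E.
have bf : bfun f.
  apply: bfun_EFin => d T u mu; apply: measurable_funM.
    apply: measurableT_comp => //; apply: measurableT_comp => //.
    apply: measurable_funM => //; apply: measurable_qf => i.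
    by under eq_fun do rewrite mxE; exact: mu.
  by apply: measurable_prod => i _; exact: measurableT_comp.
have f0 v : (0 <= f v)%E.
  by rewrite lee_fin mulr_ge0 ?expR_ge0 ?prodr_ge0.
have fE := IH M' (fun i => Z i.+1) (fun i => h i.+1) sM' pM'.
have {}fE : iter_lebesgue n f = ((Num.sqrt (\det M'))^-1%:E * P)%E.
  apply: fE => // [i j Zi|i Zi]; last exact: hZ.
  by rewrite M'E ZM// (inj_eq (@lift_inj _ _)).
transitivity (\int[@lebesgue_measure R]_x
   (((Num.sqrt (\det M'))^-1%:E * P) * (expR (- (2^-1 * (s * x ^+ 2))) * h 0%N x)%:E))%E.
  apply: eq_integral => x _.
  rewrite muleC -fE.
  (* Extended by 0 beyond n, as [iter_lebesgue_affine] demands. *)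
  pose a k := if insub k is Some i then x * w ord0 i else 0 : R.
  have aE (i : 'I_n) : a i = x * w ord0 i by rewrite /a valK.
  rewrite -(@iter_lebesgue_affine _ n a (fun=> 1) f)//; last first.
    by move=> i ni; rewrite /a insubF// ltnNge ni.
  rewrite big1// mul1e -iter_lebesgueZ//.
  - apply: eq_iter_lebesgue => v; rewrite /f -EFinM; congr EFin.
    rewrite rvec_vcons qf_schur// -/s -/w -/M'.
    rewrite big_ord_recl /= mulrDr opprD expRD [x ^+ 2 * s]mulrC -[LHS]mulrA -[RHS]mulrA.
    congr (_ * _); rewrite [LHS]mulrCA; congr (_ * _); congr (_ * _).
      congr (expR (- (_ * qf _ _))); apply/rowP => i; rewrite [LHS]mxE [RHS]mxE aE mul1r addrC.
      by rewrite [rvec n v _ _]mxE [(x *: w) _ _]mxE.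
    apply: eq_bigr => i _; change (h i.+1 (v i) = h i.+1 (a i + 1 * v i)).
    rewrite aE mul1r; case: (boolP (Z i.+1)) => Zi.
      by rewrite w0// mulr0 add0r.
    by rewrite hZ.
  - by rewrite mulr_ge0// expR_ge0.
  - move=> d T u mu; apply: (bf _ _ (fun t i => a i + 1 * u t i)) => i.
    by apply: measurable_funD => //; apply: measurable_funM.
have mg : measurable_fun [set: measurableTypeR R]
    (fun x => (expR (- (2^-1 * (s * x ^+ 2))) * h 0%N x)%:E).
  apply/measurable_EFinP; apply: measurable_funM => //; last exact: mh.
  apply: measurableT_comp => //; apply: measurableT_comp => //.
  apply: measurable_funM => //; apply: measurable_funM => //; exact: measurable_funX.
rewrite ge0_integralZl//; last 2 first.
- by move=> x _; rewrite lee_fin mulr_ge0// expR_ge0.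
- by rewrite mule_ge0// lee_fin invr_ge0 sqrtr_ge0.
have -> : (\int[@lebesgue_measure R]_x (expR (- (2^-1 * (s * x ^+ 2))) * h 0%N x)%:E
  = (Num.sqrt s)^-1%:E *
    \int[@lebesgue_measure R]_x (expR (- (2^-1 * x ^+ 2)) * h 0%N x)%:E)%E.
  (* Either the outer row is that of the identity and s = 1, or the outer factor of h is 1 and the
     Gaussian integral scales. *)
  case: (boolP (Z 0%N)) => Z0.
    have c0 : @ursubmx _ 1 n 1 n M = 0.
      by apply/rowP => i; rewrite cE ZM// mxE.
    have -> : s = 1.
      rewrite /s /schur c0 !mul0mx subr0 !mxE ZM//.
    by rewrite sqrtr1 invr1 mul1e; under eq_integral do rewrite mul1r.
  rewrite hZ//=; under eq_integral do rewrite mulr1.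
  by under [in RHS]eq_integral do rewrite mulr1; exact: integral_gauss_scale.
rewrite (@det_schur _ n)// -/s -/M' sqrtrM ?ltW// invfM EFinM.
by rewrite muleACA; congr (_ * _)%E; rewrite muleC.
Qed.

(** * Gamma integrals *)

Lemma measurable_indic_itv (R : realType) (i : interval R) :
  measurable_fun [set: R] (\1_([set` i]) : R -> R).
Proof. exact: measurable_indic. Qed.

Definition unit_power (R : realType) (a x : R) : R := \1_(`[0, 1]%classic) x * x `^ (a - 1).

Lemma unit_power_ge0 (R : realType) (a x : R) : 0 <= unit_power a x.
Proof. by rewrite mulr_ge0// powR_ge0. Qed.

Lemma measurable_unit_power (R : realType) (a : R) : measurable_fun [set: R] (unit_power a).
Proof. by apply: measurable_funM => //; exact: measurable_indic_itv. Qed.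

Lemma integral_indic01 (R : realType) :
  (\int[@lebesgue_measure R]_x (\1_(`[0%R, 1%R]%classic) x)%:E = 1)%E.
Proof.
by rewrite integral_indic//= setIT lebesgue_measure_itv/= lte_fin ltr01 oppr0 adde0.
Qed.

(* For a < 1 the kernel f satisfies f(x) <= C + 2^(1-a) f(2x), and halving the
   variable costs a factor 1/2, so the integrals I_k of the truncations min(f,k)
   satisfy I_k <= C + 2^(-a) I_k. *)
Lemma integral_unit_power_lty (R : realType) (a : R) : 0 < a ->
  (\int[@lebesgue_measure R]_x (unit_power a x)%:E < +oo)%E.
Proof.
move=> a0; pose mu := @lebesgue_measure R.
have ind01 x : unit_power a x != 0 -> 0 <= x <= 1.
  rewrite /unit_power indicE; case: (boolP (_ \in _)) => [|_]; last by rewrite mul0r eqxx.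
  by rewrite inE /= in_itv.
have indE x : 0 <= x <= 1 -> unit_power a x = x `^ (a - 1).
  by move=> x01; rewrite /unit_power indicE mem_set ?mul1r//= in_itv.
have mi := @measurable_indic_itv R `[0, 1].
have [a1|a1] := leP 1 a.
  apply: (@le_lt_trans _ _ (\int[mu]_x (\1_(`[0%R, 1%R]%classic) x)%:E)%E); last first.
    by rewrite integral_indic01 ltry.
  apply: ge0_le_integral => //.
  - by move=> x _; rewrite lee_fin unit_power_ge0.
  - by apply/measurable_EFinP; exact: measurable_unit_power.
  - by apply/measurable_EFinP.
  - move=> x _; rewrite lee_fin /unit_power indicE.
    case: (boolP (_ \in _)) => [|_]; last by rewrite mul0r.
    rewrite inE /= in_itv /= mul1r => /andP[x0 x1].
    have e : 1 `^ (a - 1) = 1 :> R by rewrite powR1.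
    by rewrite -[leRHS]e ge0_ler_powR ?nnegrE ?subr_ge0.
pose c : R := 2 `^ (1 - a).
have c1 : 1 <= c by rewrite -(powRr0 2) ler_powR ?ler1n// subr_ge0 ltW.
pose f k x := Num.min (unit_power a x) k%:R.
have f0 k x : 0 <= f k x by rewrite le_min unit_power_ge0/=.
have mf k : measurable_fun [set: R] (f k).
  by apply: measurable_minr => //; exact: measurable_unit_power.
have fle k x : f k x <= c * \1_(`[0, 1]%classic) x + c * f k (0 + 2 * x).
  rewrite add0r; have [e|n0] := eqVneq (unit_power a x) 0.
    rewrite {1}/f e; apply: le_trans (_ : 0 <= _); first by rewrite ge_min lexx.
    by rewrite addr_ge0 ?mulr_ge0// (le_trans ler01).
  have /andP[x0 x1] := ind01 _ n0.
  rewrite indicE mem_set/= ?in_itv/= ?x0// mulr1.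
  (* Below 1/2 the doubled point is still in [0, 1] and the power scales exactly; above 1/2 the
     power itself is at most c. *)
  have [x2|x2] := leP x 2^-1.
    have -> : f k (2 * x) = Num.min (c^-1 * unit_power a x) k%:R.
      have x21 : 0 <= 2 * x <= 1.
        by rewrite mulr_ge0//= mulrC -ler_pdivlMr// mul1r.
      rewrite /f !indE ?x0// powRM// /c -powRN opprB//.
    apply: le_trans (_ : c * Num.min (c^-1 * unit_power a x) k%:R <= _); last first.
      by rewrite lerDr (le_trans ler01).
    rewrite /f minr_pMr ?(le_trans ler01)// mulrA divff ?mul1r; last first.
      by rewrite gt_eqF// (lt_le_trans ltr01).
    rewrite le_min !ge_min lexx/=; apply/orP; right.
    by rewrite ler_peMl.
  rewrite ler_wpDr ?mulr_ge0// ?(le_trans ler01)//.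
  rewrite ge_min; apply/orP; left; rewrite indE ?x0//.
  have xp : 0 < x by rewrite (lt_trans _ x2)// invr_gt0.
  have -> : x `^ (a - 1) = x^-1 `^ (1 - a).
    by rewrite -powR_inv1 ?ltW// -powRrM mulN1r opprB.
  rewrite ge0_ler_powR ?nnegrE ?subr_ge0 ?ltW ?invr_gt0//.
  by rewrite -[ltRHS]invrK ltf_pV2 ?posrE ?invr_gt0.
have a0' : 0 < 1 - 2 `^ (- a) :> R.
  have e : 1 `^ a = 1 :> R by rewrite powR1.
  by rewrite subr_gt0 powRN invf_lt1 ?powR_gt0// -[ltLHS]e gt0_ltr_powR ?nnegrE ?ltr1n.
have fin k : (\int[mu]_x (f k x)%:E <= (c / (1 - 2 `^ (- a)))%:E)%E.
  pose I := (\int[mu]_x (f k x)%:E)%E.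
  have I0 : (0 <= I)%E by apply: integral_ge0 => x _; rewrite lee_fin.
  have Ifin : I \is a fin_num.
    rewrite ge0_fin_numE// (@le_lt_trans _ _ (\int[mu]_x (k%:R * \1_(`[0%R, 1%R]%classic) x)%:E)%E)//.
      apply: ge0_le_integral => //.
      + by move=> x _; rewrite lee_fin.
      + by apply/measurable_EFinP; exact: mf.
      + by apply/measurable_EFinP; exact: measurable_funM.
      + move=> x _; rewrite lee_fin /f ge_min indicE.
        case: (boolP (_ \in _)) => [_|]; first by rewrite mulr1 lexx orbT.
        rewrite notin_setE /= in_itv/= => x01; apply/orP; left.
        rewrite mulr0; have [->//|n0] := eqVneq (unit_power a x) 0.
        by case: x01; exact: ind01.
    under eq_integral do rewrite EFinM.
    by rewrite ge0_integralZl_EFin// ?integral_indic01 ?mule1 ?ltry//; apply/measurable_EFinP.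
  have mf2 : measurable_fun [set: R] (fun x => f k (0 + 2 * x)).
    by apply: (measurableT_comp (mf k)); apply: measurable_funD => //.
  have : (I <= c%:E + (c * 2^-1)%:E * I)%E.
    have <- : (\int[mu]_x (c * \1_(`[0%R, 1%R]%classic) x + c * f k (0 + 2 * x))%:E
      = c%:E + (c * 2^-1)%:E * I)%E.
      under eq_integral do rewrite EFinD 2!EFinM.
      have mc1 : measurable_fun [set: measurableTypeR R]
          (fun x : R => c%:E * (\1_(`[0%R, 1%R]%classic) x)%:E)%E.
        by apply: emeasurable_funM => //; apply/measurable_EFinP.
      have mc2 : measurable_fun [set: measurableTypeR R] (fun x : R => c%:E * (f k (0 + 2 * x))%:E)%E.
        by apply: emeasurable_funM => //; apply/measurable_EFinP.
      have c0 : 0 <= c := le_trans ler01 c1.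
      rewrite ge0_integralD//; last 2 first.
      + by move=> x _; rewrite mule_ge0// lee_fin.
      + by move=> x _; rewrite mule_ge0// lee_fin.
      have E1 : (\int[mu]_x (c%:E * (\1_(`[0%R, 1%R]%classic) x)%:E) = c%:E)%E.
        rewrite ge0_integralZl_EFin ?integral_indic01 ?mule1//; exact/measurable_EFinP.
      have E2 : (\int[mu]_x (c%:E * (f k (0 + 2 * x))%:E)
                 = c%:E * \int[mu]_x (f k (0 + 2 * x))%:E)%E.
        rewrite ge0_integralZl_EFin//; first by move=> x _; rewrite lee_fin.
        by apply/measurable_EFinP; exact: mf2.
      rewrite E1 E2 EFinM -muleA.
      congr (_ + _ * _)%E.
      rewrite /I -(@integral_affine _ 0 2 (fun x => (f k x)%:E))//; last first.
      + by move=> x; rewrite lee_fin.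
      + by apply/measurable_EFinP; exact: mf.
      by rewrite muleA -EFinM mulVf// mul1e.
    apply: ge0_le_integral => //.
    + by move=> x _; rewrite lee_fin.
    + by apply/measurable_EFinP; exact: mf.
    + apply/measurable_EFinP; apply: measurable_funD; apply: measurable_funM => //.
    + by move=> x _; rewrite lee_fin.
  rewrite -/I -(fineK Ifin) -EFinM -EFinD !lee_fin => h.
  rewrite ler_pdivlMr//.
  have ca : c * 2^-1 = 2 `^ (- a).
    rewrite /c powRB ?powRr1 ?powRN//; last by apply/implyP => _.
    by rewrite mulrAC divff// mul1r.
  by rewrite mulrBr mulr1 lerBlDr mulrC -ca mulrC addrC [fine I * _]mulrC addrC.
have cv x : (f k x)%:E @[k --> \oo] --> (unit_power a x)%:E.
  apply: cvg_near_cst; near=> k; congr EFin; apply/min_idPl.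
  near: k; exact: nbhs_infty_ger.
have nd x : nondecreasing_seq (fun k => (f k x)%:E).
  move=> k l kl; rewrite lee_fin /f le_min !ge_min lexx/= ler_nat kl orbT//.
have -> : (\int[mu]_x (unit_power a x)%:E = limn (fun k => \int[mu]_x (f k x)%:E))%E.
  rewrite -monotone_convergence//.
  - by apply: eq_integral => x _; apply/esym/cvg_lim => //; exact: cv.
  - by move=> k; apply/measurable_EFinP; exact: mf.
  - by move=> k x _; rewrite lee_fin.
apply: (@le_lt_trans _ _ (c / (1 - 2 `^ (- a)))%:E); last exact: ltry.
apply: lime_le; last by apply: nearW => k; exact: fin.
apply: ereal_nondecreasing_is_cvgn => k l kl; apply: ge0_le_integral => //.
- by move=> x _; rewrite lee_fin.
- by apply/measurable_EFinP; exact: mf.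
- by apply/measurable_EFinP; exact: mf.
- by move=> x _; exact: nd.
Unshelve. all: by end_near. Qed.

Definition gamma_kernel (R : realType) (a l x : R) : R :=
  \1_(`[0, +oo[%classic) x * x `^ (a - 1) * expR (- (l * x)).

Lemma gamma_kernel_ge0 (R : realType) (a l x : R) : 0 <= gamma_kernel a l x.
Proof. by rewrite !mulr_ge0// ?powR_ge0 ?expR_ge0. Qed.

Lemma measurable_gamma_kernel (R : realType) (a l : R) :
  measurable_fun [set: R] (gamma_kernel a l).
Proof.
apply: measurable_funM; last first.
  by apply: measurableT_comp => //; apply: measurableT_comp => //; exact: measurable_funM.
by apply: measurable_funM => //; exact: measurable_indic_itv.
Qed.

(** Euler's Gamma at a. It cancels in the final ratio, which takes only its being finite and
    positive. *)
Definition gammaE (R : realType) (a : R) : \bar R :=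
  (\int[@lebesgue_measure R]_x (gamma_kernel a 1 x)%:E)%E.

Lemma integral_gamma_kernel (R : realType) (a l : R) : 0 < l ->
  (\int[@lebesgue_measure R]_x (gamma_kernel a l x)%:E = (l `^ (- a))%:E * gammaE a)%E.
Proof.
move=> l0; rewrite /gammaE.
have l1 : l `^ (a - 1) != 0 by rewrite gt_eqF// powR_gt0.
rewrite -(@integral_affine _ 0 l (fun x => (gamma_kernel a 1 x)%:E))//; last first.
- by move=> x; rewrite lee_fin gamma_kernel_ge0.
- by apply/measurable_EFinP; exact: measurable_gamma_kernel.
rewrite muleA -EFinM.
have -> : l `^ (- a) * l = (l `^ (a - 1))^-1.
  rewrite -powRN opprB addrC powRD ?powRr1 ?ltW//.
  by apply/implyP => _; rewrite gt_eqF.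
have E x : gamma_kernel a 1 (0 + l * x) = l `^ (a - 1) * gamma_kernel a l x.
  rewrite add0r /gamma_kernel mul1r !indicE.
  have -> : (l * x \in `[0, +oo[%classic) = (x \in `[0, +oo[%classic).
    by apply/idP/idP; rewrite !inE /= !in_itv/= !andbT pmulr_rge0.
  case: (boolP (x \in _)) => [|_]; last by rewrite !mul0r mulr0.
  by rewrite inE /= in_itv/= andbT !mul1r mulrA => x0; rewrite powRM// ltW.
under [in RHS]eq_integral do rewrite E EFinM.
rewrite ge0_integralZl_EFin ?powR_ge0//; last first.
- by apply/measurable_EFinP; exact: measurable_gamma_kernel.
- by move=> x _; rewrite lee_fin gamma_kernel_ge0.
by rewrite muleA -EFinM mulVf// mul1e.
Qed.

(** For a > 0, the inequality 1 + y <= exp y at y = x / (1 + 2 a) bounds x; raised to the power a,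
    it leaves the exponent a x / (1 + 2 a) <= x / 2. The absolute values give one constant for both
    signs of a. *)
Lemma powR_le_expR (R : realType) (a x : R) : 1 <= x ->
  x `^ a <= (1 + `|2 * a|) `^ `|a| * expR (2^-1 * x).
Proof.
move=> x1; have x0 : 0 <= x := le_trans ler01 x1.
have b1 : 1 <= 1 + `|2 * a| by rewrite lerDl.
have [a0|a0] := leP a 0.
  apply: le_trans (_ : 1 <= _).
    by rewrite -[leRHS](powRr0 x) ler_powR.
  apply: mulr_ege1.
    by rewrite -[leLHS](powRr0 (1 + `|2 * a|)) ler_powR.
  by rewrite -[leLHS]expR0 ler_expR mulr_ge0.
rewrite !gtr0_norm ?mulr_gt0//.
have b0 : 0 < 1 + 2 * a by rewrite addr_gt0// mulr_gt0.
have h : x <= (1 + 2 * a) * expR (x / (1 + 2 * a)).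
  rewrite -ler_pdivrMl// mulrC; apply: le_trans (expR_ge1Dx _); rewrite lerDr//.
apply: le_trans (_ : ((1 + 2 * a) * expR (x / (1 + 2 * a))) `^ a <= _).
  by apply: ge0_ler_powR; rewrite ?nnegrE ?mulr_ge0 ?expR_ge0// ltW.
rewrite powRM ?expR_ge0 ?(ltW b0)// ler_pM2l ?powR_gt0//.
rewrite [_ `^ a]/powR gt_eqF ?expR_gt0// expRK ler_expR.
rewrite mulrCA mulrC ler_wpM2r// ler_pdivrMr// mulrDr mulr1 mulrA mulVf// mul1r.
by rewrite lerDr invr_ge0.
Qed.

(** On [0, 1] the kernel is at most [unit_power]; beyond 1 the power is absorbed by half of the
    exponential, leaving C exp(- x / 2), which is 2 C times an exponential density. *)
Lemma gammaE_lty (R : realType) (a : R) : 0 < a -> (gammaE a < +oo)%E.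
Proof.
move=> a0; set mu := @lebesgue_measure R.
pose C : R := (1 + `|2 * (a - 1)|) `^ `|a - 1|.
have C0 : 0 <= C by exact: powR_ge0.
have h0 : 0 < 2^-1 :> R by rewrite invr_gt0.
apply: (@le_lt_trans _ _
  (\int[mu]_x ((unit_power a x)%:E + (2 * C)%:E * (exponential_pdf 2^-1 x)%:E))%E).
  apply: ge0_le_integral => //.
  - by move=> x _; rewrite lee_fin gamma_kernel_ge0.
  - by apply/measurable_EFinP; exact: measurable_gamma_kernel.
  - apply: emeasurable_funD; first by apply/measurable_EFinP; exact: measurable_unit_power.
    apply: emeasurable_funM => //; apply/measurable_EFinP; exact: measurable_exponential_pdf.
  - move=> x _; rewrite -EFinM -EFinD lee_fin /gamma_kernel indicE.
    case: (boolP (_ \in _)) => [|_]; last first.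
      by rewrite !mul0r addr_ge0 ?unit_power_ge0// ?mulr_ge0// exponential_pdf_ge0.
    rewrite inE /= in_itv /= andbT !mul1r => x0.
    have [x1|x1] := leP x 1.
      rewrite ler_wpDr ?mulr_ge0// ?exponential_pdf_ge0//.
      rewrite /unit_power indicE mem_set /= ?in_itv/= ?x0// mul1r ler_piMr ?powR_ge0//.
      by rewrite -[leRHS]expR0 ler_expR oppr_le0.
    rewrite ler_wpDl ?unit_power_ge0// exponential_pdfE//.
    rewrite mulrACA divff// mul1r.
    apply: le_trans (_ : C * expR (2^-1 * x) * expR (- x) <= _).
      by rewrite ler_wpM2r ?expR_ge0// powR_le_expR// ltW.
    rewrite -mulrA -expRD ler_wpM2l// ler_expR le_eqVlt; apply/orP; left; apply/eqP.
    by field.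
rewrite ge0_integralD//; last 4 first.
- by move=> x _; rewrite lee_fin unit_power_ge0.
- by apply/measurable_EFinP; exact: measurable_unit_power.
- by move=> x _; rewrite mule_ge0// lee_fin ?mulr_ge0// exponential_pdf_ge0.
- apply: emeasurable_funM => //; apply/measurable_EFinP; exact: measurable_exponential_pdf.
rewrite ge0_integralZl_EFin ?mulr_ge0//; last first.
- apply/measurable_EFinP; exact: measurable_exponential_pdf.
- by move=> x _; rewrite lee_fin exponential_pdf_ge0.
by rewrite integral_exponential_pdf// mule1 lte_add_pinfty ?integral_unit_power_lty ?ltry.
Qed.

(** The kernel is bounded below on [1, 2]; the minimum of the two endpoint powers covers both signs
    of a - 1. *)
Lemma gammaE_gt0 (R : realType) (a : R) : (0 < gammaE a)%E.
Proof.
set mu := @lebesgue_measure R.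
pose c : R := Num.min (1 `^ (a - 1)) (2 `^ (a - 1)) * expR (- 2).
have c0 : 0 < c by rewrite mulr_gt0 ?expR_gt0// lt_min !powR_gt0.
apply: (@lt_le_trans _ _ (\int[mu]_x (c * \1_(`[1%R, 2%R]%classic) x)%:E)%E).
  under eq_integral do rewrite EFinM.
  rewrite ge0_integralZl_EFin ?ltW//; last first.
    by apply/measurable_EFinP; exact: measurable_indic_itv.
  rewrite integral_indic//= setIT lebesgue_measure_itv/= lte_fin ltr1n/=.
  by rewrite -EFinD -EFinM lte_fin mulr_gt0// subr_gt0 ltr1n.
apply: ge0_le_integral => //.
- by move=> x _; rewrite lee_fin mulr_ge0// ltW.
- by apply/measurable_EFinP; apply: measurable_funM => //; exact: measurable_indic_itv.
- by apply/measurable_EFinP; exact: measurable_gamma_kernel.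
- move=> x _; rewrite lee_fin indicE; case: (boolP (_ \in _)) => [|_]; last first.
    by rewrite mulr0 gamma_kernel_ge0.
  rewrite inE /= in_itv/= mulr1 => /andP[x1 x2].
  have x0 : 0 <= x := le_trans ler01 x1.
  rewrite /gamma_kernel indicE mem_set/= ?in_itv/= ?x0// mul1r mul1r.
  apply: ler_pM; rewrite ?expR_ge0 ?le_min ?powR_ge0//; last by rewrite ler_expR lerN2.
  rewrite ge_min; have [a1|a1] := leP 0 (a - 1).
    by rewrite ge0_ler_powR ?nnegrE.
  apply/orP; right.
  have inv y : 0 < y -> y `^ (a - 1) = (y^-1) `^ (1 - a) :> R.
    by move=> y0; rewrite -powR_inv1 ?ltW// -powRrM mulN1r opprB.
  rewrite !inv ?(lt_le_trans ltr01 x1)// ge0_ler_powR ?nnegrE ?invr_ge0//.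
    by rewrite subr_ge0 -subr_le0 ltW.
  by rewrite lef_pV2 ?posrE ?(lt_le_trans ltr01 x1).
Qed.

Lemma integral_half_gauss (R : realType) :
  (\int[@lebesgue_measure R]_x (expR (- (2^-1 * x ^+ 2)))%:E
   = (Num.sqrt 2 * Num.sqrt pi)%:E)%E.
Proof.
have := @integralT_gauss R; rewrite /gauss_fun.
have -> : (fun x : R => (expR (- x ^+ 2))%:E) = (fun x => (expR (- (2^-1 * (2 * x ^+ 2))))%:E).
  by apply/funext => x; rewrite mulrA mulVf// mul1r.
rewrite integral_gauss_scale// EFinM => <-.
by rewrite muleA -EFinM divff ?mul1e// gt_eqF// sqrtr_gt0.
Qed.

Lemma integral_gauss_lty (R : realType) (c : R) : 0 < c ->
  (\int[@lebesgue_measure R]_x (expR (- (c * x ^+ 2)))%:E < +oo)%E.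
Proof.
move=> c0; have -> : (fun x : R => (expR (- (c * x ^+ 2)))%:E)
    = (fun x => (expR (- (2^-1 * (2 * c * x ^+ 2))))%:E).
  by apply/funext => x; rewrite !mulrA mulVf// mul1r.
by rewrite integral_gauss_scale ?mulr_gt0// integral_half_gauss -EFinM ltry.
Qed.

(** * Finiteness of the Dirichlet mass *)

Lemma measurable_simplex_preimage d (T : measurableType d) (R : realType) (K : nat)
    (f : T -> 'rV[R]_K) :
  (forall i, measurable_fun [set: T] (fun t => f t ord0 i)) ->
  measurable [set t | simplex R K (f t)].
Proof.
move=> mf.
have -> : [set t | simplex R K (f t)] =
    \bigcap_(i in [set: 'I_K]) [set t | 0 <= f t ord0 i]
    `&` [set t | \sum_i f t ord0 i = 1].
  by apply/seteqP; split=> t /= [H1 H2]; split => // i; [move=> _; exact: H1|exact: (H1 i I)].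
apply: measurableI.
  apply: fin_bigcap_measurable => // i _.
  rewrite (_ : [set _ | _] = (fun t => f t ord0 i) @^-1` `[0, +oo[%classic).
    by rewrite -[X in measurable X]setTI; exact: mf.
  by apply/seteqP; split => t /=; rewrite in_itv/= andbT.
have ms : measurable_fun [set: T] (fun t => \sum_i f t ord0 i).
  by apply: measurable_sum => i; exact: mf.
rewrite (_ : [set _ | _] = (fun t => \sum_i f t ord0 i) @^-1` [set 1]).
  by rewrite -[X in measurable X]setTI; exact: ms.
by [].
Qed.

Definition on_simplex (R : realType) K (E : 'rV[R]_K -> R) (t : 'rV[R]_K) : R :=
  if `[< simplex R K t >] then E t else 0.

(** Only the values on the simplex are controlled, since [H] is assumed continuous there only; hence
    the extension by zero. *)
Definition smeas (R : realType) K (E : 'rV[R]_K -> R) : Prop :=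
  forall d (T : measurableType d) (f : T -> 'rV[R]_K),
    (forall i, measurable_fun [set: T] (fun t => f t ord0 i)) ->
    measurable_fun [set: T] (fun t => on_simplex E (f t)).

Lemma on_simplexT (R : realType) K (E : 'rV[R]_K -> R) (t : 'rV[R]_K) :
  simplex R K t -> on_simplex E t = E t.
Proof. by move=> st; rewrite /on_simplex; case: asboolP. Qed.

Lemma on_simplexF (R : realType) K (E : 'rV[R]_K -> R) (t : 'rV[R]_K) :
  ~ simplex R K t -> on_simplex E t = 0.
Proof. by move=> st; rewrite /on_simplex; case: asboolP. Qed.

Lemma smeas_fun (R : realType) K (E : 'rV[R]_K -> R) :
  (forall d (T : measurableType d) (f : T -> 'rV[R]_K),
    (forall i, measurable_fun [set: T] (fun t => f t ord0 i)) ->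
    measurable_fun [set: T] (fun t => E (f t))) -> smeas E.
Proof.
move=> mE d T f mf.
have -> : (fun t => on_simplex E (f t)) =
    (fun t => E (f t) * \1_([set t | simplex R K (f t)]) t).
  apply/funext => t; rewrite indicE.
  case: (pselect (simplex R K (f t))) => st.
    by rewrite on_simplexT// mem_set// mulr1.
  by rewrite on_simplexF// memNset// mulr0.
apply: measurable_funM; first exact: mE.
by apply: measurable_indic; exact: measurable_simplex_preimage.
Qed.

Lemma smeasM (R : realType) K (E F : 'rV[R]_K -> R) :
  smeas E -> smeas F -> smeas (fun t => E t * F t).
Proof.
move=> mE mF d T f mf.
have -> : (fun t => on_simplex (fun t => E t * F t) (f t)) =
    (fun t => on_simplex E (f t) * on_simplex F (f t)).
  apply/funext => t; case: (pselect (simplex R K (f t))) => st.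
    by rewrite !on_simplexT.
  by rewrite !on_simplexF// mulr0.
by apply: measurable_funM; [exact: mE|exact: mF].
Qed.

Lemma smeasX (R : realType) K (E : 'rV[R]_K -> R) (n : nat) :
  smeas E -> smeas (fun t => E t ^+ n).
Proof.
move=> mE; elim: n => [|n IH]; first by apply: smeas_fun => d T f mf.
have -> : (fun t => E t ^+ n.+1) = (fun t => E t * E t ^+ n).
  by apply/funext => t; rewrite exprS.
exact: smeasM.
Qed.

Lemma smeas_dir_weight (R : realType) K (alpha : 'rV[R]_K) :
  smeas (dir_weight alpha).
Proof.
apply: smeas_fun => d T f mf; apply: measurable_prod => i _.
exact: (measurableT_comp (measurable_powR _) (mf i)).
Qed.

Lemma dir_weight_ge0 (R : realType) K (alpha t : 'rV[R]_K) :
  0 <= dir_weight alpha t.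
Proof. by apply: prodr_ge0 => i _; exact: powR_ge0. Qed.

Lemma dir_integralE (R : realType) N (j : 'I_N.+1) (alpha : 'rV[R]_N.+1)
    (g : 'rV[R]_N.+1 -> R) :
  smeas g -> (forall t, simplex R N.+1 t -> 0 <= g t) ->
  dir_integral alpha g
  = iter_lebesgue N (fun v => (on_simplex (fun t => g t * dir_weight alpha t) (chart j v))%:E).
Proof.
move=> mg g0; pose F t := (on_simplex (fun t => g t * dir_weight alpha t) t)%:E.
have F0 t : (0 <= F t)%E.
  rewrite lee_fin; case: (pselect (simplex R N.+1 t)) => st.
    by rewrite on_simplexT// mulr_ge0 ?dir_weight_ge0// g0.
  by rewrite on_simplexF.
have mF : rvfun F.
  move=> d T f mf; apply/measurable_EFinP.
  by apply: smeasM mg (smeas_dir_weight alpha) _ _ _ mf.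
rewrite /dir_integral -/(F _) -(iter_lebesgue_chart j mF F0) /=.
by apply: eq_iter_lebesgue => v; rewrite /F /on_simplex; case: asboolP.
Qed.

Lemma simplex_le1 (R : realType) K (t : 'rV[R]_K) (i : 'I_K) :
  simplex R K t -> 0 <= t ord0 i <= 1.
Proof.
move=> [t0 <-]; rewrite t0/= (bigD1 i)//= lerDl sumr_ge0// => k _; exact: t0.
Qed.

Lemma simplex_large (R : realType) N (t : 'rV[R]_N.+1) :
  simplex R N.+1 t -> exists j, N.+1%:R^-1 <= t ord0 j.
Proof.
move=> [t0 t1]; apply: contrapT => /forallNP H.
have : \sum_i t ord0 i < \sum_(i < N.+1) N.+1%:R^-1.
  apply: ltr_sum => [|i _]; first by apply/hasP; exists ord0; rewrite ?mem_index_enum.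
  by rewrite ltNge; apply/negP; exact: H.
by rewrite t1 sumr_const card_ord -[X in _ < X]mulr_natl divff ?pnatr_eq0// ltxx.
Qed.

(** The power is monotone in x, so on [m, 1] it is at most its value at one of the endpoints. *)
Lemma powR_le_max (R : realType) (m x a : R) : 0 < m -> m <= x -> x <= 1 ->
  x `^ a <= m `^ a + 1.
Proof.
move=> m0 mx x1; have x0 : 0 < x := lt_le_trans m0 mx.
have [a0|a0] := leP 0 a.
  have e : 1 `^ a = 1 :> R by rewrite powR1.
  by rewrite ler_wpDl ?powR_ge0// -[leRHS]e ge0_ler_powR ?nnegrE// ltW.
rewrite ler_wpDr// -[a]opprK !(powRN _ (- a)) lef_pV2 ?posrE ?powR_gt0//.
by rewrite ge0_ler_powR ?nnegrE ?oppr_ge0// ltW.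
Qed.

(* Some coordinate is at least 1/K; omitting that coordinate bounds the weight by
   a product of integrable one-dimensional kernels. *)
Lemma dirichlet_fin (R : realType) N (alpha : 'rV[R]_N.+1) :
  (forall i, 0 < alpha ord0 i) -> (dir_integral alpha (fun=> 1%R) < +oo)%E.
Proof.
move=> al0; pose m : R := N.+1%:R^-1.
have m0 : 0 < m by rewrite invr_gt0.
pose big (j : 'I_N.+1) (t : 'rV[R]_N.+1) : R := (m <= t ord0 j)%R%:R.
have mbig j : smeas (big j).
  apply: smeas_fun => d T f mf.
  have -> : (fun t => big j (f t)) = (\1_(`[m, +oo[%classic) : R -> R) \o (fun t => f t ord0 j).
    apply/funext => t; rewrite /big /= indicE; congr (nat_of_bool _)%:R.
    by apply/idP/idP; rewrite inE /= in_itv /= andbT.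
  exact: measurableT_comp (measurable_indic_itv _) (mf j).
have big0 j t : 0 <= big j t by [].
pose G j := iter_lebesgue N
  (fun v => (on_simplex (fun t => big j t * dir_weight alpha t) (simplex_point N.+1 v))%:E).
have GE j : G j = dir_integral alpha (big j).
  by apply: eq_iter_lebesgue => v; rewrite /on_simplex; case: asboolP.
have Gfin j : (dir_integral alpha (big j) < +oo)%E.
  rewrite (@dir_integralE _ _ j)//.
  pose gk (i : nat) : R -> R :=
    if insub i is Some k then unit_power (alpha ord0 (lift j k)) else cst 0.
  have gk0 i x : 0 <= gk i x by rewrite /gk; case: insub => // k; exact: unit_power_ge0.
  have mgk i : measurable_fun [set: R] (gk i).
    by rewrite /gk; case: insub => [k|] //; exact: measurable_unit_power.
  have C0 : 0 <= m `^ (alpha ord0 j - 1) + 1 by rewrite addr_ge0// powR_ge0.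
  apply: (@le_lt_trans _ _ (iter_lebesgue N
    (fun v => ((m `^ (alpha ord0 j - 1) + 1) * \prod_(i < N) gk i (v i))%:E))); last first.
    rewrite iter_lebesgue_prod// lte_mul_pinfty ?lee_fin//.
    rewrite -ge0_fin_numE; last first.
      by apply: prode_ge0 => i _; apply: integral_ge0 => x _; rewrite lee_fin.
    apply: prode_fin_num => i _; rewrite ge0_fin_numE; last first.
      by apply: integral_ge0 => x _; rewrite lee_fin.
    by rewrite /gk valK; exact: integral_unit_power_lty.
  apply: le_iter_lebesgue.
  - apply: bfun_EFin => d T u mu.
    apply: (smeasM (mbig j) (smeas_dir_weight alpha)) => i.
    under eq_fun do rewrite mxE.
    case: (unlift j i) => [k|]; first exact: mu.
    by apply: measurable_funB => //; apply: measurable_sum => k; exact: mu.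
  - apply: bfun_EFin => d T u mu; apply: measurable_funM => //.
    by apply: measurable_prod => i _; exact: measurableT_comp.
  - move=> v; rewrite lee_fin /on_simplex; case: ifP => // _.
    by rewrite mulr_ge0// dir_weight_ge0.
  - move=> v; rewrite lee_fin; case: (pselect (simplex R N.+1 (chart j v))) => st; last first.
      by rewrite on_simplexF// mulr_ge0// prodr_ge0.
    rewrite on_simplexT// /big; case: (leP m _) => [mj|_]; last first.
      by rewrite mul0r mulr_ge0// prodr_ge0.
    rewrite mul1r /dir_weight (bigD1_ord j)//=.
    apply: ler_pM; [exact: powR_ge0|by apply: prodr_ge0 => i _; exact: powR_ge0| |].
      by apply: powR_le_max => //; have /andP[] := simplex_le1 j st.
    apply: ler_prod => i _; rewrite powR_ge0/= /gk valK /unit_power chart_lift.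
    rewrite indicE mem_set ?mul1r//= in_itv/=.
    by have := simplex_le1 (lift j i) st; rewrite chart_lift.
pose H v := (\sum_(j < N.+1)
  (on_simplex (fun t => big j t * dir_weight alpha t) (simplex_point N.+1 v))%:E)%E.
have bH j : bfun (fun v =>
   (on_simplex (fun t => big j t * dir_weight alpha t) (simplex_point N.+1 v))%:E).
  rewrite simplex_pointE; apply: (@bfun_chart _ _ ord_max
    (fun t => (on_simplex (fun t => big j t * dir_weight alpha t) t)%:E)).
  move=> d T f mf; apply/measurable_EFinP.
  by apply: (smeasM (mbig j) (smeas_dir_weight alpha)).
have H0 j v : (0 <= (on_simplex (fun t => big j t * dir_weight alpha t) (simplex_point N.+1 v))%:E)%E.
  rewrite lee_fin /on_simplex; case: ifP => // _.
  by rewrite mulr_ge0// dir_weight_ge0.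
have sumG (r : seq 'I_N.+1) : iter_lebesgue N (fun v => \sum_(j <- r)
  (on_simplex (fun t => big j t * dir_weight alpha t) (simplex_point N.+1 v))%:E)%E
  = (\sum_(j <- r) G j)%E.
  elim: r => [|j r IH].
    rewrite big_nil (@eq_iter_lebesgue _ _ _ (fun=> (0 * 1)%:E)); last first.
      by move=> v; rewrite big_nil mul0r.
    under eq_iter_lebesgue do rewrite EFinM.
    by rewrite iter_lebesgueZ// mul0e.
  rewrite big_cons -IH -iter_lebesgueD//.
  - by apply: eq_iter_lebesgue => v; rewrite big_cons.
  - by move=> d T u mu; apply: emeasurable_sum => k; exact: (bH k).
  - by move=> v; apply: sume_ge0.
apply: (@le_lt_trans _ _ (iter_lebesgue N H)).
  apply: le_iter_lebesgue.
  - rewrite simplex_pointE => d T u mu.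
    apply: (@bfun_chart _ _ ord_max
      (fun t => if `[< simplex R N.+1 t >] then (1 * dir_weight alpha t)%:E else 0%E)) mu.
    move=> d' T' f mf.
    under eq_fun do rewrite mul1r.
    have := smeas_dir_weight alpha mf => /measurable_EFinP.
    congr (measurable_fun _ _); apply/funext => t; rewrite /= /on_simplex.
    by case: `[< simplex R N.+1 (f t) >].
  - by move=> d T u mu; apply: emeasurable_sum => k; exact: (bH k).
  - by move=> v; case: ifP => // _; rewrite lee_fin mul1r dir_weight_ge0.
  - move=> v; case: asboolP => st; last exact: sume_ge0.
    have [j mj] := simplex_large st.
    rewrite /H (bigD1 j)//= on_simplexT// /big mj.
    by rewrite leeDl//; apply: sume_ge0 => k _; exact: H0.
rewrite /H sumG; apply: lte_sum_pinfty => j _.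
by rewrite GE.
Qed.

(** * Laplace asymptotics on the simplex *)

Definition zmass (R : realType) K (ts t : 'rV[R]_K) : R :=
  \sum_(k < K | ts ord0 k == 0) t ord0 k.

Definition sqdist (R : realType) K (ts t : 'rV[R]_K) : R :=
  \sum_(i < K) (t ord0 i - ts ord0 i) ^+ 2.

(** The direction in the sum-zero hyperplane with coordinates y in the chart j. *)
Definition face_vec (R : realType) N (j : 'I_N.+1) (y : 'I_N -> R)
  : 'rV[R]_N.+1 :=
  \row_a (if unlift j a is Some k then y k else - \sum_k y k).

(** The differential of the chart, cut down to the face of ts. Zero rows stand for the vanishing
    coordinates, so that the size is N whatever their number. *)
Definition face_mx (R : realType) N (j : 'I_N.+1) (ts : 'rV[R]_N.+1)
  : 'M[R]_(N, N.+1) :=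
  \matrix_(i, a) (if ts ord0 (lift j i) == 0 then 0
                  else (a == lift j i)%:R - (a == j)%:R).

(* The opposite of A restricted to the tangent space of the face of ts, extended
   by the identity on the coordinates vanishing at ts. *)
Definition core_mx (R : realType) N (j : 'I_N.+1) (ts : 'rV[R]_N.+1)
    (A : 'M[R]_N.+1) : 'M[R]_N :=
  diag_mx (\row_i (ts ord0 (lift j i) == 0)%:R)
  - face_mx j ts *m A *m (face_mx j ts)^T.

Definition face_proj (R : realType) N (j : 'I_N.+1) (ts : 'rV[R]_N.+1)
    (y : 'I_N -> R) : 'I_N -> R :=
  fun i => if ts ord0 (lift j i) == 0 then 0 else y i.

Definition tangent_negdef (R : realType) K (ts : 'rV[R]_K) (A : 'M[R]_K) : Prop :=
  forall d : 'rV[R]_K, d != 0 -> \sum_i d ord0 i = 0 ->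
    (forall i, ts ord0 i = 0 -> d ord0 i = 0) -> qf A d < 0.

Lemma face_vec_lift (R : realType) N (j : 'I_N.+1) (y : 'I_N -> R) k :
  face_vec j y ord0 (lift j k) = y k.
Proof. by rewrite mxE liftK. Qed.

Lemma face_vec_id (R : realType) N (j : 'I_N.+1) (y : 'I_N -> R) :
  face_vec j y ord0 j = - \sum_k y k.
Proof. by rewrite mxE unlift_none. Qed.

Lemma face_vec_bound (R : realType) N (j : 'I_N.+1) (y : 'I_N -> R) (D : R) a :
  0 <= D -> (forall k, `|y k| <= D) -> `|face_vec j y ord0 a| <= N.+1%:R * D.
Proof.
move=> D0 yD; case: (unliftP j a) => [k ->|->].
  by rewrite face_vec_lift (le_trans (yD k))// ler_peMl ?ler1n.
rewrite face_vec_id normrN; apply: le_trans (ler_norm_sum _ _ _) _.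
apply: le_trans (_ : \sum_(k < N) D <= _); first exact: ler_sum.
by rewrite sumr_const card_ord -[leLHS]mulr_natl ler_wpM2r// ler_nat.
Qed.

Lemma zmassE (R : realType) N (j : 'I_N.+1) (ts t : 'rV[R]_N.+1) :
  ts ord0 j != 0 ->
  zmass ts t = \sum_(i < N | ts ord0 (lift j i) == 0) t ord0 (lift j i).
Proof.
move=> j0; rewrite /zmass big_mkcond (bigD1_ord j)//= (negbTE j0) add0r.
by rewrite [RHS]big_mkcond.
Qed.

Lemma mul_face_mx (R : realType) N (j : 'I_N.+1) (ts : 'rV[R]_N.+1)
    (u : 'rV[R]_N) :
  u *m face_mx j ts = face_vec j (face_proj j ts (u ord0)).
Proof.
have jl k : (lift j k == j) = false by rewrite eq_sym (negbTE (neq_lift _ _)).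
apply/rowP => a; rewrite mxE; case: (unliftP j a) => [k ->|->].
  rewrite face_vec_lift (bigD1 k)//= big1 ?addr0 => [|i ik]; rewrite !mxE /face_proj.
    by case: ifP => _; rewrite ?mulr0// eqxx jl subr0 mulr1.
  case: ifP => _; rewrite ?mulr0//.
  by rewrite (inj_eq (@lift_inj _ _)) eq_sym (negbTE ik) jl subr0 mulr0.
rewrite face_vec_id -sumrN; apply: eq_bigr => i _; rewrite mxE /face_proj.
case: ifP => _; first by rewrite mulr0 oppr0.
by rewrite (negbTE (neq_lift _ _)) eqxx sub0r mulrN1.
Qed.

Lemma qf_core_mx (R : realType) N (j : 'I_N.+1) (ts : 'rV[R]_N.+1)
    (A : 'M[R]_N.+1) (u : 'rV[R]_N) :
  qf (core_mx j ts A) u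
  = \sum_(i | ts ord0 (lift j i) == 0) u ord0 i ^+ 2
    - qf A (face_vec j (face_proj j ts (u ord0))).
Proof.
rewrite -mul_face_mx /qf /core_mx mulmxBr mulmxBl mxE [X in _ + X]mxE.
congr (_ - _); last by rewrite trmx_mul !mulmxA.
rewrite mxE [RHS]big_mkcond; apply: eq_bigr => i _.
rewrite mul_mx_diag !mxE; case: eqP => _; first by rewrite mulr1 expr2.
by rewrite mulr0 mul0r.
Qed.

Lemma sum_face_vec (R : realType) N (j : 'I_N.+1) (y : 'I_N -> R) :
  \sum_a face_vec j y ord0 a = 0.
Proof.
rewrite (bigD1_ord j)//= face_vec_id.
by under eq_bigr do rewrite face_vec_lift; rewrite addNr.
Qed.

Lemma core_mx_sym (R : realType) N (j : 'I_N.+1) (ts : 'rV[R]_N.+1)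
    (A : 'M[R]_N.+1) : A^T = A -> (core_mx j ts A)^T = core_mx j ts A.
Proof.
by move=> sA; rewrite /core_mx linearB /= tr_diag_mx !trmx_mul trmxK sA mulmxA.
Qed.

(** If the face part of u is nonzero, the hypothesis on A applies to it; otherwise u lives on the
    vanishing coordinates, where the block is the identity. *)
Lemma core_mx_posdef (R : realType) N (j : 'I_N.+1) (ts : 'rV[R]_N.+1)
    (A : 'M[R]_N.+1) :
  ts ord0 j != 0 -> tangent_negdef ts A -> posdef (core_mx j ts A).
Proof.
move=> j0 nA u u0; rewrite qf_core_mx.
set d := face_vec _ _; have S0 : 0 <= \sum_(i | ts ord0 (lift j i) == 0) u ord0 i ^+ 2.
  by apply: sumr_ge0 => i _; exact: sqr_ge0.
have [d0|d0] := eqVneq d 0; last first.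
  rewrite ltr_wpDl// oppr_gt0; apply: nA => //; first exact: sum_face_vec.
  move=> a; case: (unliftP j a) => [k ->|->]; last by move/eqP; rewrite (negbTE j0).
  by rewrite /d face_vec_lift /face_proj => ->; rewrite eqxx.
rewrite d0 qf0 subr0 lt_neqAle S0 andbT eq_sym.
apply: contra u0 => /eqP Se; apply/eqP/rowP => i; rewrite mxE.
case: (boolP (ts ord0 (lift j i) == 0)) => zi.
  have /psumr_eq0P : forall k : 'I_N, ts ord0 (lift j k) == 0 -> 0 <= u ord0 k ^+ 2.
    by move=> k _; exact: sqr_ge0.
  by move=> /(_ Se i zi) /eqP; rewrite sqrf_eq0 => /eqP.
have : d ord0 (lift j i) = 0 by rewrite d0 mxE.
by rewrite /d face_vec_lift /face_proj (negbTE zi).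
Qed.

Lemma core_mx_zrow (R : realType) N (j : 'I_N.+1) (ts : 'rV[R]_N.+1)
    (A : 'M[R]_N.+1) (i k : 'I_N) :
  ts ord0 (lift j i) = 0 -> core_mx j ts A i k = (i == k)%:R.
Proof.
move=> zi; rewrite mxE [X in _ + X]mxE [X in _ - X]mxE big1 ?subr0 => [|a _].
  by rewrite !mxE zi eqxx; case: eqP => _; rewrite ?mulr1n ?mulr0n.
by rewrite mxE big1 ?mul0r// => b _; rewrite mxE zi eqxx mul0r.
Qed.

Lemma qf_dist (R : realType) K (A : 'M[R]_K) (x y : 'rV[R]_K) (D e : R) :
  (forall a, `|x ord0 a| <= D) -> (forall a, `|y ord0 a| <= D) ->
  (forall a, `|x ord0 a - y ord0 a| <= e) ->
  `|qf A x - qf A y| <= (\sum_a \sum_b `|A a b|) * (2 * D * e).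
Proof.
move=> xD yD xye; rewrite !qfE -sumrB mulr_suml.
apply: le_trans (ler_norm_sum _ _ _) _; apply: ler_sum => a _.
rewrite -sumrB mulr_suml.
apply: le_trans (ler_norm_sum _ _ _) _; apply: ler_sum => b _.
have -> : x ord0 a * A a b * x ord0 b - y ord0 a * A a b * y ord0 b
  = A a b * (x ord0 a * (x ord0 b - y ord0 b) + (x ord0 a - y ord0 a) * y ord0 b) by ring.
rewrite normrM ler_wpM2l// (le_trans (ler_normD _ _))// !normrM.
have -> : 2 * D * e = D * e + e * D by ring.
by apply: lerD; apply: ler_pM.
Qed.

(* E^n has a Laplace-type peak at ts: to second order, and up to a constant, ln E is
   minus the linear form lam in the coordinates vanishing at ts plus half the
   quadratic form A. *)
Record peak (R : realType) K (ts : 'rV[R]_K) (E : 'rV[R]_K -> R) (Emax : R)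
    (lam : 'I_K -> R) (A : 'M[R]_K) : Prop := Peak {
  peak_max : 0 < Emax;
  peak_range : forall t, simplex R K t -> 0 <= E t <= Emax;
  peak_meas : smeas E;
  peak_far : forall delta, 0 < delta ->
    exists2 q, 0 <= q < 1 & forall t, simplex R K t ->
      (exists i, delta <= `|t ord0 i - ts ord0 i|) -> E t <= q * Emax;
  peak_local : forall eps, 0 < eps ->
    exists2 delta, 0 < delta & forall t, simplex R K t ->
      (forall i, `|t ord0 i - ts ord0 i| < delta) ->
      exists2 l, E t = Emax * expR l &
        `|l + \sum_(k < K | ts ord0 k == 0) lam k * t ord0 k - 2^-1 * qf A (t - ts)|
        <= eps * (zmass ts t + sqdist ts t) }.

Lemma qfD (R : realType) K (A B : 'M[R]_K) (x : 'rV[R]_K) :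
  qf (A + B) x = qf A x + qf B x.
Proof. by rewrite /qf mulmxDr mulmxDl mxE. Qed.

Lemma zmass_ge0 (R : realType) K (ts t : 'rV[R]_K) :
  simplex R K t -> 0 <= zmass ts t.
Proof. by move=> [t0 _]; apply: sumr_ge0. Qed.

Lemma sqdist_ge0 (R : realType) K (ts t : 'rV[R]_K) : 0 <= sqdist ts t.
Proof. by apply: sumr_ge0 => i _; exact: sqr_ge0. Qed.

Lemma peakM (R : realType) K (ts : 'rV[R]_K) E1 M1 l1 A1 E2 M2 l2 A2 :
  @peak R K ts E1 M1 l1 A1 -> @peak R K ts E2 M2 l2 A2 ->
  peak ts (fun t => E1 t * E2 t) (M1 * M2) (fun k => l1 k + l2 k) (A1 + A2).
Proof.
move=> [m1 r1 s1 f1 c1] [m2 r2 s2 f2 c2]; split.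
- exact: mulr_gt0.
- move=> t st; have /andP[a0 a1] := r1 t st; have /andP[b0 b1] := r2 t st.
  by rewrite mulr_ge0//= ler_pM.
- exact: smeasM.
(* The gain of the first factor is enough, the second one being at most [M2]. *)
- move=> delta d0; have [q q01 Hq] := f1 _ d0; exists q => // t st far.
  have /andP[a0 a1] := r1 t st; have /andP[b0 b1] := r2 t st.
  by rewrite mulrA ler_pM// Hq.
- move=> eps e0; have e20 : 0 < eps / 2 by rewrite divr_gt0.
  have [d1 d10 H1] := c1 _ e20; have [d2 d20 H2] := c2 _ e20.
  exists (Num.min d1 d2) => [|t st near]; first by rewrite lt_min d10.
  have [i|x1 E1x h1] := H1 t st.
    by have := near i; rewrite lt_min => /andP[].
  have [i|x2 E2x h2] := H2 t st.
    by have := near i; rewrite lt_min => /andP[].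
  exists (x1 + x2); first by rewrite E1x E2x expRD mulrACA.
  rewrite qfD; under eq_bigr do rewrite mulrDl.
  rewrite big_split /=.
  set p1 := \sum_(_ < _ | _) _ in h1 *; set p2 := \sum_(_ < _ | _) _ in h2 *.
  have -> : x1 + x2 + (p1 + p2) - 2^-1 * (qf A1 (t - ts) + qf A2 (t - ts))
    = (x1 + p1 - 2^-1 * qf A1 (t - ts)) + (x2 + p2 - 2^-1 * qf A2 (t - ts)) by ring.
  apply: le_trans (ler_normD _ _) _; apply: le_trans (lerD h1 h2) _.
  rewrite -mulrDl le_eqVlt; apply/orP; left; apply/eqP; congr (_ * _); by field.
Qed.

(** Cauchy-Schwarz, from 2 p_i p_k <= p_i^2 + p_k^2 summed over both indices. *)
Lemma sqr_sum_le (R : realType) (n : nat) (p : 'I_n -> R) :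
  (\sum_i p i) ^+ 2 <= n%:R * \sum_i p i ^+ 2.
Proof.
have e1 : n%:R * \sum_i p i ^+ 2 = \sum_i \sum_(k < n) p i ^+ 2.
  rewrite mulr_sumr; apply: eq_bigr => i _.
  by rewrite sumr_const card_ord -[RHS]mulr_natl.
have e2 : n%:R * \sum_i p i ^+ 2 = \sum_(i < n) \sum_k p k ^+ 2.
  by rewrite e1 exchange_big.
have e3 : 2 * (n%:R * \sum_i p i ^+ 2)
    = \sum_i \sum_(k < n) p i ^+ 2 + \sum_(i < n) \sum_k p k ^+ 2.
  by rewrite -e1 -e2 mulr_natl mulr2n.
rewrite -(ler_pM2l (_ : 0 < 2 :> R))// e3.
rewrite -big_split /= expr2 mulr_suml mulr_sumr; apply: ler_sum => i _.
rewrite -big_split /= !mulr_sumr; apply: ler_sum => k _.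
by rewrite -subr_ge0 (_ : _ - _ = (p i - p k) ^+ 2) ?sqr_ge0//; ring.
Qed.

Lemma simplex_sub_face_vec (R : realType) N (j : 'I_N.+1) (ts t : 'rV[R]_N.+1) :
  simplex R N.+1 ts -> simplex R N.+1 t ->
  t - ts = face_vec j (fun k => t ord0 (lift j k) - ts ord0 (lift j k)).
Proof.
move=> [_ s1] [_ t1]; apply/rowP => a; case: (unliftP j a) => [k ->|->].
  by rewrite face_vec_lift !mxE.
rewrite face_vec_id !mxE sumrB; move: s1 t1.
rewrite !(bigD1_ord j)//= => s1 t1.
rewrite -[X in X - _](addrK (\sum_(i < N) t ord0 (lift j i))) t1.
by rewrite -[X in _ - X](addrK (\sum_(i < N) ts ord0 (lift j i))) s1; ring.
Qed.

Definition facet_sqdist (R : realType) N (j : 'I_N.+1) (ts t : 'rV[R]_N.+1) : R :=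
  \sum_(i < N | ts ord0 (lift j i) != 0) (t ord0 (lift j i) - ts ord0 (lift j i)) ^+ 2.

(** The inverse of 1 plus the sum of the inverses avoids a minimum over a possibly empty family. *)
Lemma ex_lower_bound (R : realType) (I : finType) (P : pred I) (lam : I -> R) :
  (forall k, P k -> 0 < lam k) -> exists2 m, 0 < m & forall k, P k -> m <= lam k.
Proof.
move=> l0; pose s := 1 + \sum_(k | P k) (lam k)^-1.
have S0 : 0 <= \sum_(k | P k) (lam k)^-1.
  by apply: sumr_ge0 => k Pk; rewrite invr_ge0 ltW// l0.
have s0 : 0 < s by rewrite ltr_pwDl.
exists s^-1 => [|k Pk]; first by rewrite invr_gt0.
rewrite -[leRHS]invrK lef_pV2 ?posrE ?invr_gt0 ?l0//.
rewrite /s (bigD1 k)//= addrCA lerDl addr_ge0// sumr_ge0// => i /andP[Pi _].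
by rewrite invr_ge0 ltW// l0.
Qed.

(** This bound dominates the rescaled integrands. The quadratic form has a sign on the face only;
    its cross terms with the vanishing coordinates are at most a multiple of delta times [zmass] and
    are absorbed by the linear decay. *)
Lemma peak_bound (R : realType) N (j : 'I_N.+1) (ts : 'rV[R]_N.+1)
    (E : 'rV[R]_N.+1 -> R) (Emax : R) (lam : 'I_N.+1 -> R) (A : 'M[R]_N.+1) :
  simplex R N.+1 ts -> ts ord0 j != 0 -> A^T = A -> tangent_negdef ts A ->
  (forall k, ts ord0 k == 0 -> 0 < lam k) ->
  peak ts E Emax lam A ->
  exists2 c, 0 < c & exists2 delta, 0 < delta & forall t, simplex R N.+1 t ->
    (forall i, `|t ord0 i - ts ord0 i| < delta) ->
    E t <= Emax * expR (- (c * (zmass ts t + facet_sqdist j ts t))).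
Proof.
move=> sts j0 sA nA lam0 pE.
have [c0 c00 Hc0] := posdef_coercive (core_mx_sym j ts sA) (core_mx_posdef j0 nA).
have [lm lm0 Hlm] := ex_lower_bound lam0.
pose n1 : R := N.+1%:R.
have n10 : 0 < n1 by rewrite ltr0n.
have n11 : 1 <= n1 by rewrite ler1n.
pose S := \sum_a \sum_b `|A a b|.
have S0 : 0 <= S by apply: sumr_ge0 => a _; apply: sumr_ge0 => b _.
(* With z and Y for [zmass] and [facet_sqdist], the expansion provides a decay of lm z + c0/2 Y. The
   remainder costs at most lm/4 z + c0/4 Y and the cross terms lm/4 z, which leaves lm/2 and
   c0/4. *)
pose eps := Num.min (lm / 8) (c0 / (8 * n1)).
have eps0 : 0 < eps by rewrite lt_min !divr_gt0 ?mulr_gt0.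
have [d1 d10 Hd1] := peak_local pE eps0.
(* The second bound gives 2 n1 z^2 <= z, the third S n1 delta <= lm/4; S + 1 avoids a zero
   denominator. *)
pose delta := Num.min d1 (Num.min (2 * n1 ^+ 2)^-1 (lm / (4 * (S + 1) * n1))).
have delta0 : 0 < delta.
  by rewrite !lt_min d10 invr_gt0 divr_gt0 ?mulr_gt0 ?exprn_gt0 ?ltr_wpDl.
exists (Num.min (lm / 2) (c0 / 4)); first by rewrite lt_min !divr_gt0.
exists delta => // t st near.
have near1 i : `|t ord0 i - ts ord0 i| < d1.
  by have := near i; rewrite lt_min => /andP[].
have [l -> hl] := Hd1 t st near1.
rewrite ler_pM2l ?(peak_max pE)// ler_expR.
set z := zmass ts t in hl *; set Y := facet_sqdist j ts t.
have z0 : 0 <= z by exact: zmass_ge0.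
have Y0 : 0 <= Y by apply: sumr_ge0 => i _; exact: sqr_ge0.
pose y k := t ord0 (lift j k) - ts ord0 (lift j k).
pose p := face_proj j ts y.
pose d := t - ts; pose dS := face_vec j p.
have dE : d = face_vec j y by exact: simplex_sub_face_vec.
have yd k : `|y k| <= delta by rewrite ltW// near.
have pd k : `|p k| <= delta.
  by rewrite /p /face_proj; case: ifP => _ //; rewrite normr0 ltW.
have d_le a : `|d ord0 a| <= n1 * delta.
  by rewrite dE; apply: face_vec_bound => //; exact: ltW.
have dS_le a : `|dS ord0 a| <= n1 * delta by apply: face_vec_bound => //; exact: ltW.
have zE : z = \sum_(i < N | ts ord0 (lift j i) == 0) t ord0 (lift j i) by exact: zmassE.
have yp k : y k - p k = if ts ord0 (lift j k) == 0 then t ord0 (lift j k) else 0.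
  rewrite /p /face_proj; case: eqP => [e|_]; last by rewrite subrr.
  by rewrite /y e !subr0.
have t0 : forall i, 0 <= t ord0 i by case: st.
have d_dS a : `|d ord0 a - dS ord0 a| <= z.
  rewrite dE; case: (unliftP j a) => [k ->|->].
    rewrite !face_vec_lift yp; case: ifP => zk; last by rewrite normr0.
    by rewrite ger0_norm// zE (bigD1 k)//= lerDl sumr_ge0.
  rewrite !face_vec_id opprK addrC -sumrB -normrN -sumrN.
  rewrite (eq_bigr (fun k => if ts ord0 (lift j k) == 0 then t ord0 (lift j k) else 0)); last first.
    by move=> k _; rewrite opprB yp.
  by rewrite -big_mkcond/= -zE ger0_norm.
(* [d] and its face part [dS] differ by at most z in each coordinate; on [dS] the coercivity of
   [core_mx] applies. *)
have q1 : qf A d <= - (c0 * Y) + S * (2 * (n1 * delta) * z).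
  have := qf_dist A d_le dS_le d_dS; rewrite -/S => /(le_trans (ler_norm _)).
  rewrite lerBlDl => /le_trans; apply; rewrite lerD2r.
  have := Hc0 (\row_k p k); rewrite qf_core_mx.
  have -> : \sum_i (\row_k p k) ord0 i ^+ 2 = Y.
    rewrite /Y /facet_sqdist [RHS]big_mkcond /=; apply: eq_bigr => i _.
    by rewrite mxE /p /face_proj; case: eqP => _ //=; rewrite expr0n.
  rewrite big1 ?sub0r => [|i zi]; last first.
    by rewrite mxE /p /face_proj zi expr0n.
  have -> : face_vec j (face_proj j ts ((\row_k p k) ord0)) = dS.
    apply/rowP => a; rewrite !mxE; case: (unlift j a) => [k|].
      by rewrite /face_proj mxE /p /face_proj; case: eqP.
    congr (- _); apply: eq_bigr => k _.
    by rewrite /face_proj mxE /p /face_proj; case: eqP.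
  by rewrite lerNr.
have zn : z <= n1 * delta.
  rewrite zE; apply: le_trans (_ : \sum_(i < N) delta <= _).
    rewrite big_mkcond; apply: ler_sum => i _; case: eqP => [e|_]; last exact: ltW.
    by have := yd i; rewrite /y e subr0 => /(le_trans (ler_norm _)).
  rewrite sumr_const card_ord -[leLHS]mulr_natl ler_wpM2r ?ltW//.
  by rewrite ltr_nat.
have z2 : 2 * n1 * z ^+ 2 <= z.
  have : 2 * n1 * z <= 1.
    apply: le_trans (_ : 2 * n1 * (n1 * delta) <= _); first by rewrite ler_pM2l ?mulr_gt0.
    have : delta <= (2 * n1 ^+ 2)^-1 by rewrite !ge_min lexx orbT.
    have n20 : 0 < 2 * n1 ^+ 2 by rewrite mulr_gt0 ?exprn_gt0.
    move=> /(ler_wpM2l (ltW n20)); rewrite divff ?gt_eqF// => h.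
    by apply: le_trans h; rewrite le_eqVlt; apply/orP; left; apply/eqP; ring.
  by move=> /(ler_wpM2r z0); rewrite mul1r expr2 mulrA.
(* Coordinatewise, d^2 <= 2 dS^2 + 2 z^2; the omitted coordinate of [dS] is a sum, whose square
   Cauchy-Schwarz bounds by N Y. *)
have sq : sqdist ts t <= 2 * n1 * Y + z.
  apply: le_trans (_ : 2 * n1 * Y + 2 * n1 * z ^+ 2 <= _); last by rewrite lerD2l.
  have -> : sqdist ts t = \sum_a d ord0 a ^+ 2
    by rewrite /sqdist; apply: eq_bigr => a _; rewrite /d !mxE.
  apply: le_trans (_ : \sum_a (2 * dS ord0 a ^+ 2 + 2 * z ^+ 2) <= _).
    apply: ler_sum => a _; have := d_dS a; set da := d ord0 a; set sa := dS ord0 a => h.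
    have h2 : (da - sa) ^+ 2 <= z ^+ 2.
      by rewrite -[leLHS]real_normK ?num_real// lerXn2r ?nnegrE.
    apply: le_trans (_ : 2 * sa ^+ 2 + 2 * (da - sa) ^+ 2 <= _).
      by rewrite -subr_ge0 (_ : _ - _ = (da - 2 * sa) ^+ 2) ?sqr_ge0//; ring.
    by rewrite lerD2l ler_pM2l.
  rewrite big_split /= sumr_const card_ord -[_ *+ N.+1]mulr_natl -/n1 -mulr_sumr.
  rewrite [n1 * _]mulrCA mulrA lerD2r -[leRHS]mulrA ler_pM2l//.
  rewrite (bigD1_ord j)//= face_vec_id sqrrN.
  have -> : Y = \sum_k p k ^+ 2.
    rewrite /Y /facet_sqdist [LHS]big_mkcond /=; apply: eq_bigr => i _.
    by rewrite /p /face_proj; case: eqP => _ //=; rewrite expr0n.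
  under [X in _ + X]eq_bigr do rewrite face_vec_lift.
  rewrite /n1 -natr1 mulrDl mul1r lerD2r; exact: sqr_sum_le.
have lz : lm * z <= \sum_(k < N.+1 | ts ord0 k == 0) lam k * t ord0 k.
  rewrite /z /zmass mulr_sumr; apply: ler_sum => k zk.
  by rewrite ler_wpM2r// Hlm.
have Sd : S * (n1 * delta) <= lm / 4.
  have h : delta <= lm / (4 * (S + 1) * n1) by rewrite !ge_min lexx !orbT.
  have s1 : 0 < 4 * (S + 1) * n1 by rewrite !mulr_gt0// ltr_wpDl.
  rewrite ler_pdivlMr// in h.
  rewrite ler_pdivlMr//; apply: le_trans h.
  rewrite -subr_ge0 (_ : _ - _ = 4 * n1 * delta); last by ring.
  by rewrite !mulr_ge0 ?ltW.
have e1 : eps <= lm / 8 by rewrite ge_min lexx.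
have e2 : eps * n1 <= c0 / 8.
  have : eps <= c0 / (8 * n1) by rewrite ge_min lexx orbT.
  rewrite ler_pdivlMr ?mulr_gt0// => h.
  by rewrite ler_pdivlMr// mulrAC -mulrA.
have el : l <= - (lm * z) + 2^-1 * (- (c0 * Y) + S * (2 * (n1 * delta) * z))
    + eps * (z + (2 * n1 * Y + z)).
  have h1 : eps * (z + sqdist ts t) <= eps * (z + (2 * n1 * Y + z)).
    by rewrite ler_pM2l// lerD2l.
  move: hl => /(le_trans (ler_norm _)) hl.
  by move: q1 hl h1 lz; rewrite -/d; lra.
have ez : eps * z <= lm / 8 * z by rewrite ler_wpM2r.
have eY : eps * n1 * Y <= c0 / 8 * Y by rewrite ler_wpM2r.
have Sz : S * (n1 * delta) * z <= lm / 4 * z by rewrite ler_wpM2r.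
apply: (@le_trans _ _ (- (lm / 2 * z) - c0 / 4 * Y)).
  have e3 : S * (2 * (n1 * delta) * z) = 2 * (S * (n1 * delta) * z) by ring.
  have e4 : eps * (z + (2 * n1 * Y + z)) = 2 * (eps * z) + 2 * (eps * n1 * Y) by ring.
  by move: el; rewrite e3 e4; lra.
have m1 : Num.min (lm / 2) (c0 / 4) * z <= lm / 2 * z by rewrite ler_wpM2r// ge_min lexx.
have m2 : Num.min (lm / 2) (c0 / 4) * Y <= c0 / 4 * Y by rewrite ler_wpM2r// ge_min lexx orbT.
by rewrite mulrDr; lra.
Qed.

(** * The rescaled chart and the pointwise limit of E^n *)

Lemma cvg_sumr (R : realType) (I : Type) (r : seq I) (f : I -> nat -> R) (l : I -> R) :
  (forall i, f i k @[k --> \oo] --> l i) ->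
  \sum_(i <- r) f i k @[k --> \oo] --> \sum_(i <- r) l i.
Proof.
move=> cf; elim: r => [|i r IH].
  by rewrite big_nil; under eq_cvg do rewrite big_nil; exact: cvg_cst.
by rewrite big_cons; under eq_cvg do rewrite big_cons; apply: cvgD.
Qed.

Lemma cvg_powRN (R : realType) (s : R) : 0 < s ->
  (k.+1%:R : R) `^ (- s) @[k --> \oo] --> (0 : R).
Proof.
move=> s0; have h : (k.+1%:R^-1 : R) @[k --> \oo] --> (0 : R)^'+.
  move=> P /cvg_harmonic hP.
  have hP' : \forall k \near \oo, 0 < @harmonic R k -> P (@harmonic R k) by [].
  by apply: filterS hP' => k; apply; exact: harmonic_gt0.
have := cvg_comp _ _ h (powR_cvg0 s0).
apply: cvg_trans; apply: near_eq_cvg; apply: nearW => k /=.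
by rewrite -powR_inv1// -powRrM mulN1r.
Qed.

Definition lap_exp (R : realType) N (j : 'I_N.+1) (ts : 'rV[R]_N.+1)
    (i : 'I_N) : R := if ts ord0 (lift j i) == 0 then 1 else 2^-1.

(** The default 0 is the vanishing that [iter_lebesgue_affine] asks from index N on. *)
Definition lap_shift (R : realType) N (j : 'I_N.+1) (ts : 'rV[R]_N.+1)
    (i : nat) : R := if insub i is Some k then ts ord0 (lift j k) else 0.

Definition lap_scale (R : realType) N (j : 'I_N.+1) (ts : 'rV[R]_N.+1)
    (x : R) (i : nat) : R :=
  if insub i is Some k then x `^ (- lap_exp j ts k) else 1.

Definition lap_pt (R : realType) N (j : 'I_N.+1) (ts : 'rV[R]_N.+1)
    (x : R) (u : nat -> R) : 'rV[R]_N.+1 :=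
  chart j (fun i => lap_shift j ts i + lap_scale j ts x i * u i).

Lemma lap_exp_gt0 (R : realType) N (j : 'I_N.+1) (ts : 'rV[R]_N.+1) i :
  0 < lap_exp j ts i.
Proof. by rewrite /lap_exp; case: ifP. Qed.

Lemma lap_pt_lift (R : realType) N (j : 'I_N.+1) (ts : 'rV[R]_N.+1)
    (x : R) (u : nat -> R) (k : 'I_N) :
  lap_pt j ts x u ord0 (lift j k)
  = ts ord0 (lift j k) + x `^ (- lap_exp j ts k) * u k.
Proof. by rewrite chart_lift /lap_shift /lap_scale valK. Qed.

Lemma lap_pt_sub (R : realType) N (j : 'I_N.+1) (ts : 'rV[R]_N.+1)
    (x : R) (u : nat -> R) :
  simplex R N.+1 ts ->
  lap_pt j ts x u - ts = face_vec j (fun k => x `^ (- lap_exp j ts k) * u k).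
Proof.
move=> [_ s1]; apply/rowP => a; case: (unliftP j a) => [k ->|->].
  by rewrite face_vec_lift mxE lap_pt_lift [X in _ + X]mxE addrAC subrr add0r.
rewrite face_vec_id mxE chart_id [X in _ + X]mxE.
have -> : \sum_(k < N) (lap_shift j ts k + lap_scale j ts x k * u k)
    = (1 - ts ord0 j) + \sum_(k < N) x `^ (- lap_exp j ts k) * u k.
  rewrite big_split /=; congr (_ + _).
    rewrite -s1 (bigD1_ord j)//= addrAC subrr add0r.
    by apply: eq_bigr => k _; rewrite /lap_shift valK.
  by apply: eq_bigr => k _; rewrite /lap_scale valK.
ring.
Qed.

Lemma cvg_face_vec (R : realType) N (j : 'I_N.+1) (y : nat -> 'I_N -> R)
    (y0 : 'I_N -> R) (a : 'I_N.+1) :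
  (forall i, y k i @[k --> \oo] --> y0 i) ->
  face_vec j (y k) ord0 a @[k --> \oo] --> face_vec j y0 ord0 a.
Proof.
move=> cy; case: (unliftP j a) => [k ->|->].
  by under eq_cvg do rewrite face_vec_lift; rewrite face_vec_lift; exact: cy.
under eq_cvg do rewrite face_vec_id; rewrite face_vec_id.
by apply: cvgN; apply: cvg_sumr => i; exact: cy.
Qed.

Lemma cvg_lap_pt (R : realType) N (j : 'I_N.+1) (ts : 'rV[R]_N.+1)
    (u : nat -> R) (a : 'I_N.+1) :
  simplex R N.+1 ts ->
  lap_pt j ts k.+1%:R u ord0 a @[k --> \oo] --> ts ord0 a.
Proof.
move=> sts.
have -> : (fun k => lap_pt j ts k.+1%:R u ord0 a) =
   (fun k => face_vec j (fun i => k.+1%:R `^ (- lap_exp j ts i) * u i) ord0 a + ts ord0 a).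
  apply/funext => k; rewrite -lap_pt_sub// [X in _ = X + _]mxE [X in _ = _ + X + _]mxE.
  by rewrite subrK.
rewrite -[X in _ --> X]add0r; apply: cvgD; last exact: cvg_cst.
have -> : 0 = face_vec j (fun i => 0 * u i) ord0 a.
  rewrite mxE; case: (unlift j a) => [k|]; first by rewrite mul0r.
  by rewrite big1 ?oppr0// => i _; rewrite mul0r.
apply: (@cvg_face_vec R N j (fun k i => k.+1%:R `^ (- lap_exp j ts i) * u i)) => i.
by apply: cvgMr_tmp; apply: cvg_powRN; exact: lap_exp_gt0.
Qed.

Lemma scale_face_vec (R : realType) N (j : 'I_N.+1) (c : R) (y : 'I_N -> R) :
  c *: face_vec j y = face_vec j (fun k => c * y k).
Proof.
apply/rowP => a; rewrite !mxE; case: (unlift j a) => [k|] //.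
by rewrite mulrN mulr_sumr.
Qed.

Lemma qfZ (R : realType) (n : nat) (A : 'M[R]_n) (c : R) (x : 'rV[R]_n) :
  qf A (c *: x) = c ^+ 2 * qf A x.
Proof.
by rewrite /qf [(c *: x)^T]linearZ /= -!scalemxAl -scalemxAr !mxE mulrA.
Qed.

Lemma cvg_qf (R : realType) (n : nat) (A : 'M[R]_n) (x : nat -> 'rV[R]_n) (x0 : 'rV[R]_n) :
  (forall a, x k ord0 a @[k --> \oo] --> x0 ord0 a) ->
  qf A (x k) @[k --> \oo] --> qf A x0.
Proof.
move=> cx; under eq_cvg do rewrite qfE; rewrite qfE.
apply: cvg_sumr => a; apply: cvg_sumr => b.
by apply: cvgM; [apply: cvgM; [exact: cx|exact: cvg_cst]|exact: cx].
Qed.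

(** Multiplied by sqrt n, a chart coordinate scaled by 1/n vanishes in the limit and one scaled by
    1/sqrt n is constant: only the face part reaches the quadratic form. *)
Lemma cvg_lap_scaled (R : realType) N (j : 'I_N.+1) (ts : 'rV[R]_N.+1)
    (u : nat -> R) (a : 'I_N.+1) :
  simplex R N.+1 ts ->
  (Num.sqrt k.+1%:R *: (lap_pt j ts k.+1%:R u - ts)) ord0 a @[k --> \oo]
  --> face_vec j (face_proj j ts (fun i => u i)) ord0 a.
Proof.
move=> sts; under eq_cvg do rewrite lap_pt_sub// scale_face_vec.
apply: (@cvg_face_vec R N j (fun k i => Num.sqrt k.+1%:R * (k.+1%:R `^ (- lap_exp j ts i) * u i))) => i.
have k0 (k : nat) : 0 < k.+1%:R :> R by [].
have e (k : nat) (s : R) : Num.sqrt k.+1%:R * (k.+1%:R `^ (- s) * u i)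
    = k.+1%:R `^ (2^-1 - s) * u i.
  by rewrite mulrA -powR12_sqrt// -powRD//; apply/implyP => _; rewrite gt_eqF.
rewrite (_ : (fun k => _) = (fun k => k.+1%:R `^ (2^-1 - lap_exp j ts i) * u i)); last first.
  by apply/funext => k; rewrite e.
have [zi|zi] := boolP (ts ord0 (lift j i) == 0).
  rewrite /face_proj /lap_exp zi.
  suff : (k.+1%:R : R) `^ (2^-1 - 1) * u i @[k --> \oo] --> 0 * u i by rewrite mul0r.
  apply: cvgMr_tmp.
  have -> : 2^-1 - 1 = - 2^-1 :> R by field.
  exact: cvg_powRN.
rewrite /face_proj /lap_exp (negbTE zi) subrr.
by under eq_cvg do rewrite powRr0 mul1r; exact: cvg_cst.
Qed.

Lemma near_lap_pt (R : realType) N (j : 'I_N.+1) (ts : 'rV[R]_N.+1)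
    (u : nat -> R) (delta : R) :
  simplex R N.+1 ts -> 0 < delta ->
  \forall k \near \oo, forall i, `|lap_pt j ts k.+1%:R u ord0 i - ts ord0 i| < delta.
Proof.
move=> sts d0; apply: filter_forall => i.
by have /cvgrPdistC_lt/(_ _ d0) := @cvg_lap_pt R N j ts u i sts.
Qed.

(** The sum is 1 by construction, positive coordinates of ts stay positive near ts, and the
    vanishing ones become nonnegative multiples of u_i. *)
Lemma near_lap_simplex (R : realType) N (j : 'I_N.+1) (ts : 'rV[R]_N.+1)
    (u : nat -> R) :
  simplex R N.+1 ts -> ts ord0 j != 0 ->
  (forall i : 'I_N, ts ord0 (lift j i) == 0 -> 0 <= u i) ->
  \forall k \near \oo, simplex R N.+1 (lap_pt j ts k.+1%:R u).
Proof.
move=> sts j0 u0; have [ts0 _] := sts.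
suff : \forall k \near \oo, forall a, 0 <= lap_pt j ts k.+1%:R u ord0 a.
  by apply: filterS => k H; split=> //; exact: sum_chart.
apply: filter_forall => a.
have [z|nz] := eqVneq (ts ord0 a) 0; last first.
  have tsa : 0 < ts ord0 a by rewrite lt_neqAle eq_sym nz ts0.
  have /cvgrPdistC_lt/(_ _ tsa) := @cvg_lap_pt R N j ts u a sts.
  by apply: filterS => k; rewrite ltr_norml => /andP[+ _]; rewrite ltrBrDl subrr => /ltW.
apply: nearW => k; case: (unliftP j a) z => [i ->|->] z; last by rewrite z eqxx in j0.
by rewrite lap_pt_lift z add0r mulr_ge0 ?powR_ge0// u0// z.
Qed.

Lemma zmass_lap_pt (R : realType) N (j : 'I_N.+1) (ts : 'rV[R]_N.+1)
    (u : nat -> R) (x : R) (lam : 'I_N.+1 -> R) : 0 < x -> ts ord0 j != 0 ->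
  x * \sum_(k < N.+1 | ts ord0 k == 0) lam k * lap_pt j ts x u ord0 k
  = \sum_(i < N | ts ord0 (lift j i) == 0) lam (lift j i) * u i.
Proof.
move=> x0 j0; rewrite big_mkcond (bigD1_ord j)//= (negbTE j0) add0r.
rewrite mulr_sumr [RHS]big_mkcond; apply: eq_bigr => i _; case: eqP => [z|_]; last by rewrite mulr0.
rewrite lap_pt_lift z add0r /lap_exp z eqxx powR_inv1 ?ltW//.
by rewrite mulrCA mulVKf// gt_eqF.
Qed.

(** In n ln(E / Emax) the linear part no longer depends on n after rescaling, the quadratic part
    converges, and the error is eps times a bounded quantity, because [zmass] and [sqdist] are of
    order 1/n. *)
Lemma cvg_lap_peak (R : realType) N (j : 'I_N.+1) (ts : 'rV[R]_N.+1)
    (E : 'rV[R]_N.+1 -> R) (Emax : R) (lam : 'I_N.+1 -> R) (A : 'M[R]_N.+1)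
    (u : nat -> R) :
  simplex R N.+1 ts -> ts ord0 j != 0 -> peak ts E Emax lam A ->
  (forall i : 'I_N, ts ord0 (lift j i) == 0 -> 0 <= u i) ->
  (E (lap_pt j ts k.+1%:R u) / Emax) ^+ k.+1 @[k --> \oo]
  --> expR (- \sum_(i < N | ts ord0 (lift j i) == 0) lam (lift j i) * u i
            + 2^-1 * qf A (face_vec j (face_proj j ts (fun i => u i)))).
Proof.
move=> sts j0 pE u0; have m0 := peak_max pE.
set Lz := \sum_(_ < _ | _) _; set q0 := qf A _.
pose t k := lap_pt j ts k.+1%:R u.
pose q k := qf A (Num.sqrt k.+1%:R *: (t k - ts)).
have cq : q k @[k --> \oo] --> q0.
  by apply: cvg_qf => a; exact: cvg_lap_scaled.
pose l k := ln (E (t k) / Emax).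
pose X k := k.+1%:R * l k + Lz - 2^-1 * q k.
pose Z := \sum_(i < N | ts ord0 (lift j i) == 0) 1 * u i.
have Z0 : 0 <= Z by apply: sumr_ge0 => i zi; rewrite mul1r u0.
pose b k := \sum_a ((Num.sqrt k.+1%:R *: (t k - ts)) ord0 a) ^+ 2.
pose b0 := \sum_a (face_vec j (face_proj j ts (fun i => u i)) ord0 a) ^+ 2.
have cb : b k @[k --> \oo] --> b0.
  apply: cvg_sumr => a; under eq_cvg do rewrite expr2; rewrite expr2.
  by apply: cvgM; exact: cvg_lap_scaled.
have b00 : 0 <= b0 by apply: sumr_ge0 => a _; exact: sqr_ge0.
(* Eventually n (zmass + sqdist) is at most [B], so the expansion is used with eps / B. *)
pose B := Z + (b0 + 1).
have B0 : 0 < B by rewrite ltr_wpDl// ltr_wpDl.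
have k0 (k : nat) : 0 < k.+1%:R :> R by [].
(* Near ts the function is positive, so the logarithm [l] is a genuine one. *)
have Epos : \forall k \near \oo, E (t k) = Emax * expR (l k).
  have [d d0 Hd] := peak_local pE ltr01.
  near=> k.
  have sk : simplex R N.+1 (t k) by near: k; exact: near_lap_simplex.
  have nk : forall i, `|t k ord0 i - ts ord0 i| < d by near: k; exact: near_lap_pt.
  have [l' E' _] := Hd _ sk nk.
  by rewrite /l E' mulrAC divff ?gt_eqF// mul1r expRK.
have cX : X k @[k --> \oo] --> (0 : R).
  apply/cvgr0Pnorm_le => eps e0.
  have eB : 0 < eps / B by rewrite divr_gt0.
  have [d d0 Hd] := peak_local pE eB.
  near=> k.
  have sk : simplex R N.+1 (t k) by near: k; exact: near_lap_simplex.
  have nk : forall i, `|t k ord0 i - ts ord0 i| < d by near: k; exact: near_lap_pt.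
  have [l' E' Hl] := Hd _ sk nk.
  have -> : X k = k.+1%:R * (l' + \sum_(i < N.+1 | ts ord0 i == 0) lam i * t k ord0 i
      - 2^-1 * qf A (t k - ts)).
    have ll : l k = l' by rewrite /l E' mulrAC divff ?gt_eqF// mul1r expRK.
    rewrite /X ll mulrBr mulrDr zmass_lap_pt// -/Lz; congr (_ - _).
    by rewrite /q qfZ sqr_sqrtr ?ltW// mulrCA.
  rewrite normrM gtr0_norm//;
  apply: le_trans (_ : k.+1%:R * (eps / B * (zmass ts (t k) + sqdist ts (t k))) <= _).
    by rewrite ler_pM2l.
  have -> : k.+1%:R * (eps / B * (zmass ts (t k) + sqdist ts (t k))) = eps / B * (Z + b k).
    rewrite mulrCA; congr (_ * _); rewrite mulrDr; congr (_ + _).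
      rewrite /Z -(zmass_lap_pt u (fun=> 1) (k0 k) j0); congr (_ * _).
      by apply: eq_bigr => i _; rewrite mul1r.
    rewrite /sqdist /b mulr_sumr; apply: eq_bigr => a _.
    by rewrite [in RHS]mxE exprMn sqr_sqrtr ?ltW//; congr (_ * _ ^+ 2); rewrite !mxE.
  rewrite mulrAC ler_pdivrMr// ler_pM2l// lerD2l.
  near: k; have /cvgrPdistC_lt/(_ _ ltr01) := cb.
  by apply: filterS => k; rewrite ltr_norml => /andP[_ +]; rewrite ltrBlDl addrC => /ltW.
have cl : k.+1%:R * l k @[k --> \oo] --> - Lz + 2^-1 * q0.
  have -> : (fun k => k.+1%:R * l k) = (fun k => X k + (- Lz + 2^-1 * q k)).
    by apply/funext => k; rewrite /X; ring.
  rewrite -[X in _ --> X]add0r; apply: cvgD; first exact: cX.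
  by apply: cvgD; [exact: cvg_cst|apply: cvgMl_tmp; exact: cq].
have : expR (k.+1%:R * l k) @[k --> \oo] --> expR (- Lz + 2^-1 * q0).
  exact: (cvg_comp _ _ cl (@continuous_expR R _)).
apply: cvg_trans; apply: near_eq_cvg; move: Epos; apply: filterS => k Ek.
by rewrite -/(t k) Ek mulrAC divff ?gt_eqF// mul1r expRM_natl.
Unshelve. all: by end_near. Qed.

Lemma measurable_chart (R : realType) N (j : 'I_N.+1) d (T : measurableType d)
    (u : T -> nat -> R) (a : 'I_N.+1) :
  (forall i, measurable_fun [set: T] (fun t => u t i)) ->
  measurable_fun [set: T] (fun t => chart j (u t) ord0 a).
Proof.
move=> mu; under eq_fun do rewrite mxE.
case: (unlift j a) => [k|]; first exact: mu.
by apply: measurable_funB => //; apply: measurable_sum => k; exact: mu.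
Qed.

Lemma bfun_on_simplex (R : realType) N (j : 'I_N.+1) (G : 'rV[R]_N.+1 -> R) :
  smeas G -> bfun (fun v => (on_simplex G (chart j v))%:E).
Proof.
move=> mG; apply: bfun_EFin => d T u mu; apply: mG => i.
exact: measurable_chart.
Qed.

Lemma bfun_lap_pt (R : realType) N (j : 'I_N.+1) (ts : 'rV[R]_N.+1) (x : R)
    (G : 'rV[R]_N.+1 -> R) :
  smeas G -> bfun (fun v => (on_simplex G (lap_pt j ts x v))%:E).
Proof.
move=> mG; apply: bfun_EFin => d T u mu; apply: mG => i.
apply: (@measurable_chart R N j d T (fun t i => lap_shift j ts i + lap_scale j ts x i * u t i)) => k.
by apply: measurable_funD => //; apply: measurable_funM.
Qed.

(** * The rescaled integrand, its limit and its dominating function *)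

Definition lap_order (R : realType) N (j : 'I_N.+1) (alpha ts : 'rV[R]_N.+1) : R :=
  \sum_(i < N) (if ts ord0 (lift j i) == 0 then alpha ord0 (lift j i) else 2^-1).

Lemma powR_sum (R : realType) (x : R) (I : Type) (r : seq I) (s : I -> R) :
  0 < x -> x `^ (\sum_(i <- r) s i) = \prod_(i <- r) x `^ (s i).
Proof.
move=> x0; elim: r => [|i r IH]; first by rewrite !big_nil powRr0.
rewrite !big_cons powRD ?IH//; by apply/implyP => _; rewrite gt_eqF.
Qed.

(** The Jacobian cancels the face part of n^s and one power of n per vanishing coordinate; the
    remaining n^(alpha_i - 1) is what rescales the weight. *)
Lemma prod_lap_scale (R : realType) N (j : 'I_N.+1) (alpha ts : 'rV[R]_N.+1)
    (x : R) : 0 < x ->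
  x `^ lap_order j alpha ts * \prod_(i < N) lap_scale j ts x i
  = \prod_(i < N | ts ord0 (lift j i) == 0) x `^ (alpha ord0 (lift j i) - 1).
Proof.
move=> x0; rewrite /lap_order powR_sum// -big_split [RHS]big_mkcond /=.
apply: eq_bigr => i _; rewrite /lap_scale valK /lap_exp.
case: ifP => _; rewrite -powRD ?subrr ?powRr0//.
all: by apply/implyP => _; rewrite gt_eqF.
Qed.

(** The indicator of an open cube around ts, written as a product so that its measurability is
    immediate. *)
Definition near_indic (R : realType) K (ts : 'rV[R]_K) (delta : R)
    (t : 'rV[R]_K) : R := \prod_a \1_(`]ts ord0 a - delta, ts ord0 a + delta[%classic) (t ord0 a).

Lemma near_indicT (R : realType) K (ts : 'rV[R]_K) (delta : R) (t : 'rV[R]_K) :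
  (forall i, `|t ord0 i - ts ord0 i| < delta) -> near_indic ts delta t = 1.
Proof.
move=> H; rewrite /near_indic big1// => i _; rewrite indicE mem_set//=.
by rewrite in_itv/= -ltr_distl.
Qed.

Lemma near_indicF (R : realType) K (ts : 'rV[R]_K) (delta : R) (t : 'rV[R]_K) :
  ~ (forall i, `|t ord0 i - ts ord0 i| < delta) ->
  near_indic ts delta t = 0 /\ exists i, delta <= `|t ord0 i - ts ord0 i|.
Proof.
move=> /existsNP[i /negP]; rewrite -leNgt => Hi; split; last by exists i.
rewrite /near_indic (bigD1 i)//= indicE memNset ?mul0r//=.
by rewrite in_itv/= -ltr_distl ltNge Hi.
Qed.

Lemma near_indic01 (R : realType) K (ts : 'rV[R]_K) (delta : R) (t : 'rV[R]_K) :
  0 <= near_indic ts delta t <= 1.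
Proof.
case: (pselect (forall i, `|t ord0 i - ts ord0 i| < delta)) => H.
  by rewrite near_indicT// ler01 lexx.
by have [-> _] := near_indicF H; rewrite lexx ler01.
Qed.

Lemma smeas_near_indic (R : realType) K (ts : 'rV[R]_K) (delta : R) :
  smeas (near_indic ts delta).
Proof.
apply: smeas_fun => d T f mf; apply: measurable_prod => i _.
exact: (measurableT_comp (measurable_indic_itv _) (mf i)).
Qed.

(** The Dirichlet weight with the vanishing coordinates replaced by their rescaled variables, in
    which it has a nondegenerate limit. *)
Definition lap_weight (R : realType) N (j : 'I_N.+1) (alpha ts t : 'rV[R]_N.+1)
    (u : nat -> R) : R :=
  t ord0 j `^ (alpha ord0 j - 1) *
  \prod_(i < N) (if ts ord0 (lift j i) == 0 then u i `^ (alpha ord0 (lift j i) - 1)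
                 else t ord0 (lift j i) `^ (alpha ord0 (lift j i) - 1)).

Lemma dir_weight_lap_pt (R : realType) N (j : 'I_N.+1) (alpha ts : 'rV[R]_N.+1)
    (x : R) (u : nat -> R) : 0 < x ->
  (forall i : 'I_N, ts ord0 (lift j i) == 0 -> 0 <= u i) ->
  (\prod_(i < N | ts ord0 (lift j i) == 0) x `^ (alpha ord0 (lift j i) - 1))
    * dir_weight alpha (lap_pt j ts x u)
  = lap_weight j alpha ts (lap_pt j ts x u) u.
Proof.
move=> x0 u0; rewrite /dir_weight (bigD1_ord j)//= mulrCA; congr (_ * _).
rewrite [X in X * _]big_mkcond -big_split /=; apply: eq_bigr => i _.
case: eqP => [z|_]; last by rewrite mul1r.
rewrite lap_pt_lift z add0r /lap_exp z eqxx -powRM ?(ltW x0)//; last first.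
  by rewrite mulr_ge0 ?powR_ge0// u0// z.
by rewrite powR_inv1 ?(ltW x0)// mulVKf// gt_eqF.
Qed.

(* The factor exp(x^2 / 2) compensates the identity block of core_mx. *)
Definition lap_h (R : realType) N (j : 'I_N.+1) (alpha ts : 'rV[R]_N.+1)
    (lam : 'I_N.+1 -> R) (i : nat) : R -> R :=
  if insub i is Some k then
    if ts ord0 (lift j k) == 0 then
      (fun x => gamma_kernel (alpha ord0 (lift j k)) (lam (lift j k)) x * expR (2^-1 * x ^+ 2))
    else cst 1
  else cst 1.

(** The default [cst 0] is integrable, as [iter_lebesgue_dct] asks at every index. *)
Definition lap_dom (R : realType) N (j : 'I_N.+1) (alpha ts : 'rV[R]_N.+1)
    (c : R) (i : nat) : R -> R :=
  if insub i is Some k then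
    if ts ord0 (lift j k) == 0 then gamma_kernel (alpha ord0 (lift j k)) c
    else (fun x => expR (- (c * x ^+ 2)))
  else cst 0.

Definition base_weight (R : realType) N (j : 'I_N.+1) (alpha ts : 'rV[R]_N.+1) : R :=
  ts ord0 j `^ (alpha ord0 j - 1) *
  \prod_(i < N | ts ord0 (lift j i) != 0) ts ord0 (lift j i) `^ (alpha ord0 (lift j i) - 1).

Definition lap_limit (R : realType) N (j : 'I_N.+1) (alpha ts : 'rV[R]_N.+1)
    (lam : 'I_N.+1 -> R) (A : 'M[R]_N.+1) (u : nat -> R) : R :=
  base_weight j alpha ts *
  (expR (- (2^-1 * qf (core_mx j ts A) (rvec N u))) * \prod_(i < N) lap_h j alpha ts lam i (u i)).

(** The near part of the integral in the rescaled variables, including the normalisation n^s /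
    Emax^n and the Jacobian. *)
Definition lap_integrand (R : realType) N (j : 'I_N.+1) (alpha ts : 'rV[R]_N.+1)
    (E : 'rV[R]_N.+1 -> R) (Emax delta : R) (k : nat) (u : nat -> R) : R :=
  (\prod_(i < N | ts ord0 (lift j i) == 0) k.+1%:R `^ (alpha ord0 (lift j i) - 1))
  / Emax ^+ k.+1
  * on_simplex (fun t => E t ^+ k.+1 * dir_weight alpha t * near_indic ts delta t)
      (lap_pt j ts k.+1%:R u).

Lemma simplex_lap_pt_ge0 (R : realType) N (j : 'I_N.+1) (ts : 'rV[R]_N.+1)
    (x : R) (u : nat -> R) : 0 < x ->
  simplex R N.+1 (lap_pt j ts x u) ->
  forall i : 'I_N, ts ord0 (lift j i) == 0 -> 0 <= u i.
Proof.
move=> x0 [t0 _] i /eqP z; have := t0 (lift j i).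
by rewrite lap_pt_lift z add0r pmulr_rge0// powR_gt0.
Qed.

Lemma lap_integrandE (R : realType) N (j : 'I_N.+1) (alpha ts : 'rV[R]_N.+1)
    (E : 'rV[R]_N.+1 -> R) (Emax delta : R) (k : nat) (u : nat -> R) :
  let t := lap_pt j ts k.+1%:R u in
  simplex R N.+1 t -> (forall i, `|t ord0 i - ts ord0 i| < delta) ->
  lap_integrand j alpha ts E Emax delta k u
  = (E t / Emax) ^+ k.+1 * lap_weight j alpha ts t u.
Proof.
move=> t st nt; rewrite /lap_integrand on_simplexT// near_indicT// mulr1.
rewrite -dir_weight_lap_pt//; last exact: simplex_lap_pt_ge0 st.
by rewrite -/t expr_div_n; ring.
Qed.

Lemma lap_integrand0 (R : realType) N (j : 'I_N.+1) (alpha ts : 'rV[R]_N.+1)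
    (E : 'rV[R]_N.+1 -> R) (Emax delta : R) (k : nat) (u : nat -> R) :
  let t := lap_pt j ts k.+1%:R u in
  ~ (simplex R N.+1 t /\ (forall i, `|t ord0 i - ts ord0 i| < delta)) ->
  lap_integrand j alpha ts E Emax delta k u = 0.
Proof.
move=> t /not_andP[st|nt]; rewrite /lap_integrand; first by rewrite on_simplexF// mulr0.
case: (pselect (simplex R N.+1 t)) => st; last by rewrite on_simplexF// mulr0.
by rewrite on_simplexT//; have [-> _] := near_indicF nt; rewrite !mulr0.
Qed.

Lemma cvg_powR_cst (R : realType) (f : nat -> R) (l a : R) : 0 < l ->
  f k @[k --> \oo] --> l -> f k `^ a @[k --> \oo] --> l `^ a.
Proof.
move=> l0 fl; rewrite [l `^ a]/powR gt_eqF//.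
have : expR (a * ln (f k)) @[k --> \oo] --> expR (a * ln l).
  have h : a * ln (f k) @[k --> \oo] --> a * ln l.
    apply: cvgMl_tmp; exact: (cvg_comp _ _ fl (continuous_ln l0)).
  exact: (cvg_comp _ _ h (@continuous_expR R _)).
apply: cvg_trans; apply: near_eq_cvg.
have /cvgrPdistC_lt/(_ _ l0) := fl; apply: filterS => k.
rewrite ltr_norml => /andP[+ _]; rewrite ltrBrDl subrr => fk.
by rewrite /powR gt_eqF.
Qed.

Lemma cvg_prodr (R : realType) (I : Type) (r : seq I) (f : I -> nat -> R) (l : I -> R) :
  (forall i, f i k @[k --> \oo] --> l i) ->
  \prod_(i <- r) f i k @[k --> \oo] --> \prod_(i <- r) l i.
Proof.
move=> cf; elim: r => [|i r IH].
  by rewrite big_nil; under eq_cvg do rewrite big_nil; exact: cvg_cst.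
by rewrite big_cons; under eq_cvg do rewrite big_cons; apply: cvgM.
Qed.

Lemma cvg_lap_integrand (R : realType) N (j : 'I_N.+1) (alpha ts : 'rV[R]_N.+1)
    (E : 'rV[R]_N.+1 -> R) (Emax : R) (lam : 'I_N.+1 -> R) (A : 'M[R]_N.+1)
    (delta : R) (u : nat -> R) :
  simplex R N.+1 ts -> ts ord0 j != 0 -> peak ts E Emax lam A -> 0 < delta ->
  lap_integrand j alpha ts E Emax delta k u @[k --> \oo] --> lap_limit j alpha ts lam A u.
Proof.
move=> sts j0 pE d0; have [ts0 _] := sts.
have tsp a : ts ord0 a != 0 -> 0 < ts ord0 a by move=> nz; rewrite lt_neqAle eq_sym nz ts0.
(* If u_i < 0 at some vanishing coordinate, the point is off the simplex for every n, and the Gamma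
   kernel makes the limit 0. *)
case: (pselect (forall i : 'I_N, ts ord0 (lift j i) == 0 -> 0 <= u i)) => u0; last first.
  have -> : lap_limit j alpha ts lam A u = 0.
    move/existsNP: u0 => [i /not_implyP[zi /negP]]; rewrite -ltNge => ui.
    rewrite /lap_limit (bigD1 i)//= /lap_h valK zi /gamma_kernel indicE memNset.
      by rewrite !(mul0r, mulr0).
    by rewrite /= in_itv/= andbT leNgt ui.
  have -> : (fun k => lap_integrand j alpha ts E Emax delta k u) = cst 0.
    apply/funext => k; rewrite lap_integrand0// => -[st _]; apply: u0.
    exact: simplex_lap_pt_ge0 st.
  exact: cvg_cst.
pose t k := lap_pt j ts k.+1%:R u.
pose w0 := ts ord0 j `^ (alpha ord0 j - 1) *
  \prod_(i < N) (if ts ord0 (lift j i) == 0 then u i `^ (alpha ord0 (lift j i) - 1)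
                 else ts ord0 (lift j i) `^ (alpha ord0 (lift j i) - 1)).
have cw : lap_weight j alpha ts (t k) u @[k --> \oo] --> w0.
  apply: cvgM; first by apply: cvg_powR_cst; [exact: tsp|exact: cvg_lap_pt].
  apply: (@cvg_prodr R _ _ (fun i k => if ts ord0 (lift j i) == 0
    then u i `^ (alpha ord0 (lift j i) - 1)
    else t k ord0 (lift j i) `^ (alpha ord0 (lift j i) - 1))) => i.
  have [zi|zi] := boolP (ts ord0 (lift j i) == 0); first exact: cvg_cst.
  by apply: cvg_powR_cst; [exact: tsp|exact: cvg_lap_pt].
have cE := cvg_lap_peak sts j0 pE u0.
have -> : lap_limit j alpha ts lam A u
  = expR (- \sum_(i < N | ts ord0 (lift j i) == 0) lam (lift j i) * u i
            + 2^-1 * qf A (face_vec j (face_proj j ts (fun i => u i)))) * w0.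
  rewrite /lap_limit qf_core_mx.
  have -> : face_vec j (face_proj j ts ((rvec N u) ord0)) = face_vec j (face_proj j ts (fun i => u i)).
    by congr face_vec; apply/funext => i; rewrite /face_proj mxE.
  set a := 2^-1 * qf A _.
  pose PA := \prod_(i < N | ts ord0 (lift j i) != 0) ts ord0 (lift j i) `^ (alpha ord0 (lift j i) - 1).
  pose PB := \prod_(i < N | ts ord0 (lift j i) == 0) expR (- (2^-1 * u i ^+ 2)).
  pose Ph := \prod_(i < N) lap_h j alpha ts lam i (u i).
  pose PC := \prod_(i < N | ts ord0 (lift j i) == 0) expR (- (lam (lift j i) * u i)).
  pose PD := \prod_(i < N) (if ts ord0 (lift j i) == 0 then u i `^ (alpha ord0 (lift j i) - 1)
                 else ts ord0 (lift j i) `^ (alpha ord0 (lift j i) - 1)).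
  (* The factor exp(u_i^2 / 2) inside [lap_h] cancels the Gaussian contributed by the identity block
     of [core_mx]. *)
  have key : PA * (PB * Ph) = PC * PD.
    rewrite /PA /PB /PC big_mkcond [X in _ * (X * _)]big_mkcond [X in _ = X * _]big_mkcond.
    rewrite -!big_split /=; apply: eq_bigr => i _; rewrite /lap_h valK.
    case: (boolP (ts ord0 (lift j i) == 0)) => zi /=; last by rewrite mul1r mulr1 mul1r.
    rewrite /gamma_kernel indicE mem_set ?mul1r/=; last by rewrite in_itv/= andbT u0.
    rewrite [expR (- (2^-1 * _))]expRN; set e := expR (2^-1 * _).
    have e0 : e != 0 by rewrite gt_eqF// expR_gt0.
    by field.
  have -> : - (2^-1 * (\sum_(i | ts ord0 (lift j i) == 0) rvec N u ord0 i ^+ 2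
        - qf A (face_vec j (face_proj j ts (fun i => u i)))))
     = a + \sum_(i < N | ts ord0 (lift j i) == 0) - (2^-1 * u i ^+ 2).
    rewrite mulrBr opprB -/a; congr (_ + _).
    by rewrite mulr_sumr -sumrN; apply: eq_bigr => i _; rewrite mxE.
  rewrite -sumrN !expRD !expR_sum -/PB -/PC -/Ph /w0 -/PD /base_weight -/PA.
  transitivity (ts ord0 j `^ (alpha ord0 j - 1) * expR a * (PA * (PB * Ph))); first by ring.
  by rewrite key; ring.
apply: cvg_trans (cvgM cE cw); apply: near_eq_cvg.
near=> k; rewrite lap_integrandE//; near: k; first exact: near_lap_simplex.
exact: near_lap_pt.
Unshelve. all: by end_near. Qed.

(** Bounds the weight at the coordinates positive at ts, as long as these stay above half their
    value there. *)
Definition lap_cst (R : realType) N (j : 'I_N.+1) (alpha ts : 'rV[R]_N.+1) : R :=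
  ((ts ord0 j / 2) `^ (alpha ord0 j - 1) + 1) *
  \prod_(i < N | ts ord0 (lift j i) != 0)
    ((ts ord0 (lift j i) / 2) `^ (alpha ord0 (lift j i) - 1) + 1).

Lemma lap_cst_ge0 (R : realType) N (j : 'I_N.+1) (alpha ts : 'rV[R]_N.+1) :
  0 <= lap_cst j alpha ts.
Proof.
rewrite mulr_ge0 ?addr_ge0 ?powR_ge0//; apply: prodr_ge0 => i _.
by rewrite addr_ge0 ?powR_ge0.
Qed.

Lemma lap_dom_ge0 (R : realType) N (j : 'I_N.+1) (alpha ts : 'rV[R]_N.+1) c i x :
  0 <= lap_dom j alpha ts c i x.
Proof.
rewrite /lap_dom; case: insub => [k|] //; case: ifP => _; last exact: expR_ge0.
exact: gamma_kernel_ge0.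
Qed.

Lemma measurable_lap_dom (R : realType) N (j : 'I_N.+1) (alpha ts : 'rV[R]_N.+1) c i :
  measurable_fun [set: R] (lap_dom j alpha ts c i).
Proof.
rewrite /lap_dom; case: insub => [k|] //.
case: (_ == _); first exact: measurable_gamma_kernel.
apply: measurableT_comp => //; apply: measurableT_comp => //.
by apply: measurable_funM => //; exact: measurable_funX.
Qed.

Lemma integral_lap_dom_lty (R : realType) N (j : 'I_N.+1) (alpha ts : 'rV[R]_N.+1) c i :
  (forall a, 0 < alpha ord0 a) -> 0 < c ->
  (\int[@lebesgue_measure R]_x (lap_dom j alpha ts c i x)%:E < +oo)%E.
Proof.
move=> al0 c0; rewrite /lap_dom; case: insub => [k|]; last by rewrite integral0 ltry.
case: (_ == _); last exact: integral_gauss_lty.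
rewrite integral_gamma_kernel// lte_mul_pinfty ?lee_fin ?powR_ge0//.
exact: gammaE_lty.
Qed.

Lemma lap_integrand_ge0 (R : realType) N (j : 'I_N.+1) (alpha ts : 'rV[R]_N.+1)
    (E : 'rV[R]_N.+1 -> R) (Emax delta : R) (k : nat) (u : nat -> R) :
  0 < Emax -> (forall t, simplex R N.+1 t -> 0 <= E t) ->
  0 <= lap_integrand j alpha ts E Emax delta k u.
Proof.
move=> m0 E0; rewrite mulr_ge0//.
  rewrite divr_ge0 ?exprn_ge0 ?(ltW m0)//; apply: prodr_ge0 => i _; exact: powR_ge0.
case: (pselect (simplex R N.+1 (lap_pt j ts k.+1%:R u))) => st; last by rewrite on_simplexF.
rewrite on_simplexT// !mulr_ge0 ?exprn_ge0 ?E0 ?dir_weight_ge0//.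
by have /andP[] := near_indic01 ts delta (lap_pt j ts k.+1%:R u).
Qed.

(** Rescaling turns n [zmass] into the sum of the u_i and n [facet_sqdist] into that of the u_i^2,
    so the n-th power of the bound on E no longer depends on n. *)
Lemma lap_integrand_le (R : realType) N (j : 'I_N.+1) (alpha ts : 'rV[R]_N.+1)
    (E : 'rV[R]_N.+1 -> R) (Emax c delta : R) (k : nat) (u : nat -> R) :
  simplex R N.+1 ts -> ts ord0 j != 0 -> 0 < Emax ->
  (forall t, simplex R N.+1 t -> 0 <= E t) ->
  (forall a, ts ord0 a != 0 -> delta <= ts ord0 a / 2) ->
  (forall t, simplex R N.+1 t ->
    (forall i, `|t ord0 i - ts ord0 i| < delta) ->
    E t <= Emax * expR (- (c * (zmass ts t + facet_sqdist j ts t)))) ->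
  lap_integrand j alpha ts E Emax delta k u
  <= lap_cst j alpha ts * \prod_(i < N) lap_dom j alpha ts c i (u i).
Proof.
move=> sts j0 m0 E0 dl HE; have [ts0 _] := sts.
pose t := lap_pt j ts k.+1%:R u.
case: (pselect (simplex R N.+1 t /\ (forall i, `|t ord0 i - ts ord0 i| < delta))); last first.
  move=> H; rewrite lap_integrand0// mulr_ge0 ?lap_cst_ge0//.
  by apply: prodr_ge0 => i _; exact: lap_dom_ge0.
move=> [st nt]; rewrite lap_integrandE// -/t.
have x0 : 0 < k.+1%:R :> R by [].
have u0 := simplex_lap_pt_ge0 x0 st.
pose PE := \prod_(i < N) (if ts ord0 (lift j i) == 0 then expR (- (c * u i))
                          else expR (- (c * u i ^+ 2))).
have hE : (E t / Emax) ^+ k.+1 <= PE.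
  have e1 : E t / Emax <= expR (- (c * (zmass ts t + facet_sqdist j ts t))).
    by rewrite ler_pdivrMr// mulrC; exact: HE.
  apply: le_trans (_ : expR (- (c * (zmass ts t + facet_sqdist j ts t))) ^+ k.+1 <= _).
    by rewrite lerXn2r ?nnegrE ?expR_ge0 ?divr_ge0 ?E0 ?(ltW m0).
  rewrite -expRM_natl mulrN mulrCA mulrDr.
  have -> : k.+1%:R * zmass ts t = \sum_(i < N | ts ord0 (lift j i) == 0) 1 * u i.
    rewrite -(zmass_lap_pt u (fun=> 1) x0 j0); congr (_ * _).
    by apply: eq_bigr => i _; rewrite mul1r.
  have -> : k.+1%:R * facet_sqdist j ts t = \sum_(i < N | ts ord0 (lift j i) != 0) u i ^+ 2.
    rewrite /facet_sqdist mulr_sumr; apply: eq_bigr => i zi.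
    rewrite lap_pt_lift addrAC subrr add0r /lap_exp (negbTE zi) exprMn mulrA.
    by rewrite powRN powR12_sqrt ?(ltW x0)// exprVn sqr_sqrtr ?(ltW x0)// divff ?mul1r// gt_eqF.
  rewrite mulrDr opprD expRD !mulr_sumr -!sumrN !expR_sum.
  rewrite [X in X * _]big_mkcond [X in _ * X]big_mkcond -big_split /=.
  rewrite /PE le_eqVlt; apply/orP; left; apply/eqP; apply: eq_bigr => i _.
  by case: (ts ord0 (lift j i) == 0) => /=; rewrite ?mul1r ?mulr1.
have bnd a : ts ord0 a != 0 ->
    t ord0 a `^ (alpha ord0 a - 1) <= (ts ord0 a / 2) `^ (alpha ord0 a - 1) + 1.
  move=> nz; have tsa : 0 < ts ord0 a by rewrite lt_neqAle eq_sym nz ts0.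
  apply: powR_le_max; first by rewrite divr_gt0.
    have := nt a; rewrite ltr_norml => /andP[+ _]; have := dl a nz; lra.
  by have /andP[] := simplex_le1 a st.
have hw : lap_weight j alpha ts t u <= ((ts ord0 j / 2) `^ (alpha ord0 j - 1) + 1) *
    \prod_(i < N) (if ts ord0 (lift j i) == 0 then u i `^ (alpha ord0 (lift j i) - 1)
     else (ts ord0 (lift j i) / 2) `^ (alpha ord0 (lift j i) - 1) + 1).
  apply: ler_pM; [exact: powR_ge0| |exact: bnd|].
    by apply: prodr_ge0 => i _; case: ifP => _; exact: powR_ge0.
  apply: ler_prod => i _; case: ifP => zi; first by rewrite powR_ge0 lexx.
  by rewrite powR_ge0/= bnd// zi.
apply: le_trans (ler_pM _ _ hE hw) _.
- by rewrite exprn_ge0// divr_ge0 ?E0 ?(ltW m0).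
- rewrite mulr_ge0 ?powR_ge0//; apply: prodr_ge0 => i _; case: ifP => _; exact: powR_ge0.
rewrite mulrCA /lap_cst -mulrA ler_wpM2l ?addr_ge0 ?powR_ge0//.
rewrite /PE [X in _ <= X * _]big_mkcond -!big_split /=.
rewrite le_eqVlt; apply/orP; left; apply/eqP; apply: eq_bigr => i _.
rewrite /lap_dom valK; case: (boolP (ts ord0 (lift j i) == 0)) => zi /=; last by rewrite mulrC.
rewrite mul1r /gamma_kernel indicE mem_set/= ?mul1r; first by rewrite mulrC.
by rewrite in_itv/= andbT u0.
Qed.

Lemma smeas_near_peak (R : realType) K (alpha ts : 'rV[R]_K)
    (E : 'rV[R]_K -> R) (delta : R) (k : nat) : smeas E ->
  smeas (fun t => E t ^+ k * dir_weight alpha t * near_indic ts delta t).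
Proof.
move=> mE; apply: smeasM; last exact: smeas_near_indic.
by apply: smeasM; [exact: smeasX|exact: smeas_dir_weight].
Qed.

Definition lap_int (R : realType) N (j : 'I_N.+1) (alpha ts : 'rV[R]_N.+1)
    (lam : 'I_N.+1 -> R) (A : 'M[R]_N.+1) : R :=
  base_weight j alpha ts * ((Num.sqrt (\det (core_mx j ts A)))^-1 *
   \prod_(i < N) (if ts ord0 (lift j i) == 0
                  then lam (lift j i) `^ (- alpha ord0 (lift j i)) * fine (gammaE (alpha ord0 (lift j i)))
                  else Num.sqrt 2 * Num.sqrt pi)).

Lemma lap_h_ge0 (R : realType) N (j : 'I_N.+1) (alpha ts : 'rV[R]_N.+1) lam i x :
  0 <= lap_h j alpha ts lam i x.
Proof.
rewrite /lap_h; case: insub => [k|] //; case: ifP => _ //.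
by rewrite mulr_ge0 ?gamma_kernel_ge0 ?expR_ge0.
Qed.

Lemma measurable_lap_h (R : realType) N (j : 'I_N.+1) (alpha ts : 'rV[R]_N.+1) lam i :
  measurable_fun [set: R] (lap_h j alpha ts lam i).
Proof.
rewrite /lap_h; case: insub => [k|] //.
case: (_ == _) => //; apply: measurable_funM; first exact: measurable_gamma_kernel.
apply: measurableT_comp => //; apply: measurable_funM => //; exact: measurable_funX.
Qed.

Lemma base_weight_ge0 (R : realType) N (j : 'I_N.+1) (alpha ts : 'rV[R]_N.+1) :
  0 <= base_weight j alpha ts.
Proof. by rewrite mulr_ge0 ?powR_ge0//; apply: prodr_ge0 => i _; exact: powR_ge0. Qed.

Lemma fine_gammaE (R : realType) (a : R) : 0 < a -> (fine (gammaE a))%:E = gammaE a.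
Proof.
move=> a0; rewrite fineK// ge0_fin_numE ?gammaE_lty//; exact/ltW/gammaE_gt0.
Qed.

Lemma iter_lap_limit (R : realType) N (j : 'I_N.+1) (alpha ts : 'rV[R]_N.+1)
    (lam : 'I_N.+1 -> R) (A : 'M[R]_N.+1) :
  (forall a, 0 < alpha ord0 a) -> ts ord0 j != 0 -> A^T = A -> tangent_negdef ts A ->
  (forall k, ts ord0 k == 0 -> 0 < lam k) ->
  iter_lebesgue N (fun u => (lap_limit j alpha ts lam A u)%:E) = (lap_int j alpha ts lam A)%:E.
Proof.
move=> al0 j0 sA nA lam0; rewrite /lap_limit.
under eq_iter_lebesgue do rewrite EFinM.
(* False beyond N, in agreement with the default [cst 1] of [lap_h]. *)
pose Z (i : nat) := if insub i is Some k then ts ord0 (lift j (k : 'I_N)) == 0 else false.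
rewrite iter_lebesgueZ ?base_weight_ge0//; last 2 first.
- apply: bfun_EFin => d T u mu; apply: measurable_funM.
    apply: measurableT_comp => //; apply: measurableT_comp => //.
    apply: measurable_funM => //; apply: measurable_qf => i.
    by under eq_fun do rewrite mxE; exact: mu.
  by apply: measurable_prod => i _; exact: (measurableT_comp (measurable_lap_h _ _ _ _ _)).
- move=> v; rewrite lee_fin mulr_ge0 ?expR_ge0//.
  by apply: prodr_ge0 => i _; exact: lap_h_ge0.
rewrite (@iter_lebesgue_gauss _ _ _ Z).
- rewrite /lap_int !EFinM; congr (_ * (_ * _))%E.
  rewrite -prodEFin; apply: eq_bigr => i _.
  rewrite /lap_h valK; case: (boolP (ts ord0 (lift j i) == 0)) => zi.
    rewrite EFinM fine_gammaE// -integral_gamma_kernel ?lam0//.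
    apply: eq_integral => x _; rewrite mulrCA -expRD addNr expR0 mulr1//.
  by under eq_integral do rewrite mulr1; exact: integral_half_gauss.
- exact: core_mx_sym.
- exact: core_mx_posdef.
- by move=> i k; rewrite /Z valK => /eqP; exact: core_mx_zrow.
- by move=> i; rewrite /Z /lap_h; case: insub => [k|] // /negbTE ->.
- by move=> i x; exact: lap_h_ge0.
- by move=> i; exact: measurable_lap_h.
Qed.

(** * The exponentially small far part and the Laplace limit *)

Lemma cvg_powR_geometric (R : realType) (s q : R) : 0 <= q < 1 ->
  (k.+1%:R : R) `^ s * q ^+ k.+1 @[k --> \oo] --> (0 : R).
Proof.
(* Since q may be 0, it is replaced by p = exp(- e) > 0. Half of the decay e absorbs the power of n;
   the other half, z^n, tends to 0. *)
move=> /andP[q0 q1]; pose p := (1 + q) / 2.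
have p0 : 0 < p by rewrite divr_gt0// ltr_wpDr.
have p1 : p < 1 by rewrite /p; lra.
have qp : q <= p by rewrite /p; lra.
pose e := - ln p.
have e0 : 0 < e by rewrite oppr_gt0 ln_lt0// p0.
have pE : p = expR (- e) by rewrite /e opprK lnK.
pose C := ((1 + `|2 * (s / e)|) `^ `|s / e|) `^ e.
pose z := expR (- (e / 2)).
have z0 : 0 < z by exact: expR_gt0.
have z1 : z < 1 by rewrite -[ltRHS]expR0 ltr_expR oppr_lt0 divr_gt0.
have bound k : (k.+1%:R : R) `^ s * q ^+ k.+1 <= C * z ^+ k.+1.
  have x1 : 1 <= k.+1%:R :> R by rewrite ler1n.
  have x0 : 0 <= k.+1%:R :> R by [].
  have h : (k.+1%:R : R) `^ s <= C * expR (e / 2 * k.+1%:R).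
    (* With exponent s / e, raising [powR_le_expR] to the power e turns the rate 1/2 into e/2. *)
    have -> : (k.+1%:R : R) `^ s = (k.+1%:R `^ (s / e)) `^ e.
      by rewrite -powRrM divfK// gt_eqF.
    apply: le_trans (_ : ((1 + `|2 * (s / e)|) `^ `|s / e| * expR (2^-1 * k.+1%:R)) `^ e <= _).
      apply: ge0_ler_powR; rewrite ?nnegrE ?powR_ge0 ?mulr_ge0 ?powR_ge0 ?expR_ge0 ?(ltW e0)//.
      exact: powR_le_expR.
    rewrite powRM ?powR_ge0 ?expR_ge0// -/C ler_wpM2l ?powR_ge0//.
    rewrite [_ `^ e]/powR gt_eqF ?expR_gt0// expRK ler_expR le_eqVlt; apply/orP; left; apply/eqP.
    by rewrite mulrA.
  apply: le_trans (_ : C * expR (e / 2 * k.+1%:R) * p ^+ k.+1 <= _).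
    by apply: ler_pM; rewrite ?powR_ge0 ?exprn_ge0 ?lerXn2r ?nnegrE ?(ltW p0).
  rewrite pE /z -!expRM_natl -mulrA -expRD ler_wpM2l ?powR_ge0// ler_expR.
  by rewrite le_eqVlt; apply/orP; left; apply/eqP; field.
have cz : C * z ^+ k.+1 @[k --> \oo] --> (0 : R).
  rewrite -[X in _ --> X](mulr0 C); apply: cvgMl_tmp.
  have : GRing.exp z @ \oo --> (0 : R) by apply: cvg_expr; rewrite gtr0_norm.
  by rewrite -cvg_shiftS.
apply: (squeeze_cvgr _ (cvg_cst 0) cz).
by apply: nearW => k; rewrite bound mulr_ge0 ?powR_ge0 ?exprn_ge0.
Qed.

Lemma dir_integral_ge0 (R : realType) K (alpha : 'rV[R]_K) (g : 'rV[R]_K -> R) :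
  (forall t, simplex R K t -> 0 <= g t) -> (0 <= dir_integral alpha g)%E.
Proof.
move=> g0; apply: iter_lebesgue_ge0 => v; case: asboolP => // st.
by rewrite lee_fin mulr_ge0 ?g0// dir_weight_ge0.
Qed.

Lemma smeas_cst (R : realType) K (c : R) : @smeas R K (fun=> c).
Proof. by apply: smeas_fun => d T f mf. Qed.

Lemma dir_integral_le (R : realType) N (alpha : 'rV[R]_N.+1)
    (g : 'rV[R]_N.+1 -> R) (M : R) :
  smeas g -> (forall t, simplex R N.+1 t -> 0 <= g t <= M) ->
  (dir_integral alpha g <= M%:E * dir_integral alpha (fun=> 1%R))%E.
Proof.
move=> mg g01.
(* A point of the simplex yields M >= 0; without one both integrals vanish. *)
case: (pselect (exists t, simplex R N.+1 t)) => [[t0 st0]|no]; last first.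
  have E h : dir_integral alpha h = iter_lebesgue N (fun=> 0%E).
    by apply: eq_iter_lebesgue => v; case: asboolP => // st; case: no; eexists; exact: st.
  have e0 : iter_lebesgue N (fun _ : nat -> R => 0%E) = 0%E.
    elim: N {alpha g mg g01 no E} => [|N IH] //.
    by rewrite iter_lebesgueS; under eq_integral do rewrite IH; rewrite integral0.
  by rewrite !E e0 mule0.
have M0 : 0 <= M by have /andP[h1 h2] := g01 _ st0; exact: le_trans h2.
have g0 t : simplex R N.+1 t -> 0 <= g t by move=> /g01/andP[].
rewrite (dir_integralE ord0)// (dir_integralE ord0 alpha (g := fun=> 1))//; last exact: smeas_cst.
have mw := smeasM (@smeas_cst R N.+1 1) (smeas_dir_weight alpha).
have w0 v : 0 <= on_simplex (fun t => 1 * dir_weight alpha t) (chart (@ord0 N) v).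
  by rewrite /on_simplex; case: ifP => // _; rewrite mul1r dir_weight_ge0.
have bw := bfun_on_simplex (@ord0 N) mw.
rewrite -(iter_lebesgueZ N M0 bw) => [|v]; last by rewrite lee_fin.
apply: le_iter_lebesgue.
- by apply: bfun_on_simplex; apply: smeasM => //; exact: smeas_dir_weight.
- move=> d T u mu; apply: emeasurable_funM => //; exact: (bw _ _ _ mu).
- move=> v; rewrite lee_fin /on_simplex; case: asboolP => // st.
  by rewrite mulr_ge0 ?dir_weight_ge0 ?g0.
- move=> v; rewrite -EFinM lee_fin /on_simplex; case: asboolP => [st|_]; last by rewrite mulr0.
  by rewrite mul1r ler_wpM2r ?dir_weight_ge0//; have /andP[] := g01 _ st.
Qed.

(** [near_indic] splits the integral. The near part converges by domination; the far part has
    relative size at most n^s q^n with q < 1. *)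
Theorem laplace_simplex (R : realType) N (j : 'I_N.+1) (alpha ts : 'rV[R]_N.+1)
    (E : 'rV[R]_N.+1 -> R) (Emax : R) (lam : 'I_N.+1 -> R) (A : 'M[R]_N.+1) :
  (forall a, 0 < alpha ord0 a) -> simplex R N.+1 ts -> ts ord0 j != 0 ->
  A^T = A -> tangent_negdef ts A -> (forall k, ts ord0 k == 0 -> 0 < lam k) ->
  peak ts E Emax lam A ->
  (k.+1%:R : R) `^ lap_order j alpha ts / Emax ^+ k.+1
    * fine (dir_integral alpha (fun t => E t ^+ k.+1)) @[k --> \oo]
  --> lap_int j alpha ts lam A.
Proof.
move=> al0 sts j0 sA nA lam0 pE; have [ts0 _] := sts.
have m0 := peak_max pE.
have E0 t : simplex R N.+1 t -> 0 <= E t by move=> /(peak_range pE)/andP[].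
have mE := peak_meas pE.
have [c c0 [d d0 Hd]] := peak_bound sts j0 sA nA lam0 pE.
have tsp a : ts ord0 a != 0 -> 0 < ts ord0 a / 2.
  by move=> nz; rewrite divr_gt0// lt_neqAle eq_sym nz ts0.
have [d2 d20 Hd2] := ex_lower_bound tsp.
(* [d] is the range of the exponential bound; [d2] keeps the positive coordinates of ts above half
   their value. *)
pose delta := Num.min d d2.
have delta0 : 0 < delta by rewrite lt_min d0.
have dom k u : lap_integrand j alpha ts E Emax delta k u
    <= lap_cst j alpha ts * \prod_(i < N) lap_dom j alpha ts c i (u i).
  apply: lap_integrand_le => // [a nz|t st nt].
    by apply: le_trans (Hd2 a nz); rewrite ge_min lexx orbT.
  by apply: Hd => // i; have := nt i; rewrite lt_min => /andP[].
pose F k (u : nat -> R) := (lap_integrand j alpha ts E Emax delta k u)%:E.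
have bF k : bfun (F k).
  move=> dd T u mu; apply/measurable_EFinP; apply: measurable_funM => //.
  by have /measurable_EFinP := @bfun_lap_pt R N j ts k.+1%:R _
    (smeas_near_peak alpha ts delta k.+1 mE) dd T u mu.
have cF : iter_lebesgue N (F k) @[k --> \oo] --> (lap_int j alpha ts lam A)%:E.
  rewrite -iter_lap_limit//.
  apply: (@iter_lebesgue_dct R N F _ (lap_dom j alpha ts c) (lap_cst j alpha ts)) => //.
  - exact: lap_cst_ge0.
  - exact: lap_dom_ge0.
  - exact: measurable_lap_dom.
  - by move=> i; exact: integral_lap_dom_lty.
  - move=> k v; have : 0 <= lap_integrand j alpha ts E Emax delta k v.
      exact: lap_integrand_ge0.
    by rewrite -lee_fin.
  - move=> v; apply: cvg_EFin; first exact: nearW.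
    exact: cvg_lap_integrand.
have [q q01 Hq] := peak_far pE delta0; have /andP[q0 q1] := q01.
pose near k (t : 'rV[R]_N.+1) := E t ^+ k.+1 * dir_weight alpha t * near_indic ts delta t.
(* No Dirichlet weight here, unlike in [near]: [far] is passed to [dir_integral], which supplies
   it. *)
pose far k (t : 'rV[R]_N.+1) := E t ^+ k.+1 * (1 - near_indic ts delta t).
have mfar k : smeas (far k).
  apply: smeasM; first exact: smeasX.
  apply: smeas_fun => dd T f mf; apply: measurable_funB => //.
  apply: measurable_prod => i _; exact: (measurableT_comp (measurable_indic_itv _) (mf i)).
have far01 k t : simplex R N.+1 t -> 0 <= far k t <= (q * Emax) ^+ k.+1.
  move=> st; have qE : 0 <= q * Emax by rewrite mulr_ge0// ltW.
  rewrite /far; case: (pselect (forall i, `|t ord0 i - ts ord0 i| < delta)) => nt.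
    by rewrite near_indicT// subrr mulr0 lexx exprn_ge0.
  have [-> fr] := near_indicF nt; rewrite subr0 mulr1 exprn_ge0 ?E0//=.
  by rewrite lerXn2r ?nnegrE ?E0// Hq.
pose s := lap_order j alpha ts.
pose coef k : R := (k.+1%:R : R) `^ s / Emax ^+ k.+1.
have coef0 k : 0 <= coef k by rewrite divr_ge0 ?powR_ge0 ?exprn_ge0// ltW.
have split k : dir_integral alpha (fun t => E t ^+ k.+1)
   = (iter_lebesgue N (fun v => (on_simplex (near k) (chart j v))%:E)
     + dir_integral alpha (far k))%E.
  rewrite (dir_integralE j)//; last 2 first.
  - exact: smeasX.
  - by move=> t st; rewrite exprn_ge0// E0.
  rewrite (dir_integralE j alpha (mfar k)); last by move=> t /(far01 k)/andP[].
  rewrite -iter_lebesgueD.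
  - apply: eq_iter_lebesgue => v; rewrite -EFinD; congr EFin.
    rewrite /on_simplex; case: ifP => _; last by rewrite addr0.
    by rewrite /near /far; ring.
  - by apply: bfun_on_simplex; exact: smeas_near_peak.
  - by apply: bfun_on_simplex; apply: smeasM => //; exact: smeas_dir_weight.
  - move=> v; rewrite lee_fin /on_simplex; case: asboolP => // st.
    rewrite !mulr_ge0 ?exprn_ge0 ?E0 ?dir_weight_ge0//.
    by have /andP[] := near_indic01 ts delta (chart j v).
  - move=> v; rewrite lee_fin /on_simplex; case: asboolP => // st.
    by rewrite mulr_ge0 ?dir_weight_ge0//; have /andP[] := far01 k _ st.
have nearE k : ((coef k)%:E * iter_lebesgue N (fun v => (on_simplex (near k) (chart j v))%:E)
    = iter_lebesgue N (F k))%E.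
  have x0 : 0 < k.+1%:R :> R by [].
  have g0 t : 0 <= on_simplex (near k) t.
    rewrite /on_simplex; case: asboolP => // st.
    rewrite !mulr_ge0 ?exprn_ge0 ?E0 ?dir_weight_ge0//.
    by have /andP[] := near_indic01 ts delta t.
  have mn : smeas (near k) by exact: smeas_near_peak.
  have r0 i : 0 < lap_scale j ts k.+1%:R i.
    by rewrite /lap_scale; case: insub => [a|] //; rewrite powR_gt0.
  have a0 i : (N <= i)%N -> lap_shift j ts i = 0.
    by move=> ni; rewrite /lap_shift insubF// ltnNge ni.
  have n0 v : (0 <= (on_simplex (near k) (chart j v))%:E)%E by rewrite lee_fin.
  rewrite -(iter_lebesgue_affine r0 a0 (bfun_on_simplex j mn) n0).
  have bl := @bfun_lap_pt R N j ts k.+1%:R _ mn.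
  have cs0 : 0 <= coef k * \prod_(i < N) lap_scale j ts k.+1%:R i.
    by rewrite mulr_ge0//; apply: prodr_ge0 => i _; exact: ltW.
  rewrite muleA -EFinM -(iter_lebesgueZ N cs0 bl); last by move=> v; rewrite lee_fin.
  apply: eq_iter_lebesgue => v; rewrite /F /lap_integrand -EFinM; congr EFin.
  rewrite -prod_lap_scale// /coef -/s; congr (_ * _).
  by rewrite mulrAC.
pose B := dir_integral alpha (fun=> 1%R).
have B0 : (0 <= B)%E by apply: dir_integral_ge0.
have Bfin : B \is a fin_num by rewrite ge0_fin_numE// dirichlet_fin.
have farle k : ((coef k)%:E * dir_integral alpha (far k)
    <= ((k.+1%:R : R) `^ s * q ^+ k.+1 * fine B)%:E)%E.
  have h := dir_integral_le alpha (mfar k) (far01 k).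
  have h' : ((coef k)%:E * dir_integral alpha (far k)
      <= (coef k)%:E * (((q * Emax) ^+ k.+1)%:E * B))%E.
    by apply: lee_wpmul2l; rewrite ?lee_fin.
  apply: le_trans h' _.
  rewrite -/B -(fineK Bfin) -!EFinM lee_fin /coef exprMn.
  rewrite le_eqVlt; apply/orP; left; apply/eqP.
  by field; rewrite expf_neq0// gt_eqF.
have far0 k : (0 <= (coef k)%:E * dir_integral alpha (far k))%E.
  rewrite mule_ge0 ?lee_fin//; apply: dir_integral_ge0 => t /(far01 k)/andP[] //.
have cfar : ((coef k)%:E * dir_integral alpha (far k))%E @[k --> \oo] --> 0%E.
  apply: (@squeeze_cvge _ _ _ _ (cst 0%E) _ (fun k => ((k.+1%:R : R) `^ s * q ^+ k.+1 * fine B)%:E)).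
  - by apply: nearW => k; rewrite far0 farle.
  - exact: cvg_cst.
  - apply: cvg_EFin; first exact: nearW.
    rewrite -[X in _ --> X](mul0r (fine B)); apply: cvgMr_tmp.
    exact: cvg_powR_geometric.
have cT : ((coef k)%:E * dir_integral alpha (fun t => (E t ^+ k.+1)%R))%E @[k --> \oo]
    --> (lap_int j alpha ts lam A)%:E.
  have -> : (fun k => (coef k)%:E * dir_integral alpha (fun t => (E t ^+ k.+1)%R))%E
    = (fun k => iter_lebesgue N (F k) + (coef k)%:E * dir_integral alpha (far k))%E.
    apply/funext => k; rewrite split ge0_muleDr ?nearE//.
      apply: iter_lebesgue_ge0 => v; rewrite lee_fin /on_simplex; case: asboolP => // st.
      rewrite !mulr_ge0 ?exprn_ge0 ?E0 ?dir_weight_ge0//.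
      by have /andP[] := near_indic01 ts delta (chart j v).
    by apply: dir_integral_ge0 => t /(far01 k)/andP[].
  rewrite -[X in _ --> X]adde0; apply: cvgeD => //.
have e k : fine ((coef k)%:E * dir_integral alpha (fun t => (E t ^+ k.+1)%R))
    = coef k * fine (dir_integral alpha (fun t => E t ^+ k.+1)).
  rewrite fineM//.
  rewrite ge0_fin_numE; last by apply: dir_integral_ge0 => t st; rewrite exprn_ge0// E0.
  have mk : smeas (fun t => E t ^+ k.+1) by exact: smeasX.
  have hk t : simplex R N.+1 t -> 0 <= E t ^+ k.+1 <= Emax ^+ k.+1.
    move=> st; have /andP[h1 h2] := peak_range pE st.
    by rewrite exprn_ge0//= lerXn2r ?nnegrE// ltW.
  apply: le_lt_trans (dir_integral_le alpha mk hk) _.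
  by rewrite -/B -(fineK Bfin) -EFinM ltry.
rewrite (_ : (fun k => _)
  = (fun k => fine ((coef k)%:E * dir_integral alpha (fun t => (E t ^+ k.+1)%R)))).
  exact: fine_cvg.
by apply/funext => k; rewrite e.
Qed.

(** * Second-order Taylor expansion *)

Lemma is_derive_line (R : realType) K (f : 'rV[R]_K -> R) (y v : 'rV[R]_K) (s : R) :
  derivable f (y + s *: v) v ->
  is_derive s (1 : R) (fun s => f (y + s *: v)) ('D_v f (y + s *: v)).
Proof.
have E : (fun h : R => h^-1 *: (((fun s => f (y + s *: v)) \o shift s) (h *: (1 : R)) - f (y + s *: v)))
    = (fun h : R => h^-1 *: ((f \o shift (y + s *: v)) (h *: v) - f (y + s *: v))).
  apply/funext => h /=; congr (_ *: (f _ - _)).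
  by rewrite [h *: (1 : R)]mulr1 scalerDl addrCA.
move=> df; apply: DeriveDef; first by rewrite /derivable E.
by rewrite /derive E.
Qed.

(** The absolute values serve increments of either sign and fit the box conditions used along
    coordinate paths. *)
Lemma MVT_abs (R : realType) (g dg : R -> R) (a : R) :
  (forall s, `|s| <= `|a| -> is_derive s (1 : R) g (dg s)) ->
  exists2 s, `|s| <= `|a| & g a - g 0 = dg s * a.
Proof.
move=> H; have [a0|a0] := leP 0 a.
  have inH s : s \in `[0, a]%R -> `|s| <= `|a|.
    by rewrite in_itv/= => /andP[s0 sa]; rewrite !ger0_norm.
  have [||s sa e] := @MVT_segment R g dg 0 a a0.
  - by move=> s s0; apply: H; apply: inH; move: s0; rewrite !in_itv/= => /andP[/ltW-> /ltW->].
  - apply: derivable_within_continuous => s sa; exact: (@ex_derive _ _ _ _ _ _ _ (H s (inH s sa))).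
  - by exists s; [exact: inH|rewrite e subr0].
have inH s : s \in `[a, 0]%R -> `|s| <= `|a|.
  by rewrite in_itv/= => /andP[s0 sa]; rewrite !ler0_norm ?lerN2// ltW.
have [||s sa e] := @MVT_segment R g dg a 0 (ltW a0).
- by move=> s s0; apply: H; apply: inH; move: s0; rewrite !in_itv/= => /andP[/ltW-> /ltW->].
- apply: derivable_within_continuous => s sa; exact: (@ex_derive _ _ _ _ _ _ _ (H s (inH s sa))).
- exists s; first exact: inH.
  by rewrite -opprB e sub0r mulrN opprK.
Qed.

Definition take_row (R : realType) K (m : nat) (d : 'rV[R]_K) : 'rV[R]_K :=
  \row_i (if (i < m)%N then d ord0 i else 0).

(* Move from 0 to d one coordinate at a time. *)
Lemma coordinate_path_bound (R : realType) K (g : 'rV[R]_K -> R)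
    (dg : 'I_K -> 'rV[R]_K -> R) (d : 'rV[R]_K) (C : R) :
  (forall (y : 'rV[R]_K) m s, (forall i, `|(y + s *: delta_mx 0 m) ord0 i| <= `|d ord0 i|) ->
     is_derive s (1 : R) (fun s => g (y + s *: delta_mx 0 m)) (dg m (y + s *: delta_mx 0 m))) ->
  (forall (y : 'rV[R]_K) m, (forall i, `|y ord0 i| <= `|d ord0 i|) -> `|dg m y| <= C) ->
  `|g d - g 0| <= C * \sum_i `|d ord0 i|.
Proof.
move=> Hd HC; pose p m := take_row m d.
have p0 : p 0 = 0 by apply/rowP => i; rewrite !mxE.
have pK : p K = d by apply/rowP => i; rewrite !mxE ltn_ord.
have pS (m : 'I_K) : p m.+1 = p m + d ord0 m *: delta_mx 0 m.
  apply/rowP => i; rewrite !mxE eqxx /= ltnS leq_eqVlt.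
  have [e|ne] := eqVneq i m; first by rewrite e eqxx ltnn/= mulr1 add0r.
  by rewrite (inj_eq val_inj) (negbTE ne) /= mulr0 addr0.
have -> : g d - g 0 = \sum_(m < K) (g (p m.+1) - g (p m)).
  by rewrite -(big_mkord xpredT (fun m => g (p m.+1) - g (p m))) telescope_sumr// p0 pK.
apply: le_trans (ler_norm_sum _ _ _) _; rewrite mulr_sumr; apply: ler_sum => m _.
have box s i : `|s| <= `|d ord0 m| -> `|(p m + s *: delta_mx 0 m) ord0 i| <= `|d ord0 i|.
  move=> sd; rewrite !mxE eqxx /=.
  have [->|ne] := eqVneq i m; first by rewrite ltnn mulr1 add0r.
  by rewrite mulr0 addr0; case: ifP => // _; rewrite normr0.
have [s|s sd e] := @MVT_abs R (fun s => g (p m + s *: delta_mx 0 m))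
    (fun s => dg m (p m + s *: delta_mx 0 m)) (d ord0 m).
  by move=> sd; apply: Hd => i; exact: box.
move: e; rewrite scale0r addr0 -pS => ->; rewrite normrM ler_wpM2r//.
by apply: HC => i; exact: box.
Qed.

Lemma is_derive_quad (R : realType) (a b c s : R) :
  is_derive s (1 : R) (fun s => a + b * s + c * s ^+ 2) (b + 2 * c * s).
Proof.
have H : is_derive s (1 : R) (cst a + b \*: id + c \*: (id ^+ 2))
    (0 + b *: 1 + c *: ((2%:R * s ^+ 1) *: 1)).
  exact: _.
have -> : (fun s => a + b * s + c * s ^+ 2) = cst a + b \*: id + c \*: (id ^+ 2).
  by apply/funext => x; rewrite !fctE.
apply: (is_derive_eq H).
by rewrite add0r /GRing.scale /= !mulr1 mulrCA mulrA expr1.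
Qed.

Lemma cont_row_near (R : realType) K (f : 'rV[R]_K -> R) (x : 'rV[R]_K) :
  {for x, continuous f} -> forall eps, 0 < eps ->
  exists2 delta, 0 < delta & forall y : 'rV[R]_K, (forall i, `|y ord0 i| < delta) ->
    `|f (x + y) - f x| < eps.
Proof.
move=> cf eps e0.
have /nbhs_ballP[delta /= d0 H] : nbhs x (fun z => `|f z - f x| < eps).
  by have /cvgrPdistC_lt := cf; apply.
exists delta => // y yd; apply: H; split => // i j.
by rewrite ord1 /ball /= mxE opprD addNKr normrN.
Qed.

Lemma open_row_near (R : realType) K (N : set 'rV[R]_K) (x : 'rV[R]_K) :
  open N -> N x ->
  exists2 delta, 0 < delta & forall y : 'rV[R]_K, (forall i, `|y ord0 i| < delta) -> N (x + y).
Proof.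
move=> oN Nx; have /nbhs_ballP[delta /= d0 H] : nbhs x N by exact: open_nbhs_nbhs.
exists delta => // y yd; apply: H; split => // i j.
by rewrite ord1 /ball /= mxE opprD addNKr normrN.
Qed.

Lemma ex_common_delta (R : realType) (I : finType) (P : I -> R -> Prop) :
  (forall i a b, P i a -> b <= a -> P i b) ->
  (forall i, exists2 d, 0 < d & P i d) -> exists2 d, 0 < d & forall i, P i d.
Proof.
move=> mono H; have dP i : {d | 0 < d & P i d} by apply/cid2; exact: H.
pose d i := s2val (dP i).
have [m m0 Hm] := @ex_lower_bound R I xpredT d (fun i _ => s2valP (dP i)).
by exists m => // i; apply: mono (s2valP' (dP i)) _; exact: Hm.
Qed.

(** Only partial derivatives are available, hence a path along the axes: on it the partials of f
    minus its linear part are at most eps, by continuity at x. *)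
Lemma first_order (R : realType) K (f : 'rV[R]_K -> R) (x : 'rV[R]_K)
    (N : set 'rV[R]_K) :
  open N -> N x -> (forall y, N y -> forall i, derivable f y (delta_mx 0 i)) ->
  (forall i, {for x, continuous (pderiv f i)}) ->
  forall eps, 0 < eps -> exists2 delta, 0 < delta & forall d : 'rV[R]_K,
    (forall i, `|d ord0 i| < delta) ->
    `|f (x + d) - f x - \sum_i d ord0 i * pderiv f i x| <= eps * \sum_i `|d ord0 i|.
Proof.
move=> oN Nx df cf eps e0.
have [d1 d10 H1] := open_row_near oN Nx.
have [d2 d20 H2] : exists2 d, 0 < d & forall i, forall y : 'rV[R]_K, (forall k, `|y ord0 k| < d) ->
    `|pderiv f i (x + y) - pderiv f i x| < eps.
  apply: ex_common_delta => [i a b Pa ba y yb|i].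
    by apply: Pa => k; exact: lt_le_trans (yb k) ba.
  exact: cont_row_near (cf i) _ e0.
exists (Num.min d1 d2) => [|d dd]; first by rewrite lt_min d10.
have dd1 i : `|d ord0 i| < d1 by have := dd i; rewrite lt_min => /andP[].
have dd2 i : `|d ord0 i| < d2 by have := dd i; rewrite lt_min => /andP[].
pose g (y : 'rV[R]_K) := f (x + y) - \sum_i y ord0 i * pderiv f i x.
have -> : f (x + d) - f x - \sum_i d ord0 i * pderiv f i x = g d - g 0.
  rewrite /g addr0 [X in _ - (_ - X)]big1 ?subr0 => [|i _]; last by rewrite mxE mul0r.
  by rewrite addrAC.
apply: (@coordinate_path_bound R K g (fun m y => pderiv f m (x + y) - pderiv f m x)).
  move=> y m s box; rewrite /g.
  have E s' : f (x + (y + s' *: delta_mx 0 m)) - \sum_i (y + s' *: delta_mx 0 m) ord0 i * pderiv f i x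
     = f (x + y + s' *: delta_mx 0 m) - ((\sum_i y ord0 i * pderiv f i x) + pderiv f m x * s' + 0 * s' ^+ 2).
    rewrite addrA mul0r addr0; congr (_ - _).
    rewrite (bigD1 m)//= [X in _ = X + _](bigD1 m)//= !mxE !eqxx mulr1 mulrDl.
    rewrite [X in _ + X = _](eq_bigr (fun i => y ord0 i * pderiv f i x)); last first.
      by move=> i im; rewrite !mxE eqxx (negbTE im) mulr0 addr0.
    by ring.
  rewrite (_ : (fun s => _) = (fun s => f (x + y + s *: delta_mx 0 m))
     - (fun s => (\sum_i y ord0 i * pderiv f i x) + pderiv f m x * s + 0 * s ^+ 2)); last first.
    by apply/funext => s'; rewrite E.
  have D1 : is_derive s (1 : R) (fun s => f (x + y + s *: delta_mx 0 m))
      (pderiv f m (x + (y + s *: delta_mx 0 m))).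
    rewrite addrA; apply: is_derive_line; rewrite -addrA; apply: df; apply: H1 => i.
    exact: le_lt_trans (box i) (dd1 i).
  have D2 := @is_derive_quad R (\sum_i y ord0 i * pderiv f i x) (pderiv f m x) 0 s.
  apply: (is_derive_eq (is_deriveB D1 D2)).
  by rewrite mulr0 mul0r addr0.
move=> y m box; apply: ltW; apply: H2 => i; exact: le_lt_trans (box i) (dd2 i).
Qed.

Definition C2_near (R : realType) K (f : 'rV[R]_K -> R) (x : 'rV[R]_K) : Prop :=
  exists N : set 'rV[R]_K, open N /\ N x /\
     (forall x, N x -> forall i, derivable f x (delta_mx 0 i)) /\
     (forall x, N x -> forall i j, derivable (pderiv f i) x (delta_mx 0 j)) /\
     (forall x, N x -> forall i, {for x, continuous (pderiv f i)}) /\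
     (forall x, N x -> forall i j, {for x, continuous (pderiv (pderiv f i) j)}).

Lemma sum_delta (R : realType) K (c : 'I_K -> R) (s : R) (m : 'I_K) :
  \sum_i (s *: delta_mx 0 m : 'rV[R]_K) ord0 i * c i = s * c m.
Proof.
rewrite (bigD1 m)//= big1 ?addr0 => [|i im]; rewrite !mxE eqxx ?eqxx ?mulr1//.
by rewrite (negbTE im) mulr0 mul0r.
Qed.

Lemma norm_delta_le (R : realType) K (s : R) (m i : 'I_K) :
  `|(s *: delta_mx 0 m : 'rV[R]_K) ord0 i| <= `|s|.
Proof. by rewrite !mxE eqxx /= normrM; case: (_ == _); rewrite ?normr1 ?mulr1// normr0 mulr0. Qed.

Lemma sum_norm_delta (R : realType) K (s : R) (m : 'I_K) :
  \sum_i `|(s *: delta_mx 0 m : 'rV[R]_K) ord0 i| = `|s|.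
Proof.
rewrite (bigD1 m)//= big1 ?addr0 => [|i im]; rewrite !mxE eqxx ?eqxx ?mulr1//.
by rewrite (negbTE im) mulr0 normr0.
Qed.

(** Mean value theorem in direction i for the increment of f along t e_l, then first-order expansion
    of the i-th partial at the two points. The errors are at most eps (t + |s|) and eps |s| with |s|
    <= t, whence the factor 3. *)
Lemma second_difference (R : realType) K (f : 'rV[R]_K -> R) (x : 'rV[R]_K)
    (i l : 'I_K) : C2_near f x -> forall eps, 0 < eps ->
  exists2 delta, 0 < delta & forall t, 0 < t -> t < delta ->
    `|f (x + t *: delta_mx 0 l + t *: delta_mx 0 i) - f (x + t *: delta_mx 0 i)
      - (f (x + t *: delta_mx 0 l) - f x) - t ^+ 2 * hessian f x i l| <= 3 * eps * t ^+ 2.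
Proof.
move=> [N [oN [Nx [df [d2f [cf c2f]]]]]] eps e0.
have [d1 d10 H1] := open_row_near oN Nx.
have [d2 d20 H2] := first_order oN Nx (fun y Ny => d2f y Ny i) (fun j => c2f x Nx i j) e0.
pose el : 'rV[R]_K := delta_mx 0 l; pose ei : 'rV[R]_K := delta_mx 0 i.
(* Halved because the coordinates of t e_l + s e_i can reach 2 t when i = l. *)
exists (Num.min d1 d2 / 2) => [|t t0 td]; first by rewrite divr_gt0// lt_min d10.
have {}td : 2 * t < Num.min d1 d2 by rewrite mulrC -ltr_pdivlMr.
move: td; rewrite lt_min => /andP[td1 td2].
have nt s : `|s| <= `|t| -> forall k, `|(t *: el + s *: ei) ord0 k| <= 2 * t.
  rewrite (gtr0_norm t0) => st k; rewrite mxE (le_trans (ler_normD _ _))//.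
  have := norm_delta_le t l k; have := norm_delta_le s i k; rewrite (gtr0_norm t0); lra.
have ns s : `|s| <= `|t| -> forall k, `|(s *: ei) ord0 k| <= 2 * t.
  by rewrite (gtr0_norm t0) => st k; have := norm_delta_le s i k; lra.
have D1 s : `|s| <= `|t| -> is_derive s (1 : R) (fun s => f (x + t *: el + s *: ei))
    (pderiv f i (x + t *: el + s *: ei)).
  move=> st; apply: is_derive_line; apply: df; rewrite -addrA; apply: H1 => k.
  exact: le_lt_trans (nt s st k) td1.
have D2 s : `|s| <= `|t| -> is_derive s (1 : R) (fun s => f (x + s *: ei))
    (pderiv f i (x + s *: ei)).
  move=> st; apply: is_derive_line; apply: df; apply: H1 => k.
  exact: le_lt_trans (ns s st k) td1.
have [s st|s st] := @MVT_abs R ((fun s => f (x + t *: el + s *: ei)) - (fun s => f (x + s *: ei)))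
   (fun s => pderiv f i (x + t *: el + s *: ei) - pderiv f i (x + s *: ei)) t.
  exact: is_deriveB (D1 s st) (D2 s st).
rewrite !fctE !scale0r !addr0 => ->.
have := H2 (t *: el + s *: ei) (fun k => le_lt_trans (nt s st k) td2).
have := H2 (s *: ei) (fun k => le_lt_trans (ns s st k) td2).
rewrite sum_delta.
under [X in _ -> `|_ - X| <= _ -> _]eq_bigr do rewrite mxE mulrDl.
rewrite big_split /= !sum_delta addrA sum_norm_delta => h1 h2.
have h3 : \sum_k `|(t *: el + s *: ei) ord0 k| <= `|t| + `|s|.
  rewrite -(sum_norm_delta t l) -(sum_norm_delta s i) -big_split /=.
  by apply: ler_sum => k _; rewrite mxE ler_normD.
have tt : `|t| = t by rewrite gtr0_norm.
rewrite [hessian f x i l]mxE.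
set p1 := pderiv f i _ in h2 *; set p2 := pderiv f i (x + s *: ei) in h1 *.
set p0 := pderiv f i x in h1 h2; set hl := pderiv (pderiv f i) l x in h2 *.
set hi := pderiv (pderiv f i) i x in h1 h2.
have -> : (p1 - p2) * t - t ^+ 2 * hl
   = t * ((p1 - p0 - (t * hl + s * hi)) - (p2 - p0 - s * hi)) by ring.
rewrite normrM tt expr2 mulrA [leRHS]mulrC ler_pM2l//.
apply: le_trans (ler_normB _ _) _.
apply: le_trans (lerD h2 h1) _; rewrite -mulrDr.
apply: le_trans (_ : eps * (`|t| + `|s| + `|s|) <= _).
  by rewrite ler_pM2l// lerD2r.
have -> : 3 * eps * t = eps * (t + t + t) by ring.
by rewrite ler_pM2l// tt !lerD// -tt.
Qed.

(** Schwarz's theorem: the second difference is symmetric in i and l, while t^2 times either mixed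
    derivative approximates it up to o(t^2). *)
Lemma hessian_sym (R : realType) K (f : 'rV[R]_K -> R) (x : 'rV[R]_K) :
  C2_near f x -> (hessian f x)^T = hessian f x.
Proof.
move=> cf; apply/matrixP => i l; rewrite mxE.
apply/eqP; rewrite -subr_eq0 -normr_le0; apply/ler_addgt0Pr => eps e0; rewrite add0r.
(* Two second differences are compared, each with error 3 (eps / 6) t^2. *)
have e6 : 0 < eps / 6 by rewrite divr_gt0.
have [d1 d10 H1] := second_difference i l cf e6.
have [d2 d20 H2] := second_difference l i cf e6.
pose t := Num.min d1 d2 / 2.
have m0 : 0 < Num.min d1 d2 by rewrite lt_min d10.
have t0 : 0 < t by rewrite divr_gt0.
have tm : t < Num.min d1 d2 by rewrite /t; lra.
have [td1 td2] : t < d1 /\ t < d2 by move: tm; rewrite lt_min => /andP[].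
have := H1 t t0 td1; have := H2 t t0 td2.
rewrite [x + t *: delta_mx 0 i + _]addrAC.
set a := f (x + _ + _); set b := f (x + _); set c := f (x + _); set e := f x.
set h1 := hessian f x l i; set h2 := hessian f x i l => k1 k2.
have t2 : 0 < t ^+ 2 by rewrite exprn_gt0.
rewrite -(ler_pM2l t2) -{1}(gtr0_norm t2) -normrM.
have -> : t ^+ 2 * (h1 - h2) = (a - c - (b - e) - t ^+ 2 * h2) - (a - b - (c - e) - t ^+ 2 * h1) by ring.
apply: le_trans (ler_normB _ _) _; apply: le_trans (lerD k2 k1) _.
by rewrite le_eqVlt; apply/orP; left; apply/eqP; field.
Qed.

Lemma qf_shift (R : realType) K (A : 'M[R]_K) (y : 'rV[R]_K) (m : 'I_K) (s : R) :
  A^T = A ->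
  qf A (y + s *: delta_mx 0 m)
  = qf A y + 2 * (\sum_l A m l * y ord0 l) * s + A m m * s ^+ 2.
Proof.
move=> sA; pose e : 'rV[R]_K := delta_mx 0 m.
have ey : (e *m A *m y^T) ord0 ord0 = \sum_l A m l * y ord0 l.
  by rewrite -rowE mxE; apply: eq_bigr => l _; rewrite !mxE.
have ye : (y *m A *m e^T) ord0 ord0 = \sum_l A m l * y ord0 l.
  have h : (e *m A *m y^T)^T = y *m A *m e^T by rewrite !trmx_mul trmxK sA mulmxA.
  by rewrite -ey -h mxE.
have ee : (e *m A *m e^T) ord0 ord0 = A m m.
  by rewrite -rowE trmx_delta -colE !mxE.
rewrite /qf -/e [(y + s *: e)^T]linearD /= [(s *: e)^T]linearZ /= !mulmxDl !mulmxDr.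
rewrite -!scalemxAl -!scalemxAr -?scalemxAl.
move: ey ye ee; move: (y *m A *m y^T) (e *m A *m y^T) (y *m A *m e^T) (e *m A *m e^T).
by move=> X1 X2 X3 X4 h2 h3 h4; rewrite !mxE h2 h3 h4; ring.
Qed.

(** The axis path again, with the quadratic part removed as well: by symmetry of the Hessian, the
    partials of the remainder are the first-order remainders of the partials of f. *)
Lemma second_order (R : realType) K (f : 'rV[R]_K -> R) (x : 'rV[R]_K) :
  C2_near f x -> forall eps, 0 < eps ->
  exists2 delta, 0 < delta & forall d : 'rV[R]_K, (forall i, `|d ord0 i| < delta) ->
    `|f (x + d) - f x - \sum_i d ord0 i * pderiv f i x - 2^-1 * qf (hessian f x) d|
    <= eps * (\sum_i `|d ord0 i|) ^+ 2.
Proof.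
move=> C2 eps e0; have sA := hessian_sym C2; set A := hessian f x in sA *.
have [N [oN [Nx [df [d2f [cf c2f]]]]]] := C2.
have [d1 d10 H1] := open_row_near oN Nx.
have [d2 d20 H2] : exists2 d, 0 < d & forall i, forall y : 'rV[R]_K,
    (forall k, `|y ord0 k| < d) ->
    `|pderiv f i (x + y) - pderiv f i x - \sum_l y ord0 l * pderiv (pderiv f i) l x|
      <= eps * \sum_l `|y ord0 l|.
  apply: ex_common_delta => [i a b Pa ba y yb|i].
    by apply: Pa => k; exact: lt_le_trans (yb k) ba.
  exact: (first_order oN Nx (fun y Ny => d2f y Ny i) (fun j => c2f x Nx i j) e0).
exists (Num.min d1 d2) => [|d dd]; first by rewrite lt_min d10.
have dd1 i : `|d ord0 i| < d1 by have := dd i; rewrite lt_min => /andP[].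
have dd2 i : `|d ord0 i| < d2 by have := dd i; rewrite lt_min => /andP[].
pose g (y : 'rV[R]_K) := f (x + y) - (\sum_i y ord0 i * pderiv f i x + 2^-1 * qf A y).
have -> : f (x + d) - f x - \sum_i d ord0 i * pderiv f i x - 2^-1 * qf A d = g d - g 0.
  rewrite /g addr0 qf0 [X in _ - (_ - (X + _))]big1 => [|i _]; last by rewrite mxE mul0r.
  by rewrite mulr0 addr0 subr0; ring.
rewrite expr2 mulrA.
apply: (@coordinate_path_bound R K g
  (fun m y => pderiv f m (x + y) - pderiv f m x - \sum_l A m l * y ord0 l)).
  move=> y m s box; rewrite /g.
  set a := \sum_i y ord0 i * pderiv f i x; set b := \sum_l A m l * y ord0 l.
  rewrite (_ : (fun s => _) = (fun s => f (x + y + s *: delta_mx 0 m))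
     - (fun s => (a + 2^-1 * qf A y) + (pderiv f m x + b) * s + (2^-1 * A m m) * s ^+ 2)); last first.
    apply/funext => s'; rewrite fctE addrA qf_shift// -/b; congr (_ - _).
    have -> : \sum_i (y + s' *: delta_mx 0 m) ord0 i * pderiv f i x = a + s' * pderiv f m x.
      under eq_bigr do rewrite mxE mulrDl.
      by rewrite big_split /= sum_delta.
    by field.
  have D1 : is_derive s (1 : R) (fun s => f (x + y + s *: delta_mx 0 m))
      (pderiv f m (x + (y + s *: delta_mx 0 m))).
    rewrite addrA; apply: is_derive_line; rewrite -addrA; apply: df; apply: H1 => i.
    exact: le_lt_trans (box i) (dd1 i).
  have D2 := @is_derive_quad R (a + 2^-1 * qf A y) (pderiv f m x + b) (2^-1 * A m m) s.
  apply: (is_derive_eq (is_deriveB D1 D2)).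
  have -> : \sum_l A m l * (y + s *: delta_mx 0 m) ord0 l = b + s * A m m.
    under eq_bigr do rewrite [(y + _) _ _]mxE mulrDr.
    rewrite big_split /= -/b; congr (_ + _); rewrite -(sum_delta (A m) s m).
    by apply: eq_bigr => l _; rewrite mulrC.
  by field.
move=> y m box.
have -> : \sum_l A m l * y ord0 l = \sum_l y ord0 l * pderiv (pderiv f m) l x.
  by apply: eq_bigr => l _; rewrite mulrC mxE.
apply: le_trans (H2 m y _) _; first by move=> k; exact: le_lt_trans (box k) (dd2 k).
by rewrite ler_pM2l//; apply: ler_sum => l _.
Qed.

(** * The peak of exp H *)

Lemma within_row_near (R : realType) K (A : set 'rV[R]_K) (f : 'rV[R]_K -> R)
    (x : 'rV[R]_K) :
  {within A, continuous f} -> A x -> forall eps, 0 < eps ->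
  exists2 delta, 0 < delta & forall y, A y ->
    (forall i, `|y ord0 i - x ord0 i| < delta) -> `|f y - f x| < eps.
Proof.
move=> /subspace_continuousP cf Ax eps e0.
have /cvgrPdistC_lt/(_ _ e0) := cf x Ax.
move=> /nbhs_ballP[delta /= d0 H]; exists delta => // y Ay yd.
by apply: H => //; split => // i j; rewrite ord1 /ball /= distrC.
Qed.

(* The preimage of an open half-line is a countable union of boxes with rational
   centres. *)
Lemma smeas_within_continuous (R : realType) K (f : 'rV[R]_K -> R) :
  {within simplex R K, continuous f} -> smeas f.
Proof.
move=> cf d T u mu.
have main a : measurable [set t | simplex R K (u t) /\ a < f (u t)].
  pose box (p : {ffun 'I_K -> rat} * nat) (y : 'rV[R]_K) :=
    forall i, `|y ord0 i - ratr (p.1 i)| < p.2.+1%:R^-1.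
  pose good p := forall y, simplex R K y -> box p y -> a < f y.
  pose F (n : nat) : set T :=
    if unpickle n is Some p then
      if `[< good p >] then [set t | simplex R K (u t) /\ box p (u t)] else set0
    else set0.
  have -> : [set t | simplex R K (u t) /\ a < f (u t)] = \bigcup_n F n.
    apply/seteqP; split => t /=; last first.
      move=> [n _]; rewrite /F; case: unpickle => [p|] //.
      by case: asboolP => // gp [st bt]; split => //; exact: gp.
    move=> [st ft]; have e0 : 0 < f (u t) - a by rewrite subr_gt0.
    have [dl dl0 H] := within_row_near cf st e0.
    have [k kd] : exists k : nat, k.+1%:R^-1 < dl / 2 :> R.
      have d2 : 0 < dl / 2 by rewrite divr_gt0.
      have [k _ Hk] := near_infty_natSinv_lt (PosNum d2).
      by exists k; apply: (Hk k) => /=.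
    have hq i : exists q : rat, `|u t ord0 i - ratr q| < k.+1%:R^-1 :> R.
      have [|q] := @rat_in_itvoo R (u t ord0 i) (u t ord0 i + k.+1%:R^-1).
        by rewrite ltrDl invr_gt0.
      rewrite in_itv/= => /andP[q1 q2]; exists q.
      by rewrite distrC ger0_norm ?subr_ge0 ?(ltW q1)// ltrBlDl.
    pose q : {ffun 'I_K -> rat} := [ffun i => projT1 (cid (hq i))].
    have qP i : `|u t ord0 i - ratr (q i)| < k.+1%:R^-1 :> R.
      by rewrite ffunE; exact: (projT2 (cid (hq i))).
    exists (pickle (q, k)) => //; rewrite /F pickleK.
    case: asboolP => [_|bad]; first by split.
    exfalso; apply: bad => y sy yb.
    suff : `|f y - f (u t)| < f (u t) - a.
      by rewrite ltr_norml => /andP[+ _]; rewrite opprB ltrBrDl addrC subrK.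
    apply: H => // i; have := yb i; have := qP i; rewrite /= => h1 h2.
    have -> : y ord0 i - u t ord0 i = (y ord0 i - ratr (q i)) - (u t ord0 i - ratr (q i)) by ring.
    apply: le_lt_trans (ler_normB _ _) _; apply: lt_trans (ltrD h2 h1) _.
    by have := ltrD kd kd; rewrite -splitr.
  apply: bigcupT_measurable => n; rewrite /F.
  case: unpickle => [p|]; last exact: measurable0.
  case: asboolP => _; last exact: measurable0.
  rewrite (_ : [set t | _] = [set t | simplex R K (u t)] `&`
     \bigcap_(i in [set: 'I_K]) [set t | `|u t ord0 i - ratr (p.1 i)| < p.2.+1%:R^-1]); last first.
    apply/seteqP; split => t /= [h1 h2]; split => // i; first by move=> _; exact: h2.
    exact: (h2 i I).
  apply: measurableI; first exact: measurable_simplex_preimage.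
  apply: fin_bigcap_measurable => // i _.
  rewrite (_ : [set _ | _] = (fun t => u t ord0 i) @^-1`
     `]ratr (p.1 i) - p.2.+1%:R^-1, ratr (p.1 i) + p.2.+1%:R^-1[%classic).
    by rewrite -[X in measurable X]setTI; exact: mu.
  by apply/seteqP; split => t /=; rewrite in_itv/= -ltr_distl.
move=> mT; apply: (measurability _ (RGenOInfty.measurableE R)) => //.
move=> /= _ [_ [a ->] <-]; apply: measurableI => //.
rewrite (_ : _ @^-1` _ = [set t | simplex R K (u t) /\ a < f (u t)] `|`
   (if a < 0 then ~` [set t | simplex R K (u t)] else set0)); last first.
  apply/seteqP; split => t /=; rewrite in_itv/= andbT /on_simplex; case: asboolP => st.
  - by move=> h; left.
  - by move=> ->; right.
  - by case=> [[]//|]; case: ifP.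
  - by case=> [[]//|]; case: ifP.
apply: measurableU; first exact: main.
case: ifP => _; last exact: measurable0.
by apply: measurableC; exact: measurable_simplex_preimage.
Qed.

Lemma closed_preimage_row (R : realType) K (f : 'rV[R]_K -> R) (D : set R) :
  continuous f -> closed D -> closed (f @^-1` D).
Proof. by move=> cf cD; apply: preimage_closed => // x _; exact: cf. Qed.

Lemma closed_simplex (R : realType) (K : nat) : closed (simplex R K).
Proof.
have -> : simplex R K = \bigcap_(i in [set: 'I_K]) [set t | 0 <= t ord0 i]
    `&` [set t | \sum_i t ord0 i = 1].
  by apply/seteqP; split=> t /= [H1 H2]; split => // i; [move=> _; exact: H1|exact: (H1 i I)].
have cc i : continuous (fun t : 'rV[R]_K => t ord0 i) by exact: coord_continuous.
have cs : continuous (fun t : 'rV[R]_K => \sum_i t ord0 i).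
  elim: (index_enum _) => [|i r IH] t.
    by under eq_fun do rewrite big_nil; exact: cst_continuous.
  under eq_fun do rewrite big_cons.
  by apply: continuousD; [exact: cc|exact: IH].
apply: closedI; last exact: (closed_preimage_row cs (@closed_eq R 1)).
by apply: closed_bigI => i _; exact: (closed_preimage_row (cc i) (@closed_ge R 0)).
Qed.

Lemma simplex_far_compact (R : realType) K (ts : 'rV[R]_K) (delta : R) (i : 'I_K) :
  compact (simplex R K `&` [set t | delta <= `|t ord0 i - ts ord0 i|]).
Proof.
apply: (@subclosed_compact _ _ [set v : 'rV[R]_K | forall a, `[0, 1]%classic (v ord0 a)]).
- apply: closedI; first exact: closed_simplex.
  have cd : continuous (fun t : 'rV[R]_K => `|t ord0 i - ts ord0 i|).
    move=> t; apply: (@continuous_comp _ _ _ (fun t : 'rV[R]_K => t ord0 i - ts ord0 i)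
      (fun x : R => `|x|)).
      by apply: continuousB; [exact: coord_continuous|exact: cst_continuous].
    exact: norm_continuous.
  exact: (closed_preimage_row cd (@closed_ge R delta)).
- exact: (@rV_compact R K (fun=> `[(0 : R), 1]%classic) (fun=> @segment_compact R 0 1)).
- by move=> t [st _] a; rewrite /= in_itv/=; exact: simplex_le1.
Qed.

(** Away from ts, compactness bounds H strictly below its maximum. Near ts, the KKT conditions turn
    the Taylor expansion into the required one: mu multiplies the sum of the coordinates of t - ts,
    which is 0. *)
Lemma peak_exp (R : realType) K (ts : 'rV[R]_K) (H : 'rV[R]_K -> R)
    (lam : 'I_K -> R) (mu : R) :
  simplex R K ts ->
  (forall t, simplex R K t -> t != ts -> H t < H ts) ->
  {within simplex R K, continuous H} -> C2_near H ts ->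
  (forall i, pderiv H i ts = (if ts ord0 i == 0 then - lam i else 0) + mu) ->
  peak ts (fun t => expR (H t)) (expR (H ts)) lam (hessian H ts).
Proof.
move=> sts Hmax cH C2 kkt; split.
- exact: expR_gt0.
- move=> t st; rewrite expR_ge0/= ler_expR.
  by have [->//|tt] := eqVneq t ts; apply/ltW/Hmax.
- apply: smeas_within_continuous.
  apply: (@within_continuous_comp _ _ _ _ H expR) => //.
  by move=> x _; exact: continuous_expR.
- move=> delta d0.
  have Hi i : exists2 q : R, 0 <= q < 1 & forall t, simplex R K t ->
      delta <= `|t ord0 i - ts ord0 i| -> expR (H t) <= q * expR (H ts).
    pose B := simplex R K `&` [set t | delta <= `|t ord0 i - ts ord0 i|].
    case: (pselect (B !=set0)) => [B0|noB]; last first.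
      exists 0; first by rewrite lexx ltr01.
      by move=> t st td; exfalso; apply: noB; exists t.
    have cB : {within B, continuous H} by apply: continuous_subspaceW cH => t [].
    have [c] := EVT_max_rV B0 (@simplex_far_compact R K ts delta i) cB.
    rewrite inE => -[sc dc] cmax; exists (expR (H c - H ts)).
      rewrite expR_ge0/= -[ltRHS]expR0 ltr_expR subr_lt0; apply: Hmax => //.
      by apply/eqP => e; move: dc; rewrite /= e subrr normr0 leNgt d0.
    move=> t st td; rewrite -expRD subrK ler_expR; apply: cmax.
    by rewrite inE; split.
  pose qf i := s2val (cid2 (Hi i)).
  have [m m0 Hm] := @ex_lower_bound R _ xpredT (fun i => 1 - qf i)
    (fun i _ => ltac:(rewrite subr_gt0; by have /andP[] := s2valP (cid2 (Hi i)))).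
  (* The ratios of all coordinates are at most 1 - m; the maximum with 0 ensures q >= 0. *)
  pose q := Num.max 0 (1 - m).
  exists q; first by rewrite le_max lexx/= gt_max ltr01/= ltrBlDr ltrDl.
  move=> t st [i ti]; apply: le_trans (s2valP' (cid2 (Hi i)) t st ti) _.
  rewrite ler_pM2r ?expR_gt0// le_max; apply/orP; right.
  by have := Hm i isT; rewrite -/(qf i); lra.
(* Cauchy-Schwarz, from the squared sum to [sqdist], costs a factor K. *)
- move=> eps e0; pose eps' := eps / K.+1%:R.
  have e'0 : 0 < eps' by rewrite divr_gt0.
  have [delta d0 Hd] := second_order C2 e'0.
  exists delta => // t st near; exists (H t - H ts); first by rewrite -expRD addrC subrK.
  have := Hd (t - ts) (fun i => ltac:(by rewrite !mxE; exact: near)).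
  rewrite [ts + _]addrC subrK.
  have -> : \sum_i (t - ts) ord0 i * pderiv H i ts
      = - \sum_(k < K | ts ord0 k == 0) lam k * t ord0 k.
    under eq_bigr do rewrite kkt mulrDr.
    rewrite big_split /= -mulr_suml.
    have -> : \sum_i (t - ts) ord0 i = 0.
      by under eq_bigr do rewrite !mxE; rewrite sumrB;
       case: st => _ ->; case: sts => _ ->; rewrite subrr.
    rewrite mul0r addr0 -sumrN [RHS]big_mkcond; apply: eq_bigr => i _.
    by rewrite !mxE; case: eqP => [->|_]; rewrite ?mulr0// subr0 mulrN mulrC.
  rewrite opprK => h; apply: le_trans h _.
  apply: le_trans (_ : eps' * (K%:R * sqdist ts t) <= _).
    rewrite ler_pM2l//; apply: le_trans (sqr_sum_le _) _.
    rewrite ler_wpM2l// /sqdist; apply: ler_sum => i _.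
    by rewrite real_normK ?num_real// !mxE.
  rewrite mulrA; apply: ler_pM.
  - by rewrite mulr_ge0// ltW.
  - exact: sqdist_ge0.
  - by rewrite /eps' mulrAC ler_pdivrMr// ler_pM2l// ler_nat.
  - by rewrite lerDr zmass_ge0.
Qed.

(** * The peak of exp (- KL) *)

Lemma is_derive_translate (R : realType) (f : R -> R) (a s l : R) :
  is_derive (a + s) (1 : R) f l -> is_derive s (1 : R) (fun s => f (a + s)) l.
Proof.
have E : (fun h : R => h^-1 *: (((fun s => f (a + s)) \o shift s) (h *: (1 : R)) - f (a + s)))
    = (fun h : R => h^-1 *: ((f \o shift (a + s)) (h *: (1 : R)) - f (a + s))).
  by apply/funext => h /=; rewrite addrCA.
move=> [df dfE]; apply: DeriveDef; first by rewrite /derivable E.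
by rewrite /derive E.
Qed.

(** The remainder has derivative s^2 / (1 + s), at most 2 s^2 as 1 + s >= 1/2, so the mean value
    theorem suffices. *)
Lemma ln_taylor2 (R : realType) (x : R) : `|x| <= 2^-1 ->
  `|ln (1 + x) - x + 2^-1 * x ^+ 2| <= 2 * `|x| ^+ 3.
Proof.
move=> x2.
have pos s : `|s| <= `|x| -> 2^-1 <= 1 + s.
  by move=> sx; have := le_trans sx x2; rewrite ler_norml => /andP[+ _]; lra.
have D s : `|s| <= `|x| -> is_derive s (1 : R)
   ((fun s => ln (1 + s)) - (fun s => 0 + 1 * s + (- 2^-1) * s ^+ 2))
   ((1 + s)^-1 - (1 + 2 * (- 2^-1) * s)).
  move=> sx; apply: is_deriveB; last exact: is_derive_quad.
  apply: is_derive_translate; apply: is_derive1_ln.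
  by apply: lt_le_trans (pos s sx); rewrite invr_gt0.
have [s sx] := MVT_abs D.
rewrite !fctE expr0n/= !(addr0, mulr0, ln1, subr0) => e.
have -> : ln (1 + x) - x + 2^-1 * x ^+ 2 = ln (1 + x) - (0 + 1 * x + - 2^-1 * x ^+ 2) by ring.
have s1 : 0 < 1 + s by apply: lt_le_trans (pos s sx); rewrite invr_gt0.
rewrite e; have -> : (1 + s)^-1 - (1 + 2 * - 2^-1 * s) = s ^+ 2 / (1 + s).
  by field; rewrite gt_eqF.
rewrite normrM [`|x| ^+ 3]exprSr [leRHS]mulrA ler_wpM2r// normrM normfV (gtr0_norm s1) normrX.
rewrite ler_pdivrMr//; apply: le_trans (_ : `|x| ^+ 2 <= _).
  by rewrite lerXn2r ?nnegrE.
have := pos s sx; have : 0 <= `|x| ^+ 2 by exact: exprn_ge0.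
by move=> h1 h2; have := ler_wpM2l h1 h2; lra.
Qed.

(* exp(- KL(ts | t)), as a product of powers *)
Definition kl_prod (R : realType) K (ts t : 'rV[R]_K) : R :=
  \prod_(k < K | 0 < ts ord0 k) (t ord0 k / ts ord0 k) `^ (ts ord0 k).

Lemma expE_Hhat (R : realType) K (H : 'rV[R]_K -> R) (ts t : 'rV[R]_K) (n : nat) :
  simplex R K t ->
  expE (n.+1%:R%:E * Hhat H ts t)%E = (expR (H ts) * kl_prod ts t) ^+ n.+1.
Proof.
move=> [t0 _]; rewrite /Hhat.
have n0 : 0 < n.+1%:R :> R by [].
(* If t vanishes at some k in the support, KL is +oo; both sides are then 0, the product having a
   zero factor. *)
case: (pselect (exists k, 0 < ts ord0 k /\ t ord0 k = 0)) => [[k [tsk tk]]|H0].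
  have -> : KL ts t = +oo%E.
    rewrite /KL; apply/esum_eqyP => [i _|]; first by case: ifP.
    by exists k; split=> //; rewrite ?mem_index_enum// tk ltxx.
  rewrite addeNy gt0_muleNy ?lte_fin//= /kl_prod (bigD1 k)//= tk mul0r powR0 ?gt_eqF//.
  by rewrite mul0r mulr0 expr0n.
have tp k : 0 < ts ord0 k -> 0 < t ord0 k.
  move=> tsk; rewrite lt_neqAle t0 andbT; apply/negP => /eqP e; apply: H0.
  by exists k.
have -> : KL ts t = (\sum_(k < K | 0 < ts ord0 k) ts ord0 k * ln (ts ord0 k / t ord0 k))%:E.
  by rewrite /KL -sumEFin; apply: eq_bigr => k tsk; rewrite tp.
rewrite -EFinB -EFinM /= expRM_natl; congr (_ ^+ _).
rewrite expRD -sumrN expR_sum; congr (_ * _); apply: eq_bigr => k tsk.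
rewrite /powR mulf_eq0 invr_eq0 !gt_eqF ?tp//= ; congr expR.
by rewrite -mulrN -lnV ?posrE ?divr_gt0 ?tp// invf_div.
Qed.

Lemma kl_prod_ge0 (R : realType) K (ts t : 'rV[R]_K) : 0 <= kl_prod ts t.
Proof. by apply: prodr_ge0 => k _; exact: powR_ge0. Qed.

Lemma kl_prodE (R : realType) K (ts t : 'rV[R]_K) :
  (forall k, 0 < ts ord0 k -> 0 < t ord0 k) ->
  kl_prod ts t = expR (\sum_(k < K | 0 < ts ord0 k) ts ord0 k * ln (t ord0 k / ts ord0 k)).
Proof.
move=> tp; rewrite expR_sum; apply: eq_bigr => k tsk.
by rewrite /powR mulf_eq0 invr_eq0 !gt_eqF ?tp.
Qed.

Lemma sum_supp_sub (R : realType) K (ts t : 'rV[R]_K) :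
  simplex R K ts -> simplex R K t ->
  \sum_(k < K | 0 < ts ord0 k) (t ord0 k - ts ord0 k) = - zmass ts t.
Proof.
move=> [s0 s1] [t0 t1]; rewrite /zmass sumrB.
have e (v : 'rV[R]_K) : \sum_i v ord0 i = \sum_(k < K | 0 < ts ord0 k) v ord0 k
    + \sum_(k < K | ts ord0 k == 0) v ord0 k :> R.
  rewrite (bigID (fun k => 0 < ts ord0 k)) /=; congr (_ + _); apply: eq_bigl => k.
  by rewrite -leNgt eq_le s0 andbT.
have := e t; have := e ts; rewrite t1 s1 [X in _ = _ + X -> _]big1; last by move=> k /eqP.
by rewrite addr0 => <- ->; ring.
Qed.

(* ln x = 2 ln (sqrt x) <= 2 (sqrt x - 1) = (x - 1) - (sqrt x - 1)^2 *)
Lemma kl_term_le (R : realType) (a b : R) : 0 < a <= 1 -> 0 < b <= 1 ->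
  a * ln (b / a) <= (b - a) - 4^-1 * (b - a) ^+ 2.
Proof.
move=> /andP[a0 a1] /andP[b0 b1].
pose x := Num.sqrt a; pose y := Num.sqrt b.
have x0 : 0 < x by rewrite sqrtr_gt0.
have y0 : 0 < y by rewrite sqrtr_gt0.
have ax : a = x ^+ 2 by rewrite sqr_sqrtr// ltW.
have by_ : b = y ^+ 2 by rewrite sqr_sqrtr// ltW.
have x1 : x <= 1 by rewrite -(@sqrtr1 R) ler_sqrt.
have y1 : y <= 1 by rewrite -(@sqrtr1 R) ler_sqrt.
have yx : 0 < y / x by rewrite divr_gt0.
have l1 : ln (b / a) <= 2 * (y / x - 1).
  rewrite ax by_ -expr_div_n lnXn// -[leLHS]mulr_natl ler_pM2l//.
  have := @le_ln1Dx R (y / x - 1); rewrite [1 + _]addrC subrK; apply.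
  by rewrite ltrBrDl subrr.
apply: le_trans (_ : a * (2 * (y / x - 1)) <= _); first by rewrite ler_pM2l.
have -> : a * (2 * (y / x - 1)) = (b - a) - (y - x) ^+ 2.
  by rewrite ax by_; field; rewrite gt_eqF.
rewrite lerD2l lerN2.
(* The constant 1/4 comes from x + y <= 2. *)
have -> : 4^-1 * (b - a) ^+ 2 = (y - x) ^+ 2 * (((y + x) / 2) ^+ 2) by rewrite ax by_; field.
rewrite ler_piMr ?sqr_ge0// expr_le1//; last by rewrite divr_ge0// addr_ge0// ltW.
by rewrite ler_pdivrMr//; lra.
Qed.

(** Summing [kl_term_le], the linear terms add up to minus [zmass]: mass gained off the support is
    lost on it. The bound holds on the whole simplex and gives both the range and the far decay of
    the peak. *)
Lemma kl_prod_le (R : realType) K (ts t : 'rV[R]_K) :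
  simplex R K ts -> simplex R K t ->
  kl_prod ts t <= expR (- (zmass ts t
     + 4^-1 * \sum_(k < K | 0 < ts ord0 k) (t ord0 k - ts ord0 k) ^+ 2)).
Proof.
move=> sts st; have [t0 _] := st.
case: (pselect (exists k, 0 < ts ord0 k /\ t ord0 k = 0)) => [[k [tsk tk]]|H0].
  by rewrite /kl_prod (bigD1 k)//= tk mul0r powR0 ?gt_eqF// mul0r expR_ge0.
have tp k : 0 < ts ord0 k -> 0 < t ord0 k.
  move=> tsk; rewrite lt_neqAle t0 andbT; apply/negP => /eqP e; apply: H0.
  by exists k.
rewrite kl_prodE// ler_expR opprD -(sum_supp_sub sts st) mulr_sumr -sumrB.
apply: ler_sum => k tsk; apply: kl_term_le.
  by rewrite tsk/=; have /andP[] := simplex_le1 k sts.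
by rewrite tp//=; have /andP[] := simplex_le1 k st.
Qed.

Lemma qf_Dmat (R : realType) K (ts x : 'rV[R]_K) :
  qf (- Dmat ts) x = - \sum_(k < K | 0 < ts ord0 k) x ord0 k ^+ 2 / ts ord0 k.
Proof.
rewrite qfE -sumrN [RHS]big_mkcond; apply: eq_bigr => i _.
rewrite (bigD1 i)//= big1 ?addr0 => [|j ji]; rewrite !mxE; last first.
  by rewrite eq_sym (negbTE ji) oppr0 mulr0 mul0r.
by rewrite eqxx; case: ifP => _; [ring|rewrite oppr0 mulr0 mul0r].
Qed.

(** KL itself does not involve the vanishing coordinates; their rate 1 comes from the mass that they
    take away from the support. *)
Lemma peak_kl (R : realType) K (ts : 'rV[R]_K) (c : R) :
  simplex R K ts -> 0 < c ->
  peak ts (fun t => c * kl_prod ts t) c (fun=> 1) (- Dmat ts).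
Proof.
move=> sts c0; have [ts0 _] := sts; split => //.
- move=> t st; rewrite mulr_ge0 ?kl_prod_ge0 ?(ltW c0)//= ler_piMr ?(ltW c0)//.
  apply: le_trans (kl_prod_le sts st) _; rewrite -[leRHS]expR0 ler_expR oppr_le0.
  rewrite addr_ge0 ?zmass_ge0// mulr_ge0// sumr_ge0// => k _; exact: sqr_ge0.
- apply: smeas_fun => d T f mf; apply: measurable_funM => //.
  rewrite /kl_prod; under eq_fun do rewrite big_mkcond.
  apply: measurable_prod => i _; case: (0 < ts ord0 i) => //.
  apply: (measurableT_comp (measurable_powR _)); exact: measurable_funM.
- move=> delta d0.
  have q1 : expR (- delta) < 1 by rewrite -[ltRHS]expR0 ltr_expR oppr_lt0.
  have q2 : expR (- (4^-1 * delta ^+ 2)) < 1.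
    by rewrite -[ltRHS]expR0 ltr_expR oppr_lt0 mulr_gt0// exprn_gt0.
  exists (Num.max (expR (- delta)) (expR (- (4^-1 * delta ^+ 2)))).
    by rewrite le_max expR_ge0/= gt_max q1 q2.
  move=> t st [i ti]; rewrite [leRHS]mulrC ler_pM2l//.
  apply: le_trans (kl_prod_le sts st) _; have [t0 _] := st.
  have S0 : 0 <= \sum_(k < K | 0 < ts ord0 k) (t ord0 k - ts ord0 k) ^+ 2.
    by apply: sumr_ge0 => k _; exact: sqr_ge0.
  have [z|nz] := eqVneq (ts ord0 i) 0.
    rewrite le_max; apply/orP; left; rewrite ler_expR lerN2.
    apply: le_trans (_ : zmass ts t <= _); last by rewrite lerDl mulr_ge0.
    move: ti; rewrite z subr0 ger0_norm// => /le_trans; apply.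
    by rewrite /zmass (bigD1 i) ?z//= lerDl sumr_ge0.
  rewrite le_max; apply/orP; right; rewrite ler_expR lerN2.
  rewrite ler_wpDl ?zmass_ge0// ler_pM2l//.
  have tsi : 0 < ts ord0 i by rewrite lt_neqAle eq_sym nz ts0.
  rewrite (bigD1 i)//= ler_wpDr//.
    by apply: sumr_ge0 => k _; exact: sqr_ge0.
  by rewrite -[leRHS]real_normK ?num_real// lerXn2r ?nnegrE// ltW.
- move=> eps e0.
  have [m m0 Hm] := @ex_lower_bound R _ (fun k => 0 < ts ord0 k) (fun k => ts ord0 k) (fun k h => h).
  (* With |x_k| <= e1, the bound 1/2 admits [ln_taylor2], and the other one makes the cubic
     remainder 2 ts_k |x_k|^3 at most eps (ts_k x_k)^2. *)
  pose e1 := Num.min 2^-1 (eps * m / 2).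
  have e10 : 0 < e1 by rewrite lt_min invr_gt0 ltr0n/= divr_gt0// mulr_gt0.
  have e12 : e1 <= 2^-1 by rewrite ge_min lexx.
  have e1e : e1 <= eps * m / 2 by rewrite ge_min lexx orbT.
  exists (m * e1) => [|t st near]; first exact: mulr_gt0.
  pose x k := (t ord0 k - ts ord0 k) / ts ord0 k.
  have xe k : 0 < ts ord0 k -> `|x k| <= e1.
    move=> tsk; rewrite /x normrM normfV (gtr0_norm tsk) ler_pdivrMr//.
    by apply: le_trans (ltW (near k)) _; rewrite mulrC ler_pM2l// Hm.
  have xt k : 0 < ts ord0 k -> 1 + x k = t ord0 k / ts ord0 k.
    by move=> tsk; rewrite /x; field; rewrite gt_eqF.
  have tp k : 0 < ts ord0 k -> 0 < t ord0 k.
    move=> tsk; have -> : t ord0 k = ts ord0 k * (1 + x k).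
      by rewrite xt// mulrCA divff ?mulr1// gt_eqF.
    rewrite mulr_gt0//; have := le_trans (xe k tsk) e12.
    by rewrite ler_norml => /andP[+ _]; lra.
  exists (\sum_(k < K | 0 < ts ord0 k) ts ord0 k * ln (t ord0 k / ts ord0 k)).
    by rewrite kl_prodE.
  have -> : \sum_(k < K | ts ord0 k == 0) 1 * t ord0 k
      = - \sum_(k < K | 0 < ts ord0 k) ts ord0 k * x k.
    rewrite [X in - X](eq_bigr (fun k => t ord0 k - ts ord0 k)).
      rewrite (sum_supp_sub sts st) opprK; by apply: eq_bigr => k _; rewrite mul1r.
    by move=> k tsk; rewrite /x mulrCA divff ?mulr1// gt_eqF.
  have -> : 2^-1 * qf (- Dmat ts) (t - ts)
      = - \sum_(k < K | 0 < ts ord0 k) ts ord0 k * (2^-1 * x k ^+ 2).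
    rewrite qf_Dmat mulrN mulr_sumr; congr (- _); apply: eq_bigr => k tsk.
    by rewrite !mxE /x; field; rewrite gt_eqF.
  rewrite opprK -sumrB -big_split /=; apply: le_trans (ler_norm_sum _ _ _) _.
  apply: le_trans (_ : \sum_(k < K | 0 < ts ord0 k) eps * (t ord0 k - ts ord0 k) ^+ 2 <= _).
    apply: ler_sum => k tsk; rewrite -xt// -mulrBr -mulrDr normrM (gtr0_norm tsk).
    apply: le_trans (_ : ts ord0 k * (2 * `|x k| ^+ 3) <= _).
      by rewrite ler_pM2l// ln_taylor2// (le_trans (xe k tsk)).
    have tx : t ord0 k - ts ord0 k = ts ord0 k * x k.
      by rewrite /x mulrCA divff ?mulr1// gt_eqF.
    have h1 : `|x k| <= eps * ts ord0 k / 2.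
      apply: le_trans (xe k tsk) (le_trans e1e _).
      by rewrite ler_wpM2r// ler_pM2l// Hm.
    rewrite tx exprMn exprSr real_normK ?num_real//.
    have h2 := ler_wpM2l (mulr_ge0 (ltW tsk) (sqr_ge0 (x k))) h1.
    have -> : ts ord0 k * (2 * (x k ^+ 2 * `|x k|)) = 2 * (ts ord0 k * x k ^+ 2 * `|x k|) by ring.
    apply: le_trans (ler_wpM2l _ h2) _ => //.
    by rewrite le_eqVlt; apply/orP; left; apply/eqP; field.
  rewrite -mulr_sumr ler_pM2l//; apply: le_trans (_ : sqdist ts t <= _); last first.
    by rewrite lerDr zmass_ge0.
  rewrite /sqdist [leRHS](bigID (fun k => 0 < ts ord0 k)) /= lerDl sumr_ge0// => k _.
  exact: sqr_ge0.
Qed.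

(** * The limit of the correlation *)

(** Both sides are the determinant of the block matrix [B], factored in two ways. This brings the
    determinant of [core_mx] down to the size of U^T A U. *)
Lemma det_sylvester (R : realType) (n d : nat) (X : 'M[R]_(n, d)) (Y : 'M[R]_(d, n)) :
  \det (1%:M + X *m Y) = \det (1%:M + Y *m X).
Proof.
pose B : 'M[R]_(n + d) := block_mx 1%:M (- X) Y 1%:M.
have e1 : B = block_mx (1%:M + X *m Y) (- X) 0 1%:M *m block_mx 1%:M 0 Y 1%:M.
  by rewrite mulmx_block !(mulmx1, mulmx0, mul1mx, mul0mx, add0r, addr0) mulNmx addrK.
have e2 : B = block_mx 1%:M 0 Y 1%:M *m block_mx 1%:M (- X) 0 (1%:M + Y *m X).
  rewrite mulmx_block !(mulmx1, mulmx0, mul1mx, mul0mx, add0r, addr0) mulmxN.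
  by rewrite addrC addrK.
have := congr1 determinant e1; rewrite e2 !det_mulmx det_ublock det_lblock det_ublock !det1.
by rewrite !mulr1 !mul1r => ->.
Qed.

(** The coordinate subtracted in every column of [Umat]. The chart omits it, so that [face_mx] and
    [Umat] are built from the same differences. *)
Definition supp_last (R : realType) N (ts : 'rV[R]_N.+1) : 'I_N.+1 :=
  nth ord0 (supp_seq ts) (size (supp_seq ts)).-1.

Lemma uniq_supp_seq (R : realType) K (ts : 'rV[R]_K) : uniq (supp_seq ts).
Proof. by rewrite filter_uniq// enum_uniq. Qed.

Lemma mem_supp_seq (R : realType) K (ts : 'rV[R]_K) (i : 'I_K) :
  (i \in supp_seq ts) = (0 < ts ord0 i).
Proof. by rewrite mem_filter mem_enum andbT. Qed.

Lemma size_supp_seq (R : realType) K (ts : 'rV[R]_K) :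
  simplex R K ts -> size (supp_seq ts) = (K - #|zset ts|)%N.
Proof.
move=> [ts0 _]; rewrite -(card_uniqP (uniq_supp_seq ts)).
have -> : #|supp_seq ts| = #|~: zset ts|.
  apply: eq_card => i; rewrite mem_supp_seq !inE.
  by rewrite lt_neqAle ts0 andbT eq_sym.
by rewrite cardsCs finset.setCK card_ord.
Qed.

Lemma supp_last_gt0 (R : realType) N (ts : 'rV[R]_N.+1) :
  (0 < size (supp_seq ts))%N -> 0 < ts ord0 (supp_last ts).
Proof. by move=> s0; rewrite -mem_supp_seq mem_nth// prednK. Qed.

Definition face_sel (R : realType) N (ts : 'rV[R]_N.+1)
    : 'M[R]_(N, N.+1.-1 - #|zset ts|) :=
  \matrix_(i, r) (lift (supp_last ts) i == nth ord0 (supp_seq ts) r)%:R.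

(** For B = - U^T A U, [Sel] selects the face coordinates, so Sel^T Sel = 1 and [core_mx] is 1 + Sel
    (B - 1) Sel^T; Sylvester's identity then gives det B. *)
Lemma det_core_mx (R : realType) N (ts : 'rV[R]_N.+1) (A : 'M[R]_N.+1) :
  simplex R N.+1 ts -> (0 < size (supp_seq ts))%N ->
  \det (core_mx (supp_last ts) ts A) = \det (- ((Umat ts)^T *m A *m Umat ts)).
Proof.
move=> sts s0; have [ts0 _] := sts.
set j := supp_last ts; set Sel := face_sel ts; set P := face_mx j ts.
have tsj : 0 < ts ord0 j by exact: supp_last_gt0.
pose s := supp_seq ts.
have sz : (N.+1.-1 - #|zset ts|)%N = (size s).-1
    by rewrite size_supp_seq// -subnS subSS.
have us : uniq s := uniq_supp_seq ts.
have rlt (r : 'I_(N.+1.-1 - #|zset ts|)) : (r < (size s).-1)%N by rewrite -sz ltn_ord.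
have rlt' (r : 'I_(N.+1.-1 - #|zset ts|)) : (r < size s)%N by apply: leq_trans (rlt r) (leq_pred _).
have snj (r : 'I_(N.+1.-1 - #|zset ts|)) : nth ord0 s r != j.
  rewrite /j /supp_last -/s nth_uniq//; last by rewrite prednK.
  by rewrite neq_ltn rlt.
have tsr (r : 'I_(N.+1.-1 - #|zset ts|)) : 0 < ts ord0 (nth ord0 s r).
  by rewrite -mem_supp_seq mem_nth.
have inj_lift i k : (lift j i == lift j k) = (i == k) by rewrite (inj_eq (@lift_inj _ _)).
have SelE i r : Sel i r = (lift j i == nth ord0 s r)%:R by rewrite mxE.
have SelTE i r : Sel^T r i = (lift j i == nth ord0 s r)%:R by rewrite mxE SelE.
have exlift (r : 'I_(N.+1.-1 - #|zset ts|)) : {i | nth ord0 s r = lift j i}.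
  by case: (unliftP j (nth ord0 s r)) (snj r) => [i e _|->]; [exists i|rewrite eqxx].
have StS : Sel^T *m Sel = 1%:M.
  apply/matrixP => r r'; rewrite mxE; have [i ei] := exlift r.
  rewrite (bigD1 i)//= big1 ?addr0 => [|k ki]; rewrite SelTE SelE ei.
    by rewrite eqxx mul1r -ei nth_uniq// mxE.
  by rewrite inj_lift (negbTE ki) mul0r.
have SSt : Sel *m Sel^T = 1%:M - diag_mx (\row_i (ts ord0 (lift j i) == 0)%:R).
  apply/matrixP => i k; rewrite mxE [RHS]mxE [X in _ = _ + X]mxE [X in _ = _ - X]mxE.
  rewrite [X in _ = X - _]mxE mxE.
  have [z|nz] := eqVneq (ts ord0 (lift j i)) 0.
    rewrite big1 => [|r _]; first by case: (i == k); rewrite ?mulr1n ?mulr0n ?subrr ?subr0.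
    rewrite SelE; case: eqP => [e|_]; last by rewrite mul0r.
    by have := tsr r; rewrite -e z ltxx.
  have im : lift j i \in s by rewrite mem_supp_seq lt_neqAle eq_sym nz ts0.
  (* [j] is the last entry of the support, so any other entry has a strictly smaller index. *)
  have il : (index (lift j i) s < N.+1.-1 - #|zset ts|)%N.
    rewrite sz ltn_neqAle -ltnS prednK ?index_mem// im andbT.
    apply/negP => /eqP e; have /eqP := neq_lift j i; apply.
    by rewrite -[RHS](nth_index ord0 im) e.
  rewrite (bigD1 (Ordinal il))//= big1 ?addr0 => [|r ri]; rewrite SelTE SelE.
    rewrite /= nth_index// eqxx mul1r [in LHS]eq_sym inj_lift mul0rn subr0.
    by rewrite eq_sym; case: (_ == _).
  case: eqP => [e|_]; last by rewrite mul0r.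
  case/eqP: ri; apply/val_inj => /=; rewrite e index_uniq//.
have UP : (Umat ts)^T = Sel^T *m P.
  apply/matrixP => r a; rewrite !mxE; have [i ei] := exlift r.
  rewrite (bigD1 i)//= big1 ?addr0 => [|k ki]; rewrite mxE SelE ei.
    rewrite eqxx mul1r mxE.
    have -> : (ts ord0 (lift j i) == 0) = false by rewrite -ei gt_eqF.
    (* [Umat] takes the row index as default of [nth] and [face_sel] takes [ord0]; they agree, all
       indices being in range. *)
    by rewrite (set_nth_default ord0 a (rlt' r)) (set_nth_default ord0 a) ?prednK// ei.
  by rewrite inj_lift (negbTE ki) mul0r.
have DP : diag_mx (\row_i (ts ord0 (lift j i) == 0)%:R) *m P = 0.
  apply/matrixP => i a; rewrite mul_diag_mx !mxE.
  by case: eqP => _; rewrite ?mulr0 ?mul0r.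
have SUP : Sel *m (Umat ts)^T = P.
  by rewrite UP mulmxA SSt mulmxBl mul1mx DP subr0.
pose B := - ((Umat ts)^T *m A *m Umat ts).
have -> : core_mx j ts A = 1%:M + Sel *m ((B - 1%:M) *m Sel^T).
  rewrite mulmxBl mulmxBr mul1mx SSt opprB addrCA [1%:M + _]addrC subrK addrC /core_mx.
  congr (_ + _); rewrite /B mulNmx mulmxN; congr (- _).
  rewrite -/P -{1}SUP !mulmxA -[RHS]mulmxA; congr (_ *m _).
  by rewrite -SUP trmx_mul trmxK.
by rewrite det_sylvester -[X in 1%:M + X]mulmxA StS mulmx1 addrC subrK.
Qed.

(** * Covariances and the squared correlation *)

Lemma eq_dir_integral (R : realType) K (alpha : 'rV[R]_K) (f g : 'rV[R]_K -> R) :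
  (forall t, simplex R K t -> f t = g t) -> dir_integral alpha f = dir_integral alpha g.
Proof.
move=> fg; rewrite /dir_integral; congr (iter_lebesgue _ _); apply/funext => v.
by case: asboolP => // s; rewrite fg.
Qed.

Lemma eq_dir_corr (R : realType) K (alpha : 'rV[R]_K) (f f' g g' : 'rV[R]_K -> R) :
  (forall t, simplex R K t -> f t = f' t) -> (forall t, simplex R K t -> g t = g' t) ->
  dir_corr alpha f g = dir_corr alpha f' g'.
Proof.
move=> ff gg; have E h h' : (forall t, simplex R K t -> h t = h' t) ->
    dir_expect alpha h = dir_expect alpha h'.
  by move=> hh; rewrite /dir_expect (eq_dir_integral alpha hh).
have C h h' k k' : (forall t, simplex R K t -> h t = h' t) ->
    (forall t, simplex R K t -> k t = k' t) -> dir_cov alpha h k = dir_cov alpha h' k'.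
  move=> hh kk; rewrite /dir_cov (E h h')// (E k k')//; congr (_ - _).
  by apply: E => t st; rewrite hh ?kk.
by rewrite /dir_corr (C f f' g g')// (C f f' f f')// (C g g' g g').
Qed.

(** K >= 2 enters here: there is at least one chart coordinate, so the extra factor n^-s in the
    product of expectations tends to 0. *)
Lemma lap_order_gt0 (R : realType) N (j : 'I_N.+2) (alpha ts : 'rV[R]_N.+2) :
  (forall a, 0 < alpha ord0 a) -> 0 < lap_order j alpha ts.
Proof.
move=> al0; rewrite /lap_order big_ord_recl ltr_wpDr//.
  by apply: sumr_ge0 => i _; case: ifP => _; rewrite ?ltW ?invr_gt0.
by case: ifP => _; rewrite ?invr_gt0.
Qed.

Lemma lap_prod_gt0 (R : realType) N (j : 'I_N.+1) (alpha ts : 'rV[R]_N.+1)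
    (lam : 'I_N.+1 -> R) :
  (forall a, 0 < alpha ord0 a) -> (forall k, ts ord0 k == 0 -> 0 < lam k) ->
  0 < \prod_(i < N) (if ts ord0 (lift j i) == 0
    then lam (lift j i) `^ (- alpha ord0 (lift j i)) * fine (gammaE (alpha ord0 (lift j i)))
    else Num.sqrt 2 * Num.sqrt pi).
Proof.
move=> al0 lam0; apply: prodr_gt0 => i _; case: ifP => i0.
  by rewrite mulr_gt0 ?powR_gt0 ?lam0// fine_gt0// gammaE_gt0 gammaE_lty.
by rewrite mulr_gt0 ?sqrtr_gt0 ?pi_gt0.
Qed.

Lemma lap_int_gt0 (R : realType) N (j : 'I_N.+1) (alpha ts : 'rV[R]_N.+1)
    (lam : 'I_N.+1 -> R) (A : 'M[R]_N.+1) :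
  simplex R N.+1 ts -> ts ord0 j != 0 -> A^T = A -> tangent_negdef ts A ->
  (forall a, 0 < alpha ord0 a) -> (forall k, ts ord0 k == 0 -> 0 < lam k) ->
  0 < lap_int j alpha ts lam A.
Proof.
move=> [ts0 _] j0 sA nA al0 lam0; have tp i : ts ord0 i != 0 -> 0 < ts ord0 i.
  by move=> i0; rewrite lt_neqAle eq_sym i0 ts0.
rewrite mulr_gt0//; first rewrite mulr_gt0 ?powR_gt0 ?tp//.
  by apply: prodr_gt0 => i i0; rewrite powR_gt0 ?tp.
rewrite mulr_gt0//.
  rewrite invr_gt0 sqrtr_gt0; apply: posdef_det_gt0; first exact: core_mx_sym.
  exact: core_mx_posdef.
exact: lap_prod_gt0.
Qed.

(** With zero total mass every bounded function would integrate to 0, contradicting the positive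
    limit given by [laplace_simplex]. *)
Lemma dir_mass_neq0 (R : realType) N (j : 'I_N.+1) (alpha ts : 'rV[R]_N.+1)
    (E : 'rV[R]_N.+1 -> R) (M : R) (lam : 'I_N.+1 -> R) (A : 'M[R]_N.+1) :
  (forall a, 0 < alpha ord0 a) -> simplex R N.+1 ts -> ts ord0 j != 0 -> A^T = A ->
  tangent_negdef ts A -> (forall k, ts ord0 k == 0 -> 0 < lam k) -> peak ts E M lam A ->
  fine (dir_integral alpha (fun=> 1%R)) != 0.
Proof.
move=> al0 sts j0 sA nA lam0 pE; apply/eqP => B0.
have := laplace_simplex al0 sts j0 sA nA lam0 pE.
have b0 : (0 <= dir_integral alpha (fun=> 1%R))%E by apply: dir_integral_ge0.
have be : dir_integral alpha (fun=> 1%R) = 0%E.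
  by rewrite -[LHS]fineK ?B0// ge0_fin_numE//; exact: dirichlet_fin.
have z k : fine (dir_integral alpha (fun t => E t ^+ k.+1)) = 0.
  have r t : simplex R N.+1 t -> 0 <= E t ^+ k.+1 <= M ^+ k.+1.
    move=> st; have /andP[E0 EM] := peak_range pE st.
    by rewrite exprn_ge0//= lerXn2r// nnegrE (le_trans E0).
  suff -> : dir_integral alpha (fun t => (E t ^+ k.+1)%R) = 0%E by [].
  apply/eqP; rewrite eq_le; apply/andP; split; last first.
    by apply: dir_integral_ge0 => t st; have /andP[] := r t st.
  have mE : smeas (fun t => E t ^+ k.+1) by apply: smeasX; exact: peak_meas pE.
  by have := dir_integral_le alpha mE r; rewrite be mule0.
under eq_cvg do rewrite z mulr0; move=> h.
have := lap_int_gt0 sts j0 sA nA al0 lam0.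
suff -> : lap_int j alpha ts lam A = 0 by rewrite ltxx.
by rewrite -(cvg_lim (@Rhausdorff R) h) lim_cst.
Qed.

Lemma cvg_dir_cov (R : realType) N (j : 'I_N.+2) (alpha ts : 'rV[R]_N.+2)
    (X Y : 'rV[R]_N.+2 -> R) (M : R) (l1 l2 : 'I_N.+2 -> R) (A1 A2 : 'M[R]_N.+2) :
  (forall a, 0 < alpha ord0 a) -> simplex R N.+2 ts -> ts ord0 j != 0 ->
  A1^T = A1 -> A2^T = A2 -> tangent_negdef ts A1 -> tangent_negdef ts A2 ->
  (forall k, ts ord0 k == 0 -> 0 < l1 k) -> (forall k, ts ord0 k == 0 -> 0 < l2 k) ->
  peak ts X M l1 A1 -> peak ts Y M l2 A2 ->
  (k.+1%:R `^ lap_order j alpha ts / (M * M) ^+ k.+1 *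
     dir_cov alpha (fun t => X t ^+ k.+1) (fun t => Y t ^+ k.+1)) @[k --> \oo] -->
  lap_int j alpha ts (fun k => l1 k + l2 k) (A1 + A2) / fine (dir_integral alpha (fun=> 1%R)).
Proof.
move=> al0 sts j0 s1 s2 n1 n2 l10 l20 pX pY.
have sX := laplace_simplex al0 sts j0 s1 n1 l10 pX.
have sY := laplace_simplex al0 sts j0 s2 n2 l20 pY.
have s12 : (A1 + A2)^T = A1 + A2 by rewrite linearD /= s1 s2.
have n12 : tangent_negdef ts (A1 + A2).
  move=> d d0 ds dz; rewrite qfD; have := ltrD (n1 d d0 ds dz) (n2 d d0 ds dz).
  by rewrite addr0.
have l12 k : ts ord0 k == 0 -> 0 < l1 k + l2 k by move=> k0; rewrite addr_gt0 ?l10 ?l20.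
have sXY := laplace_simplex al0 sts j0 s12 n12 l12 (peakM pX pY).
have B0 := dir_mass_neq0 al0 sts j0 s1 n1 l10 pX.
set B := fine _; set s := lap_order j alpha ts.
have M0 : 0 < M by exact: peak_max pX.
have -> : lap_int j alpha ts (fun k => l1 k + l2 k) (A1 + A2) / B
  = lap_int j alpha ts (fun k => l1 k + l2 k) (A1 + A2) / B
    - lap_int j alpha ts l1 A1 / B * (lap_int j alpha ts l2 A2 / B) * 0.
  by rewrite mulr0 subr0.
have e k : k.+1%:R `^ s / (M * M) ^+ k.+1 *
      dir_cov alpha (fun t => X t ^+ k.+1) (fun t => Y t ^+ k.+1)
    = k.+1%:R `^ s / (M * M) ^+ k.+1 * fine (dir_integral alpha (fun t => (X t * Y t) ^+ k.+1)) / B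
      - (k.+1%:R `^ s / M ^+ k.+1 * fine (dir_integral alpha (fun t => X t ^+ k.+1)) / B
        * (k.+1%:R `^ s / M ^+ k.+1 * fine (dir_integral alpha (fun t => Y t ^+ k.+1)) / B))
        * k.+1%:R `^ (- s).
    rewrite /dir_cov /dir_expect -/B powRN exprMn.
    under [in RHS]eq_fun do rewrite exprMn.
    by field; rewrite B0 !expf_neq0 ?gt_eqF ?powR_gt0.
under eq_cvg do rewrite e.
apply: cvgB; first by apply: cvgMl.
apply: cvgM; last by apply: cvg_powRN; exact: lap_order_gt0.
by apply: cvgM; apply: cvgMl.
Qed.

Lemma cvg_dir_corr2 (R : realType) N (j : 'I_N.+2) (alpha ts : 'rV[R]_N.+2)
    (X Y : 'rV[R]_N.+2 -> R) (M : R) (l1 l2 : 'I_N.+2 -> R) (A1 A2 : 'M[R]_N.+2) :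
  (forall a, 0 < alpha ord0 a) -> simplex R N.+2 ts -> ts ord0 j != 0 ->
  A1^T = A1 -> A2^T = A2 -> tangent_negdef ts A1 -> tangent_negdef ts A2 ->
  (forall k, ts ord0 k == 0 -> 0 < l1 k) -> (forall k, ts ord0 k == 0 -> 0 < l2 k) ->
  peak ts X M l1 A1 -> peak ts Y M l2 A2 ->
  (dir_corr alpha (fun t => X t ^+ k.+1) (fun t => Y t ^+ k.+1)) ^+ 2 @[k --> \oo] -->
  lap_int j alpha ts (fun k => l1 k + l2 k) (A1 + A2) ^+ 2 /
   (lap_int j alpha ts (fun k => l1 k + l1 k) (A1 + A1) *
    lap_int j alpha ts (fun k => l2 k + l2 k) (A2 + A2)).
Proof.
move=> al0 sts j0 s1 s2 n1 n2 l10 l20 pX pY.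
have cXY := cvg_dir_cov al0 sts j0 s1 s2 n1 n2 l10 l20 pX pY.
have cXX := cvg_dir_cov al0 sts j0 s1 s1 n1 n1 l10 l10 pX pX.
have cYY := cvg_dir_cov al0 sts j0 s2 s2 n2 n2 l20 l20 pY pY.
have B0 := dir_mass_neq0 al0 sts j0 s1 n1 l10 pX.
have Bp : 0 < fine (dir_integral alpha (fun=> 1%R)).
  by rewrite lt_neqAle eq_sym B0 fine_ge0// dir_integral_ge0.
have M0 : 0 < M by exact: peak_max pX.
have dbl A l : A^T = A -> tangent_negdef ts A -> (forall k, ts ord0 k == 0 -> 0 < l k) ->
    0 < lap_int j alpha ts (fun k => l k + l k) (A + A).
  move=> sA nA l0; apply: lap_int_gt0 => //.
  - by rewrite linearD /= sA.
  - by move=> d d0 ds dz; have h := nA d d0 ds dz; rewrite qfD -[ltRHS]addr0 ltrD.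
  - by move=> k k0; rewrite addr_gt0 ?l0.
have LX := dbl _ _ s1 n1 l10; have LY := dbl _ _ s2 n2 l20.
set B := fine _ in Bp B0 cXY cXX cYY.
pose w (k : nat) : R := k.+1%:R `^ lap_order j alpha ts / (M * M) ^+ k.+1.
pose C (U V : 'rV[R]_N.+2 -> R) (k : nat) :=
  dir_cov alpha (fun t => U t ^+ k.+1) (fun t => V t ^+ k.+1).
have wp k : 0 < w k by rewrite divr_gt0 ?powR_gt0// exprn_gt0// mulr_gt0.
move: cXY cXX cYY LX LY; set LXY := lap_int _ _ _ _ (A1 + A2).
set LXX := lap_int _ _ _ _ (A1 + A1); set LYY := lap_int _ _ _ _ (A2 + A2).
move=> cXY cXX cYY LX LY.
have -> : LXY ^+ 2 / (LXX * LYY) = (LXY / B) ^+ 2 / (LXX / B * (LYY / B)).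
  by field; rewrite ?gt_eqF.
(* The variances are eventually positive, so that squaring undoes [Num.sqrt], which is 0 on negative
   numbers. *)
have pXX := cvgr_gt _ cXX _ (divr_gt0 LX Bp).
have pYY := cvgr_gt _ cYY _ (divr_gt0 LY Bp).
have c2 : (w k * C X Y k) ^+ 2 / ((w k * C X X k) * (w k * C Y Y k)) @[k --> \oo] -->
    (LXY / B) ^+ 2 / (LXX / B * (LYY / B)).
  apply: cvgM; first by rewrite expr2; under eq_cvg do rewrite expr2; exact: cvgM.
  apply: cvgV; last exact: cvgM.
  by rewrite gt_eqF// mulr_gt0 ?divr_gt0.
apply: cvg_trans c2; apply: near_eq_cvg; near=> k.
have w0 := wp k.
have xx : 0 < C X X k by rewrite -(pmulr_rgt0 _ w0); near: k; exact: pXX.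
have yy : 0 < C Y Y k by rewrite -(pmulr_rgt0 _ w0); near: k; exact: pYY.
rewrite /dir_corr expr_div_n [(Num.sqrt _ * _) ^+ 2]exprMn !sqr_sqrtr ?(ltW xx) ?(ltW yy)//.
rewrite -[dir_cov _ _ _ in RHS]/(C X Y k) -/(C X X k) -/(C Y Y k).
by field; rewrite !gt_eqF.
Unshelve. all: by end_near.
Qed.

(** The contribution of one vanishing coordinate: its rates in the three products are l + 1, 2 l and
    2, and its Gamma value g cancels. *)
Lemma powR_ratio (R : realType) (l a g : R) : 0 < l -> g != 0 ->
  ((l + 1) `^ (- a) * g) ^+ 2 / ((l + l) `^ (- a) * g * ((1 + 1) `^ (- a) * g))
  = (4 * l / (l + 1) ^+ 2) `^ a.
Proof.
move=> l0 g0; have l1 : 0 < l + 1 by rewrite addr_gt0.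
have h : (4 * l / (l + 1) ^+ 2) `^ a * ((l + 1) `^ a) ^+ 2 = (l + l) `^ a * (1 + 1) `^ a.
  have l2 : 0 <= (l + 1) * (l + 1) by rewrite mulr_ge0 ?(ltW l1).
  rewrite !expr2 -!powRM ?l2 ?mulr_ge0 ?addr_ge0 ?invr_ge0 ?(ltW l0) ?(ltW l1)//.
  by congr (_ `^ a); field; rewrite gt_eqF.
have p1 : 0 < (l + 1) `^ a by exact: powR_gt0.
have -> : (4 * l / (l + 1) ^+ 2) `^ a = (l + l) `^ a * (1 + 1) `^ a / ((l + 1) `^ a) ^+ 2.
  by rewrite -h mulfK// expf_neq0// gt_eqF.
rewrite !powRN; field.
by rewrite g0 !gt_eqF// powR_gt0// addr_gt0.
Qed.

Lemma det_opp_norm (R : realType) (n : nat) (A : 'M[R]_n) : `|\det (- A)| = `|\det A|.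
Proof. by rewrite -scaleN1r detZ normrM normrX normrN1 expr1n mul1r. Qed.

Lemma prod_zset (R : realType) N (j : 'I_N.+1) (ts : 'rV[R]_N.+1) (f : 'I_N.+1 -> R) :
  ts ord0 j != 0 ->
  \prod_(k in zset ts) f k =
  \prod_(i < N) (if ts ord0 (lift j i) == 0 then f (lift j i) else 1).
Proof.
move=> j0; rewrite big_mkcond (bigD1_ord j)//= inE (negbTE j0) mul1r.
by apply: eq_bigr => i _; rewrite inE.
Qed.

Unset Implicit Arguments.

Theorem theorem5 (R : realType) (K : nat) (alpha : 'rV[R]_K)
  (H : 'rV[R]_K -> R) (ts : 'rV[R]_K) (lambda : 'I_K -> R) (mu : R) :
  (2 <= K)%N ->
  (forall i, 0 < alpha ord0 i) ->
  ts \in simplex R K ->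
  (* (A1) *)
  (forall t, t \in simplex R K -> t != ts -> H t < H ts) ->
  (* (A2) continuity on the simplex, C^2 on an open neighbourhood of ts *)
  {within simplex R K, continuous H} ->
  (exists N : set 'rV[R]_K, open N /\ N ts /\
     (forall x, N x -> forall i, derivable H x (delta_mx 0 i)) /\
     (forall x, N x -> forall i j, derivable (pderiv H i) x (delta_mx 0 j)) /\
     (forall x, N x -> forall i, {for x, continuous (pderiv H i)}) /\
     (forall x, N x -> forall i j,
        {for x, continuous (pderiv (pderiv H i) j)})) ->
  (* KKT multipliers: grad H(ts) = - sum_{i in Z} lambda_i e_i + mu 1 *)
  (forall i, pderiv H i ts
             = (if i \in zset ts then - lambda i else 0) + mu) ->
  (* (A3) *)
  (forall i, i \in zset ts -> 0 < lambda i) ->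
  (* (A4) *)
  (forall d : 'rV[R]_K, d != 0 -> \sum_(i < K) d ord0 i = 0 ->
     (forall i, i \in zset ts -> d ord0 i = 0) ->
     (d *m hessian H ts *m d^T) ord0 ord0 < 0) ->
  (* m <= K - 2 *)
  (#|zset ts| <= K - 2)%N ->
  let Q := (Umat ts)^T *m hessian H ts *m Umat ts in
  let Rm := - ((Umat ts)^T *m Dmat ts *m Umat ts) in
  let rho2 :=
    Num.sqrt `|\det Q| * Num.sqrt `|\det Rm| / `|\det (2^-1 *: (Q + Rm))|
    * \prod_(k in zset ts)
        ((4 * lambda k / (lambda k + 1) ^+ 2) `^ (alpha ord0 k)) in
  (fun n : nat =>
     (dir_corr alpha (fun t => expR (n%:R * H t))
                     (fun t => expE (n%:R%:E * Hhat H ts t)%E)) ^+ 2)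
    @ \oo --> rho2.
Proof.
case: K alpha H ts lambda mu => [|[|N]] // alpha H ts lambda mu _ al0 sts' A1' cH C2 kkt' A3' A4' mK.
have sts : simplex R N.+2 ts by rewrite inE in sts'.
have A1 t : simplex R N.+2 t -> t != ts -> H t < H ts by move=> st; apply: A1'; rewrite inE.
have kkt i : pderiv H i ts = (if ts ord0 i == 0 then - lambda i else 0) + mu.
  by rewrite kkt' inE.
have A3 i : ts ord0 i == 0 -> 0 < lambda i by move=> h; apply: A3'; rewrite inE.
have nH : tangent_negdef ts (hessian H ts).
  by move=> d d0 ds dz; apply: A4' => // i; rewrite inE => /eqP; exact: dz.
have [ts0 _] := sts.
have nD : tangent_negdef ts (- Dmat ts).
  move=> d d0 _ dz; rewrite qf_Dmat oppr_lt0.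
  have [i di] : exists i, d ord0 i != 0.
    apply: contrapT => no; move/eqP: d0; apply; apply/rowP => i; rewrite mxE.
    by apply/eqP/negPn/negP => h; apply: no; exists i.
  have ti : 0 < ts ord0 i.
    by rewrite lt_neqAle ts0 andbT eq_sym; apply/eqP => e; rewrite (dz i e) eqxx in di.
  rewrite (bigD1 i)//= ltr_pwDl//; first by rewrite divr_gt0// exprn_even_gt0.
  by apply: sumr_ge0 => k /andP[tk _]; rewrite divr_ge0 ?sqr_ge0 ?(ltW tk).
have sH : (hessian H ts)^T = hessian H ts by exact: hessian_sym.
have sD : (- Dmat ts)^T = - Dmat ts.
  rewrite linearN /=; congr (- _); apply/matrixP => i k; rewrite !mxE eq_sym.
  by case: eqP => // ->.
have sz : (0 < size (supp_seq ts))%N.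
  by rewrite size_supp_seq// subn_gt0 (leq_ltn_trans mK)// subSS ltnS leq_subr.
set j := supp_last ts.
have tj : 0 < ts ord0 j by exact: supp_last_gt0.
have j0 : ts ord0 j != 0 by rewrite gt_eqF.
have pX := peak_exp sts A1 cH C2 kkt.
have pY := peak_kl sts (expR_gt0 (H ts)).
have one k : ts ord0 k == 0 -> 0 < (1 : R) by [].
(* Dropping the term n = 0 gives sequences indexed by [k.+1], as in the Laplace limits. *)
move=> Q Rm rho2; rewrite -cvg_shiftS /=.
have e k : dir_corr alpha (fun t => expR (k.+1%:R * H t))
     (fun t => expE (k.+1%:R%:E * Hhat H ts t)%E)
   = dir_corr alpha (fun t => expR (H t) ^+ k.+1)
      (fun t => (expR (H ts) * kl_prod ts t) ^+ k.+1).
  by apply: eq_dir_corr => t st; [rewrite expRM_natl|rewrite expE_Hhat].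
under eq_cvg do rewrite e.
suff -> : rho2 = lap_int j alpha ts (fun k => lambda k + 1) (hessian H ts - Dmat ts) ^+ 2 /
   (lap_int j alpha ts (fun k => lambda k + lambda k) (hessian H ts + hessian H ts) *
    lap_int j alpha ts (fun k => 1 + 1) (- Dmat ts - Dmat ts)).
  exact: (cvg_dir_corr2 al0 sts j0 sH sD nH nD A3 one pX pY).
rewrite /lap_int.
have bw : base_weight j alpha ts != 0.
  rewrite mulf_neq0 ?gt_eqF ?powR_gt0//; apply: prodr_gt0 => i i0.
  by rewrite powR_gt0// lt_neqAle eq_sym i0 ts0.
have dpos A : A^T = A -> tangent_negdef ts A ->
    0 < \det (- ((Umat ts)^T *m A *m Umat ts)).
  move=> sA nA; rewrite -det_core_mx//; apply: posdef_det_gt0; first exact: core_mx_sym.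
  exact: core_mx_posdef.
have q0 := dpos _ sH nH; have r0 := dpos _ sD nD.
have s0 : 0 < \det (- ((Umat ts)^T *m (hessian H ts - Dmat ts) *m Umat ts)).
  apply: dpos; first by rewrite linearD /= sH sD.
  by move=> d d0 ds dz; rewrite qfD -[ltRHS]addr0 ltrD ?nH ?nD.
rewrite !det_core_mx//.
(* These powers of 2 match the one from halving Q + R: under the two square roots they contribute
   one factor c in all. *)
have dbl A : \det (- ((Umat ts)^T *m (A + A) *m Umat ts))
    = 2 ^+ (N.+1 - #|zset ts|) * \det (- ((Umat ts)^T *m A *m Umat ts)).
  by rewrite mulmxDr mulmxDl opprD -[in RHS]detZ scaler_nat mulr2n.
rewrite (dbl (hessian H ts)) (dbl (- Dmat ts)).
have eQ : `|\det Q| = \det (- ((Umat ts)^T *m hessian H ts *m Umat ts)).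
  by rewrite -det_opp_norm gtr0_norm.
have eR : `|\det Rm| = \det (- ((Umat ts)^T *m - Dmat ts *m Umat ts)).
  have -> : Rm = (Umat ts)^T *m - Dmat ts *m Umat ts by rewrite mulmxN mulNmx.
  by rewrite -det_opp_norm gtr0_norm.
have eS : `|\det (2^-1 *: (Q + Rm))| = (2 ^+ (N.+1 - #|zset ts|))^-1 *
    \det (- ((Umat ts)^T *m (hessian H ts - Dmat ts) *m Umat ts)).
  rewrite detZ normrM ger0_norm ?exprn_ge0 ?invr_ge0// exprVn; congr (_ * _).
  rewrite -det_opp_norm -[RHS]gtr0_norm//; congr (`|\det (- _)|).
  by rewrite mulmxDr mulmxDl mulmxN mulNmx.
rewrite /rho2 eQ eR eS (prod_zset _ j0).
set q := \det _ in q0 *; set r := \det _ in r0 *; set s := \det _ in s0 *.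
set c : R := 2 ^+ _; have c0 : 0 < c by rewrite exprn_gt0.
set f1 := \prod_(i < N.+1) _; set f2 := \prod_(i < N.+1) _.
set f3 := \prod_(i < N.+1) _; set f4 := \prod_(i < N.+1) _.
have g0 a : 0 < a -> fine (gammaE a) != 0 :> R.
  by move=> a0; rewrite gt_eqF// fine_gt0// gammaE_gt0 gammaE_lty.
have sq0 : Num.sqrt 2 * Num.sqrt pi != 0 :> R by rewrite mulf_neq0// gt_eqF// sqrtr_gt0 ?pi_gt0.
have f30 : f3 != 0.
  rewrite gt_eqF//; apply: (@lap_prod_gt0 _ _ j alpha ts (fun k => lambda k + lambda k)) => // k k0.
  by rewrite addr_gt0 ?A3.
have f40 : f4 != 0.
  by rewrite gt_eqF//; apply: (@lap_prod_gt0 _ _ j alpha ts (fun=> 1 + 1)).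
(* Compared factor by factor: [powR_ratio] at a vanishing coordinate, 1 at the others. *)
have -> : f1 = f2 ^+ 2 / (f3 * f4).
  rewrite -prodrXl -big_split -prodf_div; apply: eq_bigr => i _ /=.
  case: ifP => i0; first by rewrite powR_ratio ?A3 ?g0.
  by rewrite -expr2 divff// expf_neq0.
rewrite !sqrtrM ?(ltW c0)//.
(* [s] and [c] are written as squares of their roots so that [field] sees the same atoms on both
   sides. *)
have es : s = Num.sqrt s ^+ 2 by rewrite sqr_sqrtr// ltW.
have ec : c = Num.sqrt c ^+ 2 by rewrite sqr_sqrtr// ltW.
rewrite [in LHS]ec [in LHS]es; field.
by rewrite bw f30 f40 !sqrtr_eq0 -!ltNge c0 q0 r0 s0.
Qed.
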